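(* Let $c_1, d_1 > 0$, $c_2, d_2 \in \mathbb{R}\setminus\{0\}$ and $\tau>0$, and let $\mathscr{H}$ and $\mathscr{A}$ be as defined in the context. There exist constants $M, \omega > 0$ such that for any $V^0 \in \mathscr{H}$ and any $F \in L^2_{\mathrm{loc}}(0,\infty;\mathscr{H})$ there exists a unique mild solution $V \in C^0([0,\infty),\mathscr{H})$ of the abstract Cauchy problem $$\dot V(t) = \mathscr{A} V(t) + F(t) \quad (t>0), \qquad V(0) = V^0,$$ and $$\max_{t\in[0,T]} \|V(t)\|_{\mathscr{H}} \le M e^{\omega T} \|V^0\|_{\mathscr{H}} + M e^{\omega T}\|F\|_{L^2(0,T;\mathscr{H})} \quad \text{for all } T>0,$$ where $M,\omega$ are independent of $V^0$ and $F$. Moreover, if $V^0 \in D(\mathscr{A})$ and $F \in C^1([0,\infty),\mathscr{H}) \cup C^0([0,\infty),D(\mathscr{A}))$ (with $D(\mathscr{A})$ carrying the graph norm), then the mild solution is classical: $V \in C^1([0,\infty),\mathscr{H}) \cap C^0([0,\infty),D(\mathscr{A}))$.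
   Context: $\Omega \subset \mathbb{R}^d$ is a bounded Lipschitz domain with boundary $\Gamma$; $\Gamma_0,\Gamma_1\subset\Gamma$ are relatively open with $\Gamma = \bar{\Gamma}_0 \cup \bar{\Gamma}_1$, $\bar{\Gamma}_0 \cap \bar{\Gamma}_1 = \emptyset$, $\Gamma_0 \neq \emptyset$. Put $H^1_{\Gamma_0}(\Omega) = \{u \in H^1(\Omega) : u|_{\Gamma_0} = 0\}$ (real-valued functions). The extended phase space is $$\mathscr{H} = H^1_{\Gamma_0}(\Omega) \times L^2(\Omega) \times L^2\big(0,1; H^1_{\Gamma_0}(\Omega)\big) \times L^2\big(0,1; H^1_{\Gamma_0}(\Omega)\big)$$ with the inner product $$\langle U, V\rangle_{\mathscr{H}} = \int_\Omega \Big(c_1 \nabla u_1 \cdot \nabla v_1 + u_2 v_2 + \tau d_1 \int_0^1 \xi e^{cs} \nabla u_3 \cdot \nabla v_3 \, ds + \tau |d_2| \int_0^1 \xi e^{cs} \nabla u_4 \cdot \nabla v_4 \, ds\Big) dx$$ for $U=(u_1,\dots,u_4)^T$, $V=(v_1,\dots,v_4)^T$, where $\xi = \frac{d_1}{3|d_2|}$ and $c > \ln\big(\max\big\{\frac{9 c_2^2 |d_2|}{d_1^3}, \frac{9 d_2^2}{d_1^2}\big\}\big)$ is a fixed constant. The topology is equivalent to the standard product topology. For $V=(v_1,v_2,v_3,v_4)^T$ (with $v_3,v_4$ functions of $s\in(0,1)$ and $x\in\Omega$), set $$\mathscr{A} V = \begin{pmatrix} v_2 \\ c_1 \triangle v_1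 + c_2 \triangle v_3|_{s=1} + d_1 \triangle v_2 + d_2 \triangle v_4|_{s=1} \\ -\tau^{-1} \partial_s v_3 \\ -\tau^{-1}\partial_s v_4 \end{pmatrix},$$ where the second component is understood as a distribution on $\Omega$, with domain $D(\mathscr{A})$ consisting of all $V \in \mathscr{H}$ such that $\mathscr{A}V \in \mathscr{H}$, $v_3|_{s=0} = v_1$, $v_4|_{s=0} = v_2$, and the Green's formula $$\int_\Omega \big(c_1 \triangle v_1 + c_2 \triangle v_3|_{s=1} + d_1 \triangle v_2 + d_2 \triangle v_4|_{s=1}\big)\psi\,dx = -\int_\Omega \big(c_1 \nabla v_1 + c_2 \nabla v_3|_{s=1} + d_1 \nabla v_2 + d_2 \nabla v_4|_{s=1}\big)\cdot \nabla\psi\,dx$$ holds for every $\psi \in H^1_{\Gamma_0}(\Omega)$. The operator $\mathscr{A}$ generates a $C_0$-semigroup $(e^{t\mathscr{A}})_{t\ge0}$ on $\mathscr{H}$; the mild solution is understood in the usual semigroup sense (variation of constants formula). *)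

(* Defs.v *)
From HB Require Import structures.
From mathcomp Require Import all_boot all_order all_algebra.
From mathcomp Require Import all_classical all_reals all_analysis.
From mathcomp Require Import measurable_realfun.

Set Implicit Arguments.
Unset Strict Implicit.
Unset Printing Implicit Defensive.

Import Order.TTheory GRing.Theory Num.Def Num.Theory.
Import numFieldNormedType.Exports.

Local Open Scope classical_set_scope.
Local Open Scope ring_scope.

Section cover_outer_measure.
Local Open Scope ereal_scope.
Context {R : realType} {T : pointedType}.

(* The outer measure generated by the weight w through countable covers. *)
Definition cover_outer (w : set T -> \bar R) (A : set T) : \bar R :=
  ereal_inf [set \sum_(k <oo) w (C k) | C in
    [set C : (set T)^nat | A `<=` \bigcup_k C k]].

Variable w : set T -> \bar R.
Hypotheses (w0 : w set0 = 0) (w_ge0 : forall A, 0 <= w A).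

Lemma cover_outerE :
  cover_outer w = @mu_ext _ (g_sigma_algebraType [set: set T]) R w.
Proof.
apply/funext => A; congr ereal_inf; apply/seteqP; split => x [C CA <-].
  by exists C => //; split=> // i; apply: sub_sigma_algebra.
by exists C => //; case: CA.
Qed.

Lemma cover_outer0 : cover_outer w set0 = 0.
Proof. by rewrite cover_outerE; exact: mu_ext0. Qed.

Lemma cover_outer_ge0 A : 0 <= cover_outer w A.
Proof. by rewrite cover_outerE; exact: mu_ext_ge0. Qed.

Lemma le_cover_outer : {homo cover_outer w : A B / A `<=` B >-> A <= B}.
Proof. by move=> A B AB; rewrite cover_outerE; exact: le_mu_ext. Qed.

Lemma cover_outer_sigma_subadditive : sigma_subadditive (cover_outer w).
Proof. by rewrite cover_outerE => F; exact: mu_ext_sigma_subadditive. Qed.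

End cover_outer_measure.

Section restriction_outer_measure.
Local Open Scope ereal_scope.
Context {R : realType} {T : Type}.
Variables (mu : {outer_measure set T -> \bar R}) (D : set T).

(* D need not be measurable; if it is, this is the usual restriction. *)
Definition outer_restr (A : set T) : \bar R := mu (A `&` D).

Let restr0 : outer_restr set0 = 0.
Proof. by rewrite /outer_restr set0I outer_measure0. Qed.
Let restr_ge0 A : 0 <= outer_restr A.
Proof. exact: outer_measure_ge0. Qed.
Let le_restr : {homo outer_restr : A B / A `<=` B >-> A <= B}.
Proof. by move=> A B AB; apply: le_outer_measure; exact: setSI. Qed.
Let restr_sigma_subadditive : sigma_subadditive outer_restr.
Proof.
move=> F; rewrite /outer_restr setI_bigcupl.
exact: (outer_measure_sigma_subadditive mu (fun n => F n `&` D)).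
Qed.

HB.instance Definition _ := isOuterMeasure.Build R T outer_restr
  restr0 restr_ge0 le_restr restr_sigma_subadditive.

End restriction_outer_measure.

Section euclidean_space.
Context {R : realType} {n : nat}.
Implicit Types (x y : 'rV[R]_n) (A : set 'rV[R]_n).

Definition dotv x y : R := \sum_(i < n) x 0 i * y 0 i.

Definition enormv x : R := Num.sqrt (dotv x x).

Definition ediam A : \bar R :=
  ereal_sup [set z | exists x y, [/\ A x, A y & z = (enormv (x - y))%:E]].

Definition box x y : set 'rV[R]_n :=
  [set z | forall i, x 0 i <= z 0 i <= y 0 i].

End euclidean_space.

Section lebesgue_Rd.
Local Open Scope ereal_scope.
Context {R : realType} {d : nat}.
Notation E := 'rV[R]_d.+1.

Definition box_volume (A : set E) : \bar R :=
  ereal_inf [set v | exists a b : E, [/\ forall i, (a 0%R i <= b 0%R i)%R,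
    A `<=` box a b & v = (\prod_(i < d.+1) (b 0%R i - a 0%R i))%:E]].

Let box_volume_ge0 A : 0 <= box_volume A.
Proof.
apply: le_ereal_inf_tmp => _ [a [b [ab _ ->]]].
by rewrite lee_fin; apply: prodr_ge0 => i _; rewrite subr_ge0.
Qed.

Let box_volume0 : box_volume set0 = 0.
Proof.
apply/eqP; rewrite eq_le box_volume_ge0 andbT; apply: ereal_inf_lbound.
by exists 0%R, 0%R; split => //; rewrite big_ord_recl subrr mul0r.
Qed.

Definition lebesgue_outer : set E -> \bar R := cover_outer box_volume.

HB.instance Definition _ := isOuterMeasure.Build R E lebesgue_outer
  (cover_outer0 box_volume0 box_volume_ge0) (cover_outer_ge0 box_volume_ge0)
  (@le_cover_outer _ _ _)
  (cover_outer_sigma_subadditive box_volume_ge0).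

End lebesgue_Rd.

Section hausdorff_measure.
Local Open Scope ereal_scope.
Context {R : realType} {d : nat}.
Notation E := 'rV[R]_d.+1.

(* No normalising constant: for k the dimension of a hypersurface this is a
   constant multiple of the surface measure. *)
Definition hausdorff_weight (k : nat) (delta : R) (A : set E) : \bar R :=
  if pselect (A = set0) then 0
  else if ediam A <= delta%:E then ediam A ^+ k else +oo.

Let ediam_ge0 A : A <> set0 -> 0 <= @ediam R d.+1 A.
Proof.
move=> /eqP /set0P [x Ax]; apply: (@le_trans _ _ (enormv (x - x))%:E).
  by rewrite lee_fin sqrtr_ge0.
by apply: ereal_sup_ubound; exists x, x.
Qed.

Let weight_ge0 k delta A : 0 <= hausdorff_weight k delta A.
Proof.
rewrite /hausdorff_weight; case: pselect => // A0; case: ifPn => // _.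
exact/expe_ge0/ediam_ge0.
Qed.

Let weight0 k delta : hausdorff_weight k delta set0 = 0.
Proof. by rewrite /hausdorff_weight; case: pselect. Qed.

Definition hausdorff_outer (k : nat) (A : set E) : \bar R :=
  ereal_sup [set cover_outer (hausdorff_weight k delta) A | delta in
    [set delta | (0 < delta)%R]].

Let hausdorff0 k : hausdorff_outer k set0 = 0.
Proof.
apply/eqP; rewrite eq_le; apply/andP; split.
  by apply: ge_ereal_sup => _ [delta _ <-]; rewrite cover_outer0.
apply: (@le_trans _ _ (cover_outer (hausdorff_weight k 1) set0)).
  by rewrite cover_outer0.
by apply: ereal_sup_ubound; exists 1%R => /=.
Qed.

Let hausdorff_ge0 k A : 0 <= hausdorff_outer k A.
Proof.
apply: (@le_trans _ _ (cover_outer (hausdorff_weight k 1) A)).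
  exact: cover_outer_ge0.
by apply: ereal_sup_ubound; exists 1%R => /=.
Qed.

Let le_hausdorff k : {homo hausdorff_outer k : A B / A `<=` B >-> A <= B}.
Proof.
move=> A B AB; apply: ge_ereal_sup => _ [delta delta0 <-].
apply: (le_trans (le_cover_outer _ AB)).
by apply: ereal_sup_ubound; exists delta.
Qed.

Let hausdorff_sigma_subadditive k : sigma_subadditive (hausdorff_outer k).
Proof.
move=> F; apply: ge_ereal_sup => _ [delta delta0 <-].
apply: (le_trans (cover_outer_sigma_subadditive _ _)) => //.
apply: lee_nneseries => [n _ _|n _]; first exact: cover_outer_ge0.
by apply: ereal_sup_ubound; exists delta.
Qed.

HB.instance Definition _ k := isOuterMeasure.Build R E (hausdorff_outer k)
  (hausdorff0 k) (hausdorff_ge0 k) (@le_hausdorff k)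
  (hausdorff_sigma_subadditive k).

End hausdorff_measure.

Section strong_measurability.
Context {disp : measure_display} {T : measurableType disp} {R : realType}
  {X : normedModType R}.
Implicit Types (f s : T -> X).

Definition simple_function s :=
  finite_set (range s) /\ forall x, measurable (s @^-1` [set x]).

Definition strongly_measurable (D : set T) f :=
  exists s_ : (T -> X)^nat, (forall n, simple_function (s_ n)) /\
    forall x, D x -> s_ n x @[n --> \oo] --> f x.

Definition sq_integrable (mu : {measure set T -> \bar R}) f :=
  strongly_measurable setT f /\
  (\int[mu]_x ((`|f x| ^+ 2)%:E) < +oo)%E.

Lemma simple_function_cst (c : X) : simple_function (cst c).
Proof.
split=> [|x]; first by apply: (@sub_finite_set _ _ [set c]) => //= _ [x _ <-].
have [->|cx] := pselect (c = x); first by rewrite preimage_cst mem_set.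
by rewrite preimage_cst memNset//; exact: cx.
Qed.

Lemma simple_function_comb (a : R) s t :
  simple_function s -> simple_function t -> simple_function (a *: s + t).
Proof.
move=> [fs ms] [ft mt]; split.
  apply: (@sub_finite_set _ _ [set a *: p.1 + p.2 | p in range s `*` range t]).
    by move=> _ [x _ <-]; exists (s x, t x) => //; split; exists x.
  exact/finite_image/finite_setX.
move=> y; rewrite (_ : _ @^-1` _ = \bigcup_(p in
    [set p | (range s `*` range t) p /\ a *: p.1 + p.2 = y])
    (s @^-1` [set p.1] `&` t @^-1` [set p.2])).
  apply: fin_bigcup_measurable => [|p _]; last exact: measurableI.
  by apply: (@sub_finite_set _ _ (range s `*` range t)) => [p []//|];
    exact: finite_setX.
apply/seteqP; split => [x /= <-|x [p [_ py] [/= sx tx]]].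
  by exists (s x, t x) => //; split=> //; split; exists x.
change (a *: s x + t x = y); by rewrite sx tx.
Qed.

Lemma simple_function_norm s : simple_function s ->
  measurable_fun setT (fun x => `|s x|).
Proof.
move=> [fs ms] _ Y mY; rewrite setTI.
rewrite (_ : _ @^-1` _ = \bigcup_(p in [set p | range s p /\ Y `|p|])
    (s @^-1` [set p])).
  apply: fin_bigcup_measurable => [|p _]; last exact: ms.
  by apply: sub_finite_set fs => p [].
apply/seteqP; split => [x /= Yx|x [p [_ Yp] /= sx]]; last by rewrite sx.
by exists (s x) => //; split => //; exists x.
Qed.

Lemma strongly_measurable_comb D (a : R) f g : strongly_measurable D f ->
  strongly_measurable D g -> strongly_measurable D (a *: f + g).
Proof.
move=> [s [ss sf]] [t [st tg]]; exists (fun n => a *: s n + t n); split.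
  by move=> n; exact: simple_function_comb.
move=> x Dx; apply: cvgD; last exact: tg.
by apply: cvgZr; exact: sf.
Qed.

Lemma strongly_measurable_norm f : strongly_measurable setT f ->
  measurable_fun setT (fun x => `|f x|).
Proof.
move=> [s [ss sf]].
apply: (@measurable_fun_cvg _ _ _ _ (fun n x => `|s n x|)).
  by move=> n; exact: simple_function_norm.
by move=> x _; apply: cvg_norm; exact: sf.
Qed.

End strong_measurability.

Section L2_space.
Context {disp : measure_display} {T : measurableType disp} {R : realType}.
Variables (mu : {measure set T -> \bar R}) (X : normedModType R).
Implicit Types f g : T -> X.

Definition L2_pred : {pred T -> X} := mem [set f | sq_integrable mu f].

Definition L2_seminorm f : R := Num.sqrt (\int[mu]_x (`|f x| ^+ 2))%R.

Let sqE f : (\int[mu]_x ((`|f x| ^+ 2)%:E) =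
  \int[mu]_x (`|(`|f x|%R)%:E| `^ 2))%E.
Proof.
apply: eq_integral => x _.
by rewrite /= normr_id -powR_mulrn.
Qed.

Lemma L2_seminormE f : sq_integrable mu f ->
  (L2_seminorm f)%:E = 'N[mu]_2%:E[EFin \o (fun x => `|f x|%R)]%E.
Proof.
move=> [mf foo]; rewrite unlock /Lnorm -sqE /L2_seminorm /Rintegral.
rewrite -[in RHS](@fineK _ (\int[mu]_x _)%E).
  by rewrite poweR_EFin powR12_sqrt// fine_ge0// integral_ge0.
by rewrite ge0_fin_numE// integral_ge0.
Qed.

Let sq_integrable_Lnorm f : strongly_measurable setT f ->
  ('N[mu]_2%:E[EFin \o (fun x => `|f x|%R)] < +oo)%E -> sq_integrable mu f.
Proof.
move=> mf foo; split=> //; rewrite sqE.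
apply: (@lty_poweRy _ _ 2^-1); first by rewrite invr_neq0.
by move: foo; rewrite unlock.
Qed.

Lemma L2_scale (a : R) f : sq_integrable mu f ->
  sq_integrable mu (a *: f) /\ L2_seminorm (a *: f) = `|a| * L2_seminorm f.
Proof.
move=> Lf; have [mf foo] := Lf.
have maf : strongly_measurable setT (a *: f).
  have [s [ss sf]] := mf; exists (fun n => a *: s n); split=> [n|x _].
    rewrite -[_ *: _]addr0; apply: simple_function_comb => //.
    exact: simple_function_cst.
  by apply: cvgZr; exact: sf.
have afE : (\int[mu]_x ((`|(a *: f) x| ^+ 2)%:E) =
    (`|a| ^+ 2)%:E * \int[mu]_x ((`|f x| ^+ 2)%:E))%E.
  rewrite -ge0_integralZl//=; last first.
    apply/measurable_EFinP; apply: measurable_funX.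
    exact: strongly_measurable_norm.
  by apply: eq_integral => x _; rewrite -EFinM -exprMn -normrZ.
split; first by split => //; rewrite afE lte_mul_pinfty ?lee_fin ?exprn_ge0.
rewrite /L2_seminorm /Rintegral afE fineM//=; last first.
  by rewrite ge0_fin_numE// integral_ge0.
by rewrite sqrtrM ?exprn_ge0// sqrtr_sqr normr_id.
Qed.

Lemma L2_add f g : sq_integrable mu f -> sq_integrable mu g ->
  sq_integrable mu (f + g) /\
  L2_seminorm (f + g) <= L2_seminorm f + L2_seminorm g.
Proof.
move=> Lf Lg; have [[mf _] [mg _]] := (Lf, Lg).
have mfn := strongly_measurable_norm mf; have mgn := strongly_measurable_norm mg.
have mfg : strongly_measurable setT (f + g).
  by rewrite -[f]scale1r; exact: strongly_measurable_comb.
have mfgn := strongly_measurable_norm mfg.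
have le : ('N[mu]_2%:E[EFin \o (fun x => `|(f + g)%R x|%R)] <=
    (L2_seminorm f)%:E + (L2_seminorm g)%:E)%E.
  rewrite (L2_seminormE Lf) (L2_seminormE Lg); apply: le_trans; last first.
    by apply: minkowski_EFin => //; rewrite ler1n.
  rewrite unlock /Lnorm; apply: gt0_ler_poweR; rewrite ?invr_ge0//.
  - by rewrite in_itv/= leey andbT integral_ge0.
  - by rewrite in_itv/= leey andbT integral_ge0.
  have mpow (h : T -> R) : measurable_fun setT h ->
      measurable_fun setT (fun x => `|(EFin \o h) x| `^ 2)%E.
    move=> mh; apply: (measurableT_comp (measurable_poweR 2)).
    by apply: measurableT_comp => //; exact/measurable_EFinP.
  apply: ge0_le_integral => //.
  - by move=> x _; exact: poweR_ge0.
  - exact: mpow.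
  - exact/mpow/measurable_funD.
  - by move=> x _; rewrite lee_fin ge0_ler_powR ?nnegrE// !normr_id
      ger0_norm ?addr_ge0// ler_normD.
have Lfg : sq_integrable mu (f + g).
  apply: sq_integrable_Lnorm => //; apply: (le_lt_trans le).
  by rewrite -EFinD ltry.
by split=> //; rewrite -lee_fin EFinD L2_seminormE.
Qed.

Lemma L2_zero : sq_integrable mu (0 : T -> X) /\ L2_seminorm 0 = 0.
Proof.
have i0 : (\int[mu]_x ((`|(0 : T -> X) x| ^+ 2)%:E) = 0)%E.
  by rewrite (eq_integral (cst 0%E)) ?integral0// => x _; rewrite normr0 expr0n.
split; last by rewrite /L2_seminorm /Rintegral i0 sqrtr0.
split; last by rewrite i0 ltry.
exists (fun=> 0); split=> [_|x _]; last exact: cvg_cst.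
exact: simple_function_cst.
Qed.

Record L2fun := MkL2fun { L2fun_val : T -> X; _ : L2fun_val \in L2_pred }.

HB.instance Definition _ := [isSub for L2fun_val].
HB.instance Definition _ := [Choice of L2fun by <:].

Let L2_submod_closed : submod_closed L2_pred.
Proof.
split=> [|a f g]; first by rewrite inE; exact: L2_zero.1.
rewrite !inE => Lf Lg.
exact: (L2_add (L2_scale a Lf).1 Lg).1.
Qed.

HB.instance Definition _ := GRing.isSubmodClosed.Build _ _ L2_pred
  L2_submod_closed.
HB.instance Definition _ := [SubChoice_isSubLmodule of L2fun by <:].

Lemma L2funP (f : L2fun) : sq_integrable mu (val f).
Proof. by have := valP f; rewrite inE. Qed.

Let N (f : L2fun) := L2_seminorm (val f).

Let N0 : N 0 = 0. Proof. exact: L2_zero.2. Qed.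
Let ND (f g : L2fun) : N (f + g) <= N f + N g.
Proof. exact: (L2_add (L2funP f) (L2funP g)).2. Qed.
Let NZ a (f : L2fun) : N (a *: f) = `|a| * N f.
Proof. exact: (L2_scale a (L2funP f)).2. Qed.
Let N_ge0 (f : L2fun) : 0 <= N f. Proof. exact: sqrtr_ge0. Qed.
Let NN (f : L2fun) : N (- f) = N f.
Proof. by rewrite -scaleN1r NZ normrN1 mul1r. Qed.

(* L2_eq is almost-everywhere equality: see L2_eqP. *)
Definition L2_eq (f g : L2fun) : bool := N (f - g) == 0.

Let N_eq (f g : L2fun) : N (f - g) = 0 -> N f = N g.
Proof.
have key u v : N (u - v) = 0 -> N u <= N v.
  by move=> uv; rewrite -[u](subrK v) (le_trans (ND _ _))// uv add0r.
by move=> fg; apply/eqP; rewrite eq_le !key// -NN opprB.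
Qed.

Let L2_eq_refl : reflexive L2_eq.
Proof. by move=> f; rewrite /L2_eq subrr N0. Qed.
Let L2_eq_sym : symmetric L2_eq.
Proof. by move=> f g; rewrite /L2_eq -NN opprB. Qed.
Let L2_eq_trans : transitive L2_eq.
Proof.
move=> g f h /eqP fg /eqP gh; rewrite /L2_eq eq_le N_ge0 andbT.
by rewrite -(subrKA g) (le_trans (ND _ _))// fg gh addr0.
Qed.

Canonical L2_equiv := EquivRel L2_eq L2_eq_refl L2_eq_sym L2_eq_trans.

Lemma L2_eqP (f g : L2fun) :
  L2_eq f g <-> {ae mu, forall x, val f x = val g x}.
Proof.
have vfg x : val (f - g) x = val f x - val g x by [].
have Lfg := L2funP (f - g).
have mfg : measurable_fun setT (EFin \o (fun x => `|val (f - g) x|)).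
  exact/measurable_EFinP/strongly_measurable_norm/Lfg.1.
rewrite /L2_eq; split => [/eqP N0fg|fg].
  have := L2_seminormE Lfg; rewrite (_ : L2_seminorm _ = 0)// => /esym.
  have p2 : (0%R < 2%:E :> \bar R)%E by rewrite lte_fin.
  move/(Lnorm_eq0_eq0 mfg p2); apply: filterS => x /(_ I) /= [].
  move=> /eqP; rewrite normr_eq0 => /eqP fg0.
  by apply/eqP; rewrite -subr_eq0 -vfg; exact/eqP.
apply/eqP; rewrite /N /L2_seminorm /Rintegral.
rewrite (ae_eq_integral (cst 0%E))//; first by rewrite integral0 sqrtr0.
- apply/measurable_EFinP; apply: measurable_funX.
  exact/measurable_EFinP.
- by apply: filterS fg => x fgx _; rewrite vfg fgx subrr normr0 expr0n.
Qed.

Local Open Scope quotient_scope.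

Definition L2 : Type := {eq_quot L2_eq}.
HB.instance Definition _ := Choice.on L2.
HB.instance Definition _ := EqQuotient.on L2.

Implicit Types u v w : L2.

Let zero : L2 := \pi_L2 0.
Let add u v : L2 := \pi_L2 (repr u + repr v).
Let opp u : L2 := \pi_L2 (- repr u).
Let scale (a : R) u : L2 := \pi_L2 (a *: repr u).

Let piE (f g : L2fun) : N (f - g) = 0 -> \pi_L2 f = \pi_L2 g.
Proof. by move=> fg; apply/eqP; rewrite eqmodE; apply/eqP. Qed.
Let reprE (f : L2fun) : N (repr (\pi_L2 f) - f) = 0.
Proof.
have /eqP : \pi_L2 (repr (\pi_L2 f)) = \pi_L2 f by rewrite reprK.
by rewrite eqmodE => /eqP.
Qed.
Let le0 x : x <= 0 -> 0 <= x -> x = 0 :> R.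
Proof. by move=> x0 x1; apply/eqP; rewrite eq_le x0. Qed.

Let addE (f g : L2fun) : add (\pi_L2 f) (\pi_L2 g) = \pi_L2 (f + g).
Proof.
apply: piE; apply: le0 => //; rewrite opprD addrACA (le_trans (ND _ _))//.
by rewrite !reprE addr0.
Qed.
Let oppE (f : L2fun) : opp (\pi_L2 f) = \pi_L2 (- f).
Proof. by apply: piE; rewrite -opprD NN reprE. Qed.
Let scaleE a (f : L2fun) : scale a (\pi_L2 f) = \pi_L2 (a *: f).
Proof. by apply: piE; rewrite -scalerBr NZ reprE mulr0. Qed.

Let piP u : exists f : L2fun, u = \pi_L2 f.
Proof. by exists (repr u); rewrite reprK. Qed.

Let addA : associative add.
Proof.
move=> u v w; have [f ->] := piP u; have [g ->] := piP v.
by have [h ->] := piP w; rewrite !addE addrA.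
Qed.
Let addC : commutative add.
Proof.
move=> u v; have [f ->] := piP u; have [g ->] := piP v.
by rewrite !addE addrC.
Qed.
Let add0 : left_id zero add.
Proof. by move=> u; have [f ->] := piP u; rewrite /zero addE add0r. Qed.
Let addN : left_inverse zero opp add.
Proof. by move=> u; have [f ->] := piP u; rewrite oppE addE addNr. Qed.

HB.instance Definition _ := GRing.isZmodule.Build L2 addA addC add0 addN.

Let scaleA a b u : scale a (scale b u) = scale (a * b) u.
Proof. by have [f ->] := piP u; rewrite !scaleE scalerA. Qed.
Let scale1 : left_id 1 scale.
Proof. by move=> u; have [f ->] := piP u; rewrite scaleE scale1r. Qed.
Let scaleDr : right_distributive scale +%R.
Proof.
move=> a u v; have [f ->] := piP u; have [g ->] := piP v.
change (scale a (add (\pi_L2 f) (\pi_L2 g)) =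
  add (scale a (\pi_L2 f)) (scale a (\pi_L2 g))).
by rewrite addE !scaleE addE scalerDr.
Qed.
Let scaleDl u : {morph scale^~ u : a b / a + b}.
Proof.
move=> a b; have [f ->] := piP u.
change (scale (a + b) (\pi_L2 f) =
  add (scale a (\pi_L2 f)) (scale b (\pi_L2 f))).
by rewrite !scaleE addE scalerDl.
Qed.

HB.instance Definition _ := GRing.Zmodule_isLmodule.Build R L2
  scaleA scale1 scaleDr scaleDl.

Let normv u := N (repr u).

Let normE (f : L2fun) : normv (\pi_L2 f) = N f.
Proof. by apply: N_eq; exact: reprE. Qed.
Let normD u v : normv (u + v) <= normv u + normv v.
Proof.
have [f ->] := piP u; have [g ->] := piP v.
change (normv (add (\pi_L2 f) (\pi_L2 g)) <=
  normv (\pi_L2 f) + normv (\pi_L2 g)).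
by rewrite addE !normE.
Qed.
Let normZ a u : normv (a *: u) = `|a| * normv u.
Proof.
have [f ->] := piP u.
change (normv (scale a (\pi_L2 f)) = `|a| * normv (\pi_L2 f)).
by rewrite scaleE !normE.
Qed.
Let norm0 u : normv u = 0 -> u = 0.
Proof.
by have [f ->] := piP u; rewrite normE => u0; apply: piE; rewrite subr0.
Qed.

HB.instance Definition _ := Lmodule_isNormed.Build R L2 normD normZ norm0.

Definition L2repr u : T -> X := val (repr u).

(* u is the class of f; in particular f is square-integrable. *)
Definition class_of u f := exists2 h : L2fun, val h = f & \pi_L2 h = u.

Lemma class_of0 : class_of 0 0. Proof. by exists 0. Qed.

Lemma class_of_comb (a : R) u v f g :
  class_of u f -> class_of v g -> class_of (a *: u + v) (a *: f + g).
Proof.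
move=> [h <- <-] [k <- <-]; exists (a *: h + k) => //.
change (\pi_L2 (a *: h + k) = add (scale a (\pi_L2 h)) (\pi_L2 k)).
by rewrite scaleE addE.
Qed.

End L2_space.

Definition carath_measure {R : realType} {T : pointedType}
    (mu : {outer_measure set T -> \bar R}) :
    {measure set (caratheodory_type mu) -> \bar R} :=
  (mu : set (caratheodory_type mu) -> \bar R).

Section bochner_integral.
Context {disp : measure_display} {T : measurableType disp} {R : realType}.
Variables (mu : {measure set T -> \bar R}) (X : normedModType R).

Definition simple_integral (D : set T) (s : T -> X) : X :=
  \sum_(x \in range s) fine (mu (D `&` s @^-1` [set x])) *: x.

(* I is the Bochner integral of f over D. *)
Definition is_bochner (D : set T) (f : T -> X) (I : X) :=
  exists s_ : (T -> X)^nat,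
    [/\ forall n, simple_function (s_ n),
        forall n x, x <> 0 -> (mu (D `&` s_ n @^-1` [set x]) < +oo)%E,
        forall t, D t -> s_ n t @[n --> \oo] --> f t,
        (\int[mu]_(t in D) (`|f t - s_ n t|%:E))%E @[n --> \oo] --> 0%E &
        simple_integral D (s_ n) @[n --> \oo] --> I].

End bochner_integral.

Section abstract_cauchy_problem.
Context {R : realType} {X : normedModType R}.
Implicit Types (S : R -> X -> X) (A : X -> X -> Prop) (F V : R -> X).

Definition C0_semigroup S :=
  [/\ forall t, 0 <= t -> linear (S t) /\ continuous (S t),
      forall x, S 0 x = x,
      forall s t x, 0 <= s -> 0 <= t -> S (s + t) x = S s (S t x) &
      forall x, S t x @[t --> 0^'+] --> x].

(* An unbounded operator is given by its graph: A x y stands for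
   x \in D(A) and A x = y. *)
Definition op_domain A : set X := [set x | exists y, A x y].

Definition generates A S :=
  forall x y, A x y <-> t^-1 *: (S t x - x) @[t --> 0^'+] --> y.

Definition C0_ge0 V := {within `[0, +oo[, continuous V}.

Definition C1_ge0 V := exists2 V' : R -> X, C0_ge0 V' & forall t, 0 <= t ->
  (s - t)^-1 *: (V s - V t) @[s --> within `[0, +oo[ t^'] --> V' t.

(* Continuity into D(A), normed by x |-> `|x| + `|A x|. *)
Definition C0_ge0_domain A V := exists2 W : R -> X,
  forall t, 0 <= t -> A (V t) (W t) &
  forall t, 0 <= t ->
    `|V s - V t| + `|W s - W t| @[s --> within `[0, +oo[ (nbhs t)] --> (0 : R).

Definition L2loc F := strongly_measurable (`]0, +oo[ : set (measurableTypeR R)) F /\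
  forall T, 0 < T -> (\int[lebesgue_measure]_(t in `]0%R, T[) ((`|F t| ^+ 2)%:E) < +oo)%E.

Definition mild_solution S (V0 : X) F V :=
  C0_ge0 V /\ forall t, 0 <= t -> exists2 I : X,
    is_bochner lebesgue_measure `]0, t[ (fun s => S (t - s) (F s)) I &
    V t = S t V0 + I.

Definition classical_solution A (V0 : X) F V :=
  [/\ C1_ge0 V, C0_ge0_domain A V, V 0 = V0 &
      forall t, 0 < t -> exists2 y, A (V t) y &
        (s - t)^-1 *: (V s - V t) @[s --> t^'] --> y + F t].

End abstract_cauchy_problem.

Section domains.
Context {R : realType} {d : nat}.
Notation E := 'rV[R]_d.+1.
Implicit Types (Omega Gamma : set E).

Definition boundary Omega : set E := closure Omega `\` Omega°.

(* In the direction e, Omega is near x the open epigraph of gamma, a function of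
   the component of y orthogonal to e. *)
Definition lipschitz_domain Omega :=
  [/\ Omega !=set0, open Omega, connected Omega, bounded_set Omega &
      forall x, boundary Omega x ->
        exists (e : E) (gamma : E -> R) (L r : R),
        [/\ dotv e e = 1, 0 < r,
            forall y z, `|gamma y - gamma z| <= L * `|y - z| &
            forall y, ball x r y ->
              Omega y <-> gamma (y - dotv y e *: e) < dotv y e]].

Definition relatively_open (Gamma Gamma0 : set E) :=
  exists2 U, open U & Gamma0 = Gamma `&` U.

Definition domain_measure Omega := carath_measure (outer_restr lebesgue_outer Omega).

Definition surface_measure Gamma :=
  carath_measure (outer_restr (hausdorff_outer d) Gamma).

Definition partial (i : 'I_d.+1) (phi : E -> R) : E -> R :=
  fun x => 'D_(delta_mx 0 i) phi x.

Definition gradient (phi : E -> R) : E -> E := fun x => \row_i partial i phi x.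

Definition laplacian (phi : E -> R) : E -> R :=
  fun x => \sum_i partial i (partial i phi) x.

Definition smooth (phi : E -> R) := forall s : seq 'I_d.+1,
  let psi := foldr partial phi s in
  continuous psi /\ forall x i, derivable psi x (delta_mx 0 i).

Definition test_function Omega (phi : E -> R) := smooth phi /\
  exists K : set E, [/\ compact K, K `<=` Omega & forall x, ~ K x -> phi x = 0].

End domains.


Lemma Rintegral_comb {disp : measure_display} {T : measurableType disp}
    {R : realType} {mu : {measure set T -> \bar R}} (a : R) (p q : T -> R) :
  mu.-integrable setT (EFin \o p) -> mu.-integrable setT (EFin \o q) ->
  mu.-integrable setT (EFin \o (fun x => a * p x + q x)) /\
  (\int[mu]_x (a * p x + q x) = a * \int[mu]_x p x + \int[mu]_x q x)%R.
Proof.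
move=> ip iq.
have iap : mu.-integrable setT (EFin \o (fun x => a * p x)).
  have := integrableZl measurableT a ip.
  by apply: eq_integrable => // x _; rewrite /= EFinM.
split; last by rewrite RintegralD// RintegralZl.
have := integrableD measurableT iap iq.
by apply: eq_integrable => // x _; rewrite /= EFinD.
Qed.

Lemma closure_comb {R : realType} {V : normedModType R} (A : set V) (a : R) :
  (forall u v, A u -> A v -> A (a *: u + v)) ->
  forall u v, closure A u -> closure A v -> closure A (a *: u + v).
Proof.
move=> Aa u v Au Av B nB.
have cf : (fun z : V * V => a *: z.1 + z.2) z @[z --> (u, v)] --> a *: u + v.
  by apply: cvgD; [apply: cvgZr; exact: cvg_fst|exact: cvg_snd].
have [[P Q] [/= nP nQ] PQ] := cf _ nB.
have [x [Ax Px]] := Au _ nP; have [y [Ay Qy]] := Av _ nQ.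
by exists (a *: x + y); split; [exact: Aa|exact: (PQ (x, y))].
Qed.

Section sobolev_space.
Context {R : realType} {d : nat}.
Variables Omega Gamma0 : set 'rV[R]_d.+1.
Notation E := 'rV[R]_d.+1.
Notation mu := (domain_measure Omega).
Notation L2s := (L2 mu R^o).
Notation L2v := (L2 mu E).
Notation L2b := (L2 (surface_measure Gamma0) R^o).

(* For Omega bounded, both integrability conditions hold as soon as f and G are
   square-integrable. *)
Definition is_weak_gradient (f : E -> R) (G : E -> E) :=
  forall phi i, test_function Omega phi ->
    [/\ mu.-integrable setT (EFin \o (fun x => f x * partial i phi x)),
        mu.-integrable setT (EFin \o (fun x => G x 0 i * phi x)) &
        (\int[mu]_x (f x * partial i phi x) = - \int[mu]_x (G x 0 i * phi x))%R].

(* An element of H^1 is a pair made of a function and its weak gradient. *)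
Definition H1 : set (L2s * L2v) := [set u : L2s * L2v | exists f G,
  [/\ class_of u.1 f, class_of u.2 G & is_weak_gradient f G]].

Definition smooth_traces : set ((L2s * L2v) * L2b) :=
  [set p : (L2s * L2v) * L2b | exists phi, [/\ smooth phi, class_of p.1.1 phi,
    class_of p.1.2 (gradient phi) & class_of p.2 phi]].

(* The trace on Gamma0 is the closure of phi |-> phi|_Gamma0, phi smooth up to
   the boundary, as an operator from H^1(Omega) to L^2(Gamma0). *)
Definition trace (u : L2s * L2v) (h : L2b) := closure smooth_traces (u, h).

Definition H1_Gamma0_pred : {pred L2s * L2v} :=
  mem [set u : L2s * L2v | H1 u /\ trace u 0].

Record H1_Gamma0 :=
  MkH1_Gamma0 { H1_Gamma0_val : L2s * L2v; _ : H1_Gamma0_val \in H1_Gamma0_pred }.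

HB.instance Definition _ := [isSub for H1_Gamma0_val].
HB.instance Definition _ := [Choice of H1_Gamma0 by <:].

Let partial_comb (a : R) (phi psi : E -> R) i : smooth phi -> smooth psi ->
  partial i (a *: phi + psi) = a *: partial i phi + partial i psi.
Proof.
move=> sphi spsi; apply/funext => x.
have [_ /(_ x i) d1] := sphi [::]; have [_ /(_ x i) d2] := spsi [::].
rewrite /partial (deriveD (@derivableZ _ _ _ phi a x _ d1) d2).
by rewrite (deriveZ a d1).
Qed.

Let smooth_partial (phi : E -> R) i : smooth phi -> smooth (partial i phi).
Proof. by move=> sphi s; have := sphi (rcons s i); rewrite foldr_rcons. Qed.

Let smooth_comb (a : R) (phi psi : E -> R) : smooth phi -> smooth psi ->
  smooth (a *: phi + psi).
Proof.
move=> + + s; elim/last_ind: s phi psi => [|s i IH] phi psi sphi spsi.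
  have [c1 d1] := sphi [::]; have [c2 d2] := spsi [::]; split=> [x|x i] /=.
    exact: (cvgD (cvgZr (c1 x)) (c2 x)).
  exact: derivableD (@derivableZ _ _ _ phi a x _ (d1 x i)) (d2 x i).
rewrite foldr_rcons partial_comb//.
by apply: IH; exact: smooth_partial.
Qed.

Let smooth0 : smooth (0 : E -> R).
Proof.
move=> s; rewrite (_ : foldr _ _ _ = cst 0).
  by split=> [|x i]; [exact: cst_continuous|exact: derivable_cst].
elim: s => //= i s ->; apply/funext => x.
by rewrite /partial derive_cst.
Qed.

Let H1_Gamma0_closed : submod_closed H1_Gamma0_pred.
Proof.
split=> [|a u v]; rewrite !inE.
  split.
    exists 0, 0; split; [exact: class_of0|exact: class_of0|move=> phi i _].
    rewrite (_ : (fun x => _) = cst 0); last by apply/funext => x; rewrite mul0r.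
    rewrite (_ : (fun x => _) = cst 0); last first.
      by apply/funext => x; rewrite mxE mul0r.
    by split; [exact: integrable0|exact: integrable0|rewrite /Rintegral integral0 oppr0].
  apply: subset_closure; exists 0; split; [exact: smooth0|exact: class_of0| |exact: class_of0].
  rewrite (_ : gradient 0 = 0); first exact: class_of0.
  apply/funext => x; apply/rowP => i; rewrite !mxE /partial.
  exact: (@derive_cst _ E R^o 0).
move=> [[f [G [uf uG fG]]] tu] [[f' [G' [vf' vG' fG']]] tv]; split.
  exists (a *: f + f'), (a *: G + G'); split; [exact: class_of_comb..|].
  move=> phi i tphi; have [i1 i2 e] := fG phi i tphi.
  have [i1' i2' e'] := fG' phi i tphi.
  have fE : (fun x => (a *: f + f') x * partial i phi x) =
      (fun x => a * (f x * partial i phi x) + f' x * partial i phi x).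
    by apply/funext => x; rewrite mulrDl -mulrA.
  have GE : (fun x => (a *: G + G') x 0 i * phi x) =
      (fun x => a * (G x 0 i * phi x) + G' x 0 i * phi x).
    by apply/funext => x; rewrite !mxE mulrDl -mulrA.
  rewrite fE GE; have [j1 k1] := Rintegral_comb a i1 i1'.
  have [j2 k2] := Rintegral_comb a i2 i2'.
  by split => //; rewrite k1 k2 e e' opprD mulrN.
have := @closure_comb _ _ smooth_traces a _ (u, 0) (v, 0) tu tv.
rewrite (_ : a *: (u, 0) + (v, 0) = (a *: u + v, 0 : L2b)); last first.
  by apply: injective_projections => //=; rewrite scaler0 addr0.
apply; move=> p q [phi [sphi p1 p2 p3]] [psi [spsi q1 q2 q3]].
exists (a *: phi + psi); split; [exact: smooth_comb|exact: class_of_comb| |exact: class_of_comb].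
rewrite (_ : gradient _ = a *: gradient phi + gradient psi).
  exact: class_of_comb.
by apply/funext => x; apply/rowP => i; rewrite !mxE partial_comb.
Qed.

HB.instance Definition _ := GRing.isSubmodClosed.Build _ _ H1_Gamma0_pred
  H1_Gamma0_closed.
HB.instance Definition _ := [SubChoice_isSubLmodule of H1_Gamma0 by <:].

Let normD (u v : H1_Gamma0) : `|val (u + v)| <= `|val u| + `|val v|.
Proof. by rewrite raddfD ler_normD. Qed.
Let normZ (a : R) (u : H1_Gamma0) : `|val (a *: u)| = `|a| * `|val u|.
Proof. by rewrite linearZ normrZ. Qed.
Let norm0 (u : H1_Gamma0) : `|val u| = 0 -> u = 0.
Proof. by move/normr0_eq0 => u0; apply: val_inj; rewrite u0 raddf0. Qed.

HB.instance Definition _ := Lmodule_isNormed.Build R H1_Gamma0 normD normZ norm0.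
End sobolev_space.

Section unit_interval.
Context {R : realType}.

Definition unit_measure : {measure set (measurableTypeR R) -> \bar R} :=
  mrestr lebesgue_measure (measurable_itv `]0, 1[).

Variable X : normedModType R.
Notation L2X := (L2 unit_measure X).

Definition unit_test_function (phi : R -> R) :=
  (forall k s, derivable (derive1n k phi) s 1) /\
  exists a b, [/\ 0 < a, b < 1 & forall s, s \notin `[a, b] -> phi s = 0].

Definition is_weak_derivative (v w : L2X) := exists f g,
  [/\ class_of v f, class_of w g & forall phi, unit_test_function phi ->
    exists2 I : X,
      is_bochner unit_measure setT (fun s => derive1 phi s *: f s) (- I) &
      is_bochner unit_measure setT (fun s => phi s *: g s) I].

(* v|_{s = s0} = x, read on the continuous representative of v. *)
Definition value_at (v : L2X) (s0 : R) (x : X) :=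
  exists f : R -> X, [/\ continuous f, class_of v f & f s0 = x].

End unit_interval.

Section delay_system.
Context {R : realType} {d : nat}.
Variables Omega Gamma0 : set 'rV[R]_d.+1.
Notation mu := (domain_measure Omega).
Notation HG := (H1_Gamma0 Omega Gamma0).
Notation L2s := (L2 mu R^o).

(* The canonical norm of phase is that of the product; energy_norm below is an
   equivalent one. *)
Definition phase : Type :=
  (HG * L2s * L2 unit_measure HG * L2 unit_measure HG)%type.

Definition fn (u : HG) : L2s := (val u).1.

Definition grad (u : HG) : 'rV[R]_d.+1 -> 'rV[R]_d.+1 := L2repr (val u).2.

Definition grad_prod (u v : HG) : R := \int[mu]_x dotv (grad u x) (grad v x).

Definition L2_prod (u v : L2s) : R := \int[mu]_x (L2repr u x * L2repr v x).

Variables c1 c2 d1 d2 tau c : R.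

Definition xi : R := d1 / (3 * `|d2|).

(* \int_Omega \int_0^1 xi e^(cs) grad u . grad v ds dx, with the integrals
   exchanged. *)
Definition weighted_prod (u v : L2 unit_measure HG) : R :=
  \int[unit_measure]_s (xi * expR (c * s) * grad_prod (L2repr u s) (L2repr v s)).

Definition energy_prod (U V : phase) : R :=
  let: (u1, u2, u3, u4) := U in let: (v1, v2, v3, v4) := V in
  c1 * grad_prod u1 v1 + L2_prod u2 v2
    + tau * d1 * weighted_prod u3 v3 + tau * `|d2| * weighted_prod u4 v4.

Definition energy_norm (U : phase) : R := Num.sqrt (energy_prod U U).

Definition distr_laplacian_eq (z : HG) (w : L2s) := forall phi,
  test_function Omega phi ->
  \int[mu]_x (L2repr (fn z) x * laplacian phi x) = \int[mu]_x (L2repr w x * phi x).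

Definition green_formula (z : HG) (w : L2s) := forall psi : HG,
  L2_prod w (fn psi) = - grad_prod z psi.

(* Graph of the operator: W = A V. The component v_2 of an element of the
   domain is in H^1_Gamma0; w1 is v_2 seen there. *)
Definition operatorA (V W : phase) : Prop :=
  let: (v1, v2, v3, v4) := V in let: (w1, w2, w3, w4) := W in
  exists (x3 x4 : HG) (p3 p4 : L2 unit_measure HG),
    let z := c1 *: v1 + c2 *: x3 + d1 *: w1 + d2 *: x4 in
    [/\ fn w1 = v2,
        [/\ value_at v3 0 v1, value_at v3 1 x3,
            value_at v4 0 w1 & value_at v4 1 x4],
        distr_laplacian_eq z w2 /\ green_formula z w2,
        is_weak_derivative v3 p3 /\ w3 = - tau^-1 *: p3 &
        is_weak_derivative v4 p4 /\ w4 = - tau^-1 *: p4].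

End delay_system.

(* Main.v *)
(* On D(A^2) the energy form B is quasi-dissipative: B(V, A V) <= w B(V, V).
   There v_3, v_4 and their derivatives in s are continuous functions with
   values in H^1, so integrating (xi e^(cs) |grad v_j|^2)' over (0, 1) yields
   boundary terms. Those at s = 1 absorb, by the lower bound on c, the cross
   terms coming from the delayed Laplacians; those at s = 0 are absorbed by
   d_1 |grad v_2|^2 and by B itself. Since D(A^2) is dense, the semigroup grows
   at most like e^(wt) in the energy norm. Only boundedness and positivity of B
   are used, not the equivalence of the energy norm with the product norm.
   The mild solution is given by Bochner integrals, which exist by completeness
   of the phase space, and the seminorm inequality for these integrals gives the
   estimate. For regular forcing the convolution has a continuous right
   derivative, and by a mean value argument this is a derivative. *)
Require Import Defs.
From HB Require Import structures.
From mathcomp Require Import all_boot all_order all_algebra.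
From mathcomp Require Import all_classical all_reals all_analysis.
From mathcomp Require Import measurable_realfun.
From mathcomp Require Import lra ring.
Import Order.TTheory GRing.Theory Num.Def Num.Theory.
Import numFieldNormedType.Exports.
Local Open Scope classical_set_scope.
Local Open Scope ring_scope.
Set Implicit Arguments.
Unset Strict Implicit.
Unset Printing Implicit Defensive.

(** * Strongly measurable functions *)

(** Membership of A V in D(A) makes the derivatives of v_3 and v_4 in s continuous: they are -tau
    times components of A V, which have continuous representatives when A V is in D(A). The weak
    derivative, known through test functions, then becomes a right derivative at every point of [0,
    1). Right derivatives are the working notion, since a semigroup and its generator speak of
    nonnegative times only; two integrals are often identified as functions of the upper limit with
    the same right derivative. Generation gives continuity of each orbit, so a bound on the
    semigroup that is uniform for bounded times has to be established before convolutions with F can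
    be handled in the product norm. The growth bound in the energy norm is a separate matter. The
    constants are M = 1 and omega = |c| / (2 tau) + d_1 xi / (2 c_1) + 1. The first summand pays for
    the derivative of the weight e^(cs), the second for the boundary term of v_3 at s = 0, which is
    v_1, and the last for the factor sqrt T of Cauchy-Schwarz in time, as sqrt T <= 1 + T <= e^T. *)

Section strongly_measurable_theory.
Context {disp : measure_display} {T : measurableType disp} {R : realType}.
Implicit Types (X Y : normedModType R) (D : set T).

Lemma simple_function_comp (X Y : normedModType R) (phi : X -> Y) (s : T -> X) :
  simple_function s -> simple_function (phi \o s).
Proof.
move=> [fs ms]; split.
  rewrite (_ : range _ = phi @` range s); first exact: finite_image.
  by apply/seteqP; split => [_ [t _ <-]|_ [_ [t _ <-] <-]]; [exists (s t) => //; exists t|exists t].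
move=> y; rewrite (_ : _ @^-1` _ =
    \bigcup_(x in [set x | range s x /\ phi x = y]) (s @^-1` [set x])).
  by apply: fin_bigcup_measurable => // ; apply: sub_finite_set fs => x [].
apply/seteqP; split => [t /= st|t [x [_ <-]] /= -> //].
by exists (s t) => //; split => //; exists t.
Qed.

Lemma simple_function_pair (X Y : normedModType R) (s : T -> X) (t : T -> Y) :
  simple_function s -> simple_function t ->
  simple_function (fun x => (s x, t x) : (X * Y)%type).
Proof.
move=> [fs ms] [ft mt]; split.
  apply: (@sub_finite_set _ _ (range s `*` range t)); last exact: finite_setX.
  by move=> _ [x _ <-]; split; exists x.
move=> [x y]; rewrite (_ : _ @^-1` _ = s @^-1` [set x] `&` t @^-1` [set y]).
  exact: measurableI.
by apply/seteqP; split => z /= [-> ->].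
Qed.

Lemma simple_function_patch (X : normedModType R) D (s t : T -> X) :
  measurable D -> simple_function s -> simple_function t ->
  simple_function (fun x => if x \in D then s x else t x).
Proof.
move=> mD [fs ms] [ft mt]; split.
  apply: (@sub_finite_set _ _ (range s `|` range t)).
    by move=> _ [x _ <-]; case: ifP => _; [left|right]; exists x.
  by rewrite finite_setU.
move=> x; rewrite (_ : _ @^-1` _ =
    (D `&` s @^-1` [set x]) `|` (~` D `&` t @^-1` [set x])).
  apply: measurableU; apply: measurableI => //; exact: measurableC.
apply/seteqP; split => [z /=|z].
  by case: ifPn; rewrite ?inE ?notin_setE => Dz zx; [left|right].
move=> [[Dz /= zx]|[Dz /= zx]]; first by rewrite mem_set.
by rewrite memNset.
Qed.

Lemma simple_function_measurable (X : normedModType R) (s : T -> X) (A : set X) :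
  simple_function s -> measurable (s @^-1` A).
Proof.
move=> [fs ms]; rewrite (_ : _ @^-1` _ =
    \bigcup_(x in [set x | range s x /\ A x]) (s @^-1` [set x])).
  by apply: fin_bigcup_measurable => // ; apply: sub_finite_set fs => x [].
apply/seteqP; split => [t /= st|t [x [_ Ax]] /= -> //].
by exists (s t) => //; split => //; exists t.
Qed.

Lemma strongly_measurable_comp (X Y : normedModType R) D (phi : X -> Y) (f : T -> X) :
  continuous phi -> strongly_measurable D f -> strongly_measurable D (phi \o f).
Proof.
move=> cphi [s [ss sf]]; exists (fun n => phi \o s n); split=> [n|x Dx].
  exact: simple_function_comp.
by apply: continuous_cvg; [exact: cphi|exact: sf].
Qed.

Lemma strongly_measurable_pair (X Y : normedModType R) D (f : T -> X) (g : T -> Y) :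
  strongly_measurable D f -> strongly_measurable D g ->
  strongly_measurable D (fun x => (f x, g x) : (X * Y)%type).
Proof.
move=> [s [ss sf]] [t [st tg]]; exists (fun n x => (s n x, t n x)); split=> [n|x Dx].
  exact: simple_function_pair.
by apply: cvg_pair; [exact: sf|exact: tg].
Qed.

Lemma strongly_measurable_sub (X : normedModType R) D D' (f : T -> X) :
  D' `<=` D -> strongly_measurable D f -> strongly_measurable D' f.
Proof. by move=> DD [s [ss sf]]; exists s; split => // x /DD; exact: sf. Qed.

Lemma strongly_measurable_ext (X : normedModType R) D (f g : T -> X) :
  (forall x, D x -> f x = g x) -> strongly_measurable D f -> strongly_measurable D g.
Proof. by move=> fg [s [ss sf]]; exists s; split => // x Dx; rewrite -fg//; exact: sf. Qed.

Lemma strongly_measurable_patch (X : normedModType R) D D' (f g : T -> X) :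
  measurable D -> strongly_measurable (D' `&` D) f -> strongly_measurable (D' `\` D) g ->
  strongly_measurable D' (fun x => if x \in D then f x else g x).
Proof.
move=> mD [s [ss sf]] [t [st tg]].
exists (fun n x => if x \in D then s n x else t n x); split=> [n|x D'x].
  exact: simple_function_patch.
case: ifPn; rewrite ?inE ?notin_setE => Dx; first exact: sf.
exact: tg.
Qed.

Lemma strongly_measurable_cst (X : normedModType R) D (x : X) :
  strongly_measurable D (cst x).
Proof.
by exists (fun=> cst x); split => [n|t _]; [exact: simple_function_cst|exact: cvg_cst].
Qed.

Lemma strongly_measurable_real D (f : T -> R) : measurable D ->
  strongly_measurable D (f : T -> R^o) -> measurable_fun D f.
Proof.
move=> mD [s [ss sf]].
apply: (@measurable_fun_cvg _ _ _ _ s) => // n.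
apply: (@measurable_funS _ _ _ _ setT) => // _ Y mY; rewrite setTI.
exact: simple_function_measurable.
Qed.

(* Values are replaced by the nearest among the first n points of a dense
   sequence; listing q 0 among them controls the distance to f. *)
Lemma strongly_measurable_crit (X : normedModType R) D (f : T -> X) (q : nat -> X) :
  measurable D ->
  (forall x e, D x -> 0 < e -> exists i, `|f x - q i| < e) ->
  (forall i, measurable_fun D (fun x => `|f x - q i|)) ->
  exists s : (T -> X)^nat, [/\ forall n, simple_function (s n),
    forall x, D x -> s n x @[n --> \oo] --> f x &
    forall n x, D x -> `|f x - s n x| <= `|f x - q 0|].
Proof.
move=> mD dq mq.
(* The index of a nearest point among q 0, ..., q n; the strict comparison keeps the smallest such
   index. *)
pose fix near_idx n x {struct n} : nat := if n is m.+1 then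
  let i := near_idx m x in if `|f x - q m.+1| < `|f x - q i| then m.+1 else i
  else 0%N.
have near_le n x i : (i <= n)%N -> `|f x - q (near_idx n x)| <= `|f x - q i|.
  elim: n => [|n IH]; first by rewrite leqn0 => /eqP ->.
  rewrite leq_eqVlt => /orP[/eqP ->|].
    by rewrite /=; case: ifPn => //; rewrite -leNgt.
  rewrite ltnS => /IH {}IH /=; case: ifPn => // h.
  exact: (le_trans (ltW h)).
have bnd n x : (near_idx n x <= n)%N.
  by elim: n => //= n IH; case: ifPn => // _; exact: leqW.
have mn n : forall i, measurable (D `&` [set x | near_idx n x = i]).
  elim: n => [|n IH] i.
    have [->|/eqP i0] := eqVneq i 0%N.
      rewrite (_ : [set _ | _] = setT) ?setIT//.
      by apply/seteqP; split.
    rewrite (_ : [set _ | _] = set0) ?setI0//.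
    by apply/seteqP; split => // x /= /esym.
  have mE j : measurable (D `&` [set x | `|f x - q n.+1| < `|f x - q j|]).
    exact: (measurable_fun_ltr (mq n.+1) (mq j) mD (Y := [set true]) I).
  (* A level set at stage n + 1 is split by the previous index j, according to whether q (n + 1) is
     strictly closer than q j. *)
  rewrite (_ : D `&` _ = \bigcup_(j in `I_n.+1)
    (((D `&` [set x | near_idx n x = j]) `&` (D `&` [set x | `|f x - q n.+1| < `|f x - q j|]) `&` [set x | n.+1 = i])
     `|` (((D `&` [set x | near_idx n x = j]) `\` (D `&` [set x | `|f x - q n.+1| < `|f x - q j|])) `&` [set x | j = i]))).
    apply: bigcup_measurable => j _.
    have mc (P : Prop) : measurable ([set _ : T | P]).
      by have [p|p] := pselect P; [rewrite (_ : mkset _ = setT)|rewrite (_ : mkset _ = set0)] => //;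
       apply/seteqP; split.
    by apply: measurableU; apply: measurableI => //; [apply: measurableI|apply: measurableD].
  apply/seteqP; split => x.
    move=> [Dx /= xi]; exists (near_idx n x); first by rewrite /= ltnS.
    case: ifPn xi => [h xi|h xi]; [left|right]; split => //=.
    by split => // -[_]; apply/negP.
  move=> [j _ [[[[Dx /= jx] [_ h]] ji]|[[[Dx /= jx] h] ji]]]; split => //=.
    by rewrite jx h.
  by rewrite jx; case: ifPn => // h'; exfalso; apply: h.
pose s n x := if x \in D then q (near_idx n x) else q 0.
exists s; split=> [n|x Dx|n x Dx]; last 2 first.
- apply/cvgrPdist_lt => e e0; have [i xi] := dq x e Dx e0.
  exists i => // n /= ni; rewrite /s mem_set//.
  exact: (le_lt_trans (near_le _ _ _ ni)).
- by rewrite /s mem_set//; exact: near_le.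
split.
  apply: (@sub_finite_set _ _ (q @` `I_n.+1)); last exact/finite_image/finite_II.
  move=> _ [x _ <-]; rewrite /s; case: ifPn => _; last by exists 0%N.
  by exists (near_idx n x) => //=; rewrite ltnS.
move=> y; rewrite (_ : _ @^-1` _ =
   (\bigcup_(i in [set i | q i = y]) (D `&` [set x | near_idx n x = i])) `|`
   (~` D `&` [set _ | q 0 = y])).
  apply: measurableU.
    by rewrite bigcup_mkcond; apply: bigcupT_measurable => i; case: ifP.
  apply: measurableI; first exact: measurableC.
  by have [p|p] := pselect (q 0 = y); [rewrite (_ : mkset _ = setT)|rewrite (_ : mkset _ = set0)] => //;
       apply/seteqP; split.
apply/seteqP; split => x; rewrite /s /=.
  by case: ifPn; rewrite ?inE ?notin_setE => Dx qy; [left; exists (near_idx n x)|right].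
move=> [[i /= iy [Dx /= ->]]|[Dx /= ->]]; first by rewrite mem_set.
by rewrite memNset.
Qed.

(** Each approximating function has finitely many values, so all these values fit in one sequence,
    which comes arbitrarily close to every f x. Index 0 is reserved for x0. *)
Lemma strongly_measurable_dense (X : normedModType R) D (f : T -> X) (x0 : X) :
  strongly_measurable D f -> exists q : nat -> X, q 0 = x0 /\
    (forall x e, D x -> 0 < e -> exists i, `|f x - q i| < e).
Proof.
move=> [s [ss sf]].
have /choice[l lP] n : exists l : seq X, range (s n) = [set` l].
  by have [/finite_seqP[l lE] _] := ss n; exists l.
exists (fun k => if k is k.+1 then
    (if unpickle k is Some ij then nth x0 (l ij.1) ij.2 else x0) else x0).
split => // x e Dx e0.
have /cvgrPdist_lt /(_ e e0)[n _ /(_ n (leqnn _)) /= snx] := sf x Dx.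
have : [set` l n] (s n x) by rewrite -lP; exists x.
move=> /= /(nthP x0)[j jl jx].
by exists (pickle (n, j)).+1; rewrite pickleK /= jx.
Qed.

Lemma strongly_measurable_norm_sub (X : normedModType R) D (f : T -> X) (y : X) :
  measurable D -> strongly_measurable D f -> measurable_fun D (fun x => `|f x - y|).
Proof.
move=> mD mf; apply: strongly_measurable_real => //.
apply: (@strongly_measurable_comp X R^o D (fun z => `|z - y|)) => //.
move=> z; apply: (@continuous_comp _ _ _ (fun z => z - y)); last exact: norm_continuous.
by apply: cvgB; [exact: cvg_id|exact: cvg_cst].
Qed.

(** With q 0 = 0 the nearest-point construction never ends up farther from f than 0 is; this
    domination feeds dominated convergence in [is_bochner_exists]. *)
Lemma strongly_measurable_approx (X : normedModType R) D (f : T -> X) :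
  measurable D -> strongly_measurable D f ->
  exists s : (T -> X)^nat, [/\ forall n, simple_function (s n),
    forall x, D x -> s n x @[n --> \oo] --> f x &
    forall n x, D x -> `|f x - s n x| <= `|f x|].
Proof.
move=> mD mf; have [q [q0 dq]] := strongly_measurable_dense 0 mf.
have [|s [ss sf sb]] := strongly_measurable_crit mD dq.
  by move=> i; exact: strongly_measurable_norm_sub.
by exists s; split => // n x Dx; have := sb n x Dx; rewrite q0 subr0.
Qed.

(** Merging the sequences that approach the values of each f_n gives one that approaches the values
    of f; the distances to its points are limits of measurable functions. *)
Lemma strongly_measurable_cvg (X : normedModType R) D (f_ : (T -> X)^nat) (f : T -> X) :
  measurable D -> (forall n, strongly_measurable D (f_ n)) ->
  (forall x, D x -> f_ n x @[n --> \oo] --> f x) -> strongly_measurable D f.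
Proof.
move=> mD mf_ f_f.
have /choice[q qP] n := strongly_measurable_dense 0 (mf_ n).
pose Q k := if unpickle k is Some ij then q ij.1 ij.2 else 0.
have [|i|s [ss sf _]] := @strongly_measurable_crit X D f Q mD; last by exists s.
  move=> x e Dx e0; have e20 : 0 < e / 2 by rewrite divr_gt0.
  have /cvgrPdist_lt /(_ _ e20)[n _ /(_ n (leqnn _)) /= fn] := f_f x Dx.
  have [_ /(_ x _ Dx e20)[j qj]] := qP n.
  exists (pickle (n, j)); rewrite /Q pickleK /=.
  rewrite -(subrKA (f_ n x)) (le_lt_trans (ler_normD _ _))//.
  by rewrite [ltRHS]splitr ltrD.
apply: (@measurable_fun_cvg _ _ _ _ (fun n x => `|f_ n x - Q i|)) => //.
  by move=> n; exact: strongly_measurable_norm_sub.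
move=> x Dx; apply: cvg_norm; apply: cvgB; last exact: cvg_cst.
exact: f_f.
Qed.

Lemma strongly_measurable_comb2 (X : normedModType R) D (a b : R) (f g : T -> X) :
  strongly_measurable D f -> strongly_measurable D g ->
  strongly_measurable D (fun x => a *: f x + b *: g x).
Proof.
move=> mf mg; apply: strongly_measurable_comb => //.
by apply: (@strongly_measurable_comp _ _ _ (fun z => b *: z)) => //; by move=> z; apply: cvgZr; exact: cvg_id.
Qed.

End strongly_measurable_theory.

(** * Bochner integral *)

Section bounded_seminorm.
Context {R : realType} {X : normedModType R}.

(** The integral estimates are stated for such p so that they serve both the norm, for existence and
    continuity, and the energy norm, for the final estimate. *)
Definition bounded_seminorm (p : X -> R) :=
  [/\ forall x y, p (x + y) <= p x + p y, forall a x, p (a *: x) = `|a| * p x &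
      exists2 C, 0 <= C & forall x, p x <= C * `|x|].

Variable p : X -> R.
Hypothesis hp : bounded_seminorm p.

Lemma bseminorm0 : p 0 = 0.
Proof. by have [_ pZ _] := hp; rewrite -[X in p X](scale0r (0 : X)) pZ normr0 mul0r. Qed.

Lemma bseminormN x : p (- x) = p x.
Proof. by have [_ pZ _] := hp; rewrite -scaleN1r pZ normrN1 mul1r. Qed.

Lemma bseminorm_ge0 x : 0 <= p x.
Proof.
have [pD _ _] := hp; have := pD x (- x); rewrite subrr bseminorm0 bseminormN.
by rewrite -mulr2n pmulrn_lge0.
Qed.

Lemma bseminorm_dist x y : `|p x - p y| <= p (x - y).
Proof.
have [pD _ _] := hp; rewrite ler_norml; apply/andP; split.
  rewrite lerBDr -lerBDl opprK -(bseminormN (x - y)) opprB addrC.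
  by rewrite -[X in p X <= _](subrK x y).
by rewrite lerBlDr -[X in p X <= _](subrK y x).
Qed.

Lemma bseminorm_continuous : continuous p.
Proof.
have [_ _ [C C0 pC]] := hp; move=> x; apply/cvgrPdist_lt => e e0.
have C1 : 0 < C + 1 by rewrite ltr_wpDl.
near=> y; apply: (le_lt_trans (bseminorm_dist _ _)).
apply: (le_lt_trans (pC _)); apply: (@le_lt_trans _ _ ((C + 1) * `|x - y|)).
  by rewrite ler_wpM2r// lerDl.
rewrite mulrC -ltr_pdivlMr//; near: y.
by apply: cvgr_dist_lt; rewrite ?divr_gt0.
Unshelve. all: by end_near. Qed.

Lemma bseminorm_sum I (r : seq I) (P : pred I) (F : I -> X) :
  p (\sum_(i <- r | P i) F i) <= \sum_(i <- r | P i) p (F i).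
Proof.
have [pD _ _] := hp; elim/big_rec2 : _ => [|i y z _ yz]; first by rewrite bseminorm0.
by rewrite (le_trans (pD _ _))// lerD2l.
Qed.

End bounded_seminorm.

Lemma norm_bounded_seminorm (R : realType) (X : normedModType R) :
  bounded_seminorm (fun x : X => `|x|).
Proof.
split; [exact: ler_normD|by move=> a x; rewrite normrZ|].
by exists 1 => // x; rewrite mul1r.
Qed.

Lemma cvg_real_norm (R : realType) (X : normedModType R) (u : nat -> X) (l : X) :
  (u n @[n --> \oo] --> l) <-> (`|l - u n| @[n --> \oo] --> (0 : R)).
Proof.
split=> [/cvgrPdist_lt h|/cvgrPdist_lt h]; apply/cvgrPdist_lt => e e0;
  apply: filterS (h e e0) => n; by rewrite sub0r normrN normr_id.
Qed.

Lemma cvge0_near_lt (R : realType) (u : nat -> \bar R) (e : R) :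
  u n @[n --> \oo] --> 0%E -> 0 < e -> \forall n \near \oo, (u n < e%:E)%E.
Proof.
move=> /fine_cvgP[ufin u0] e0; near=> n.
rewrite -[u n]fineK; last by near: n.
rewrite lte_fin (le_lt_trans (ler_norm _))//; near: n.
by move/cvgr0Pnorm_lt : u0; exact.
Unshelve. all: by end_near. Qed.

(** * Integrals of simple functions *)

Section simple_integral.
Context {disp : measure_display} {T : measurableType disp} {R : realType}.
Variables (mu : {measure set T -> \bar R}) (D : set T).
Hypotheses (mD : measurable D) (fD : (mu D < +oo)%E).
Implicit Types X Y Z : normedModType R.

Let fin A : measurable A -> mu (D `&` A) \is a fin_num.
Proof.
move=> mA; rewrite ge0_fin_numE//; apply: le_lt_trans fD.
by apply: le_measure; rewrite ?inE//; exact: measurableI.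
Qed.

(** Level sets of [phi \o s] are unions of level sets of s. Taking for s a pair of simple functions
    puts both integrals, and that of any combination, over one common partition, which is how
    linearity is obtained. *)
Lemma simple_integral_comp (Z X : normedModType R) (phi : Z -> X) (s : T -> Z) (l : seq Z) :
  simple_function s -> uniq l -> (forall t, s t \in l) ->
  simple_integral mu D (phi \o s) =
  \sum_(z <- l) fine (mu (D `&` s @^-1` [set z])) *: phi z.
Proof.
move=> [fs ms] ul sl.
pose lx := undup (map phi l).
have lxP t : phi (s t) \in lx by rewrite mem_undup map_f.
rewrite /simple_integral (@fsbig_fwiden _ X _ _ lx); first last.
- move=> x [/= xl xs]; rewrite (_ : _ @^-1` _ = set0).
    by rewrite setI0 measure0 scale0r.
  by apply/seteqP; split => // t /= tx; apply: xs; exists t.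
- exact: undup_uniq.
- by move=> _ [t _ <-] /=.
have step x : mu (D `&` (phi \o s) @^-1` [set x]) =
    (\sum_(z <- l | phi z == x) mu (D `&` s @^-1` [set z]))%E.
  rewrite -big_filter fsbig_seq ?filter_uniq// -measure_fin_bigcup//.
  - congr (mu _); apply/seteqP; split => [t [Dt /= tx]|t [z /=]].
      by exists (s t) => //=; rewrite mem_filter sl tx eqxx.
    by rewrite mem_filter => /andP[/eqP <- _] [Dt /= ->].
  - by apply/trivIsetP => i j _ _ ij; apply/seteqP; split => // t [[_ /= ti] [_ /= tj]];
      rewrite -ti -tj eqxx in ij.
  - by move=> z _; exact: measurableI.
rewrite (eq_bigr (fun x => \sum_(z <- l | phi z == x)
    fine (mu (D `&` s @^-1` [set z])) *: phi z)); last first.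
  move=> x _; rewrite step (eq_bigr (fun z => (fine (mu (D `&` s @^-1` [set z])))%:E)).
    rewrite sumEFin /= scaler_suml; by apply: eq_bigr => z /eqP ->.
  by move=> z _; rewrite fineK// fin.
rewrite (exchange_big_dep predT)//=; apply: eq_big_seq => z zl.
rewrite (big_rem (phi z)) /=; last by rewrite mem_undup map_f.
rewrite eqxx big_seq_cond big1 ?addr0// => x /andP[].
by rewrite mem_rem_uniq ?undup_uniq// inE => /andP[/negPf + _]; rewrite eq_sym => ->.
Qed.

Lemma simple_function_seq (X : normedModType R) (s : T -> X) : simple_function s ->
  exists l : seq X, uniq l /\ forall t, s t \in l.
Proof.
move=> [/finite_seqP[l lE] _]; exists (undup l); split; first exact: undup_uniq.
by move=> t; rewrite mem_undup; have : range s (s t) by []; rewrite lE.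
Qed.

Lemma simple_integral_comb (X : normedModType R) (a : R) (s t : T -> X) :
  simple_function s -> simple_function t ->
  simple_integral mu D (a *: s + t) = a *: simple_integral mu D s + simple_integral mu D t.
Proof.
move=> ss st; pose st' x := (s x, t x) : (X * X)%type.
have hst : simple_function st' by exact: simple_function_pair.
have [l [ul lP]] := simple_function_seq hst.
have E (phi : (X * X)%type -> X) := simple_integral_comp phi hst ul lP.
have := E fst; have := E snd; have := E (fun z => a *: z.1 + z.2).
rewrite -[_ \o st']/(a *: s + t) => -> -[->] -[->].
rewrite scaler_sumr -big_split /=.
by apply: eq_bigr => z _; rewrite scalerDr !scalerA mulrC.
Qed.

Lemma simple_integral_map (X Y : normedModType R) (phi : X -> Y) (s : T -> X) :
  (forall a x y, phi (a *: x + y) = a *: phi x + phi y) ->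
  simple_function s -> simple_integral mu D (phi \o s) = phi (simple_integral mu D s).
Proof.
move=> lphi ss; have [l [ul lP]] := simple_function_seq ss.
have phi0 : phi 0 = 0.
  have := lphi (-1) 0 0; rewrite scaler0 addr0 scaleN1r addNr => ->; exact: erefl.
have phiD x y : phi (x + y) = phi x + phi y by rewrite -[x]scale1r lphi !scale1r.
have phiZ a x : phi (a *: x) = a *: phi x by rewrite -[a *: x]addr0 lphi phi0 !addr0.
rewrite (simple_integral_comp phi ss ul lP).
have -> := simple_integral_comp id ss ul lP.
rewrite (big_morph phi phiD phi0); by apply: eq_bigr => z _; rewrite phiZ.
Qed.

Let setUD (X : normedModType R) (s : T -> X) l : (forall t, s t \in l) ->
  \big[setU/set0]_(z <- l) (D `&` s @^-1` [set z]) = D.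
Proof.
move=> lP; apply/seteqP; split => [t|t Dt]; rewrite -bigcup_seq.
  by case=> z _ [].
by exists (s t) => //=.
Qed.

Lemma integral_simple_function (X : normedModType R) (p : X -> R) (s : T -> X) (l : seq X) :
  (forall x, 0 <= p x) -> simple_function s -> uniq l -> (forall t, s t \in l) ->
  (\int[mu]_(t in D) (p (s t))%:E =
   (\sum_(z <- l) fine (mu (D `&` s @^-1` [set z])) * p z)%:E)%E.
Proof.
move=> p0 ss ul lP; rewrite -{1}(setUD lP) ge0_integral_bigsetU//=.
- rewrite -sumEFin; apply: eq_bigr => z _.
  rewrite (eq_integral (cst (p z)%:E)); last by move=> t; rewrite inE => -[_ /= ->].
  rewrite integral_cst; last by apply: measurableI => //; exact: ss.2.
  by rewrite EFinM fineK ?fin//; [rewrite muleC|exact: ss.2].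
- by move=> z; apply: measurableI => //; exact: ss.2.
- by apply/trivIsetP => i j _ _ ij; apply/seteqP; split => // t [[_ /= ti] [_ /= tj]];
      rewrite -ti -tj eqxx in ij.
- apply/measurable_EFinP; rewrite (setUD lP); apply: strongly_measurable_real => //.
  exists (fun _ => p \o s : T -> R^o); split => [_|t _]; last exact: cvg_cst.
  exact: simple_function_comp.
- by move=> t _; rewrite lee_fin.
Qed.

Lemma simple_integral_seminorm (X : normedModType R) (p : X -> R) (s : T -> X) :
  bounded_seminorm p -> simple_function s ->
  ((p (simple_integral mu D s))%:E <= \int[mu]_(t in D) (p (s t))%:E)%E.
Proof.
move=> hp ss; have [l [ul lP]] := simple_function_seq ss.
rewrite (integral_simple_function (bseminorm_ge0 hp) ss ul lP) lee_fin.
have -> := simple_integral_comp id ss ul lP.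
apply: (le_trans (bseminorm_sum hp _ _ _)); apply: ler_sum => z _.
by have [_ -> _] := hp; rewrite ger0_norm// fine_ge0.
Qed.

Lemma integral_simple_real (s : T -> R^o) : simple_function s ->
  (\int[mu]_(t in D) (s t)%:E = (simple_integral mu D s)%:E)%E.
Proof.
move=> ss; have [l [ul lP]] := simple_function_seq ss.
rewrite -{1}(setUD lP) integral_bigsetU_EFin//=.
- rewrite -[s in RHS]/(id \o s) (simple_integral_comp id ss ul lP).
  rewrite -sumEFin; apply: eq_bigr => z _.
  rewrite (eq_integral (cst z%:E)); last by move=> t; rewrite inE => -[_ /= ->].
  rewrite integral_cst; last by apply: measurableI => //; exact: ss.2.
  by rewrite EFinM fineK ?fin//; [rewrite muleC|exact: ss.2].
- by move=> z; apply: measurableI => //; exact: ss.2.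
- by apply/trivIsetP => i j _ _ ij; apply/seteqP; split => // t [[_ /= ti] [_ /= tj]];
      rewrite -ti -tj eqxx in ij.
- apply/measurable_EFinP; rewrite (setUD lP); apply: strongly_measurable_real => //.
  by exists (fun _ => s : T -> R^o); split => [_|t _] //; exact: cvg_cst.
Qed.

End simple_integral.

Definition seq_cauchy (R : realType) (X : normedModType R) (u : nat -> X) :=
  forall e, 0 < e -> exists N, forall m n, (N <= m)%N -> (N <= n)%N -> `|u m - u n| < e.

(** Completeness as a property of a normed module, the only structure that [L2], [H1_Gamma0] and
    [phase] are given; it is proved for each of them. *)
Definition seq_complete (R : realType) (X : normedModType R) :=
  forall u : nat -> X, seq_cauchy u -> exists l : X, u n @[n --> \oo] --> l.

(** * Calculus and existence of Bochner integrals *)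

Section bochner_theory.
Context {disp : measure_display} {T : measurableType disp} {R : realType}.
Variables (mu : {measure set T -> \bar R}).
Implicit Types (X Y Z : normedModType R) (D : set T).

Lemma is_bochner_strongly_measurable (X : normedModType R) D (f : T -> X) I :
  is_bochner mu D f I -> strongly_measurable D f.
Proof. by move=> [s [ss _ sf _ _]]; exists s. Qed.

Lemma is_bochner_ext (X : normedModType R) D (f g : T -> X) I :
  (forall t, D t -> f t = g t) -> is_bochner mu D f I -> is_bochner mu D g I.
Proof.
move=> fg [s [ss sD sf sfi sI]]; exists s; split => // [t Dt|].
  by rewrite -fg//; exact: sf.
rewrite (_ : (fun n => _) = (fun n => \int[mu]_(t in D) `|f t - s n t|%:E)%E)//.
by apply/funext => n; apply: eq_integral => t; rewrite inE => Dt; rewrite fg.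
Qed.

Lemma strongly_measurable_normsub (X : normedModType R) D (f s : T -> X) :
  measurable D -> strongly_measurable D f -> simple_function s ->
  measurable_fun D (fun t => `|f t - s t|).
Proof.
move=> mD mf ss; apply: strongly_measurable_real => //.
apply: (@strongly_measurable_comp _ _ _ X R^o D (fun x => `|x|)); first exact: norm_continuous.
have ms : strongly_measurable D s by exists (fun=> s); split => // t _; exact: cvg_cst.
have := strongly_measurable_comb2 1 (-1) mf ms.
by apply: strongly_measurable_ext => t _; rewrite scale1r scaleN1r.
Qed.

Lemma strongly_measurable_seminorm (X : normedModType R) (p : X -> R) D (f : T -> X) :
  measurable D -> bounded_seminorm p ->
  strongly_measurable D f -> measurable_fun D (fun t => p (f t)).
Proof.
move=> mD hp mf; apply: strongly_measurable_real => //.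
by apply: (@strongly_measurable_comp _ _ _ X R^o D p) => //; exact: bseminorm_continuous.
Qed.

Variable D : set T.
Hypotheses (mD : measurable D) (fD : (mu D < +oo)%E).

Let ge0_le_int (f g : T -> \bar R) : measurable_fun D f -> measurable_fun D g ->
  (forall t, D t -> 0 <= f t)%E -> (forall t, D t -> f t <= g t)%E ->
  (\int[mu]_(t in D) f t <= \int[mu]_(t in D) g t)%E.
Proof. by move=> mf mg f0 fg; exact: ge0_le_integral. Qed.

(** Since p (s_n) <= p f + C |f - s_n|, the inequality for simple functions passes to the limit; p
    is continuous, so its values at the simple integrals converge. *)
Lemma is_bochner_seminorm (X : normedModType R) (p : X -> R) (f : T -> X) I :
  bounded_seminorm p -> is_bochner mu D f I ->
  ((p I)%:E <= \int[mu]_(t in D) (p (f t))%:E)%E.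
Proof.
move=> hp bf; have mf := is_bochner_strongly_measurable bf.
have [s [ss _ sf sfi sI]] := bf.
have [pD _ [C C0 pC]] := hp; have p0 := bseminorm_ge0 hp.
have mpf := strongly_measurable_seminorm mD hp mf.
have cvg1 : (p (simple_integral mu D (s n)))%:E @[n --> \oo] --> (p I)%:E.
  by apply: cvg_EFin; [exact: nearW|apply: continuous_cvg => //; exact: bseminorm_continuous].
have cvg2 : (\int[mu]_(t in D) (p (f t))%:E + C%:E * \int[mu]_(t in D) `|f t - s n t|%:E)%E
    @[n --> \oo] --> (\int[mu]_(t in D) (p (f t))%:E + C%:E * 0)%E.
  apply: cvgeD; first by rewrite mule0 fin_num_adde_defl.
    exact: cvg_cst.
  exact: cvgeZl.
rewrite mule0 adde0 in cvg2.
apply: (lee_cvg_to cvg1 cvg2); apply: nearW => n.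
apply: (le_trans (simple_integral_seminorm mD fD hp (ss n))).
have mfs := strongly_measurable_normsub mD mf (ss n).
rewrite -ge0_integralZl//; last exact/measurable_EFinP.
rewrite -ge0_integralD//.
- apply: ge0_le_int => //.
  + apply/measurable_EFinP/strongly_measurable_seminorm => //.
    by exists (fun=> s n); split => // t _; exact: cvg_cst.
  + apply: emeasurable_funD; first exact/measurable_EFinP.
    apply/measurable_EFinP; exact: measurable_funM.
  + by move=> t _; rewrite lee_fin.
  + move=> t _; rewrite -EFinM -EFinD lee_fin.
    have E : s n t = f t - (f t - s n t) by rewrite opprB addrC subrK.
    by rewrite {1}E (le_trans (pD _ _))// (bseminormN hp) lerD2l.
- by move=> t _; rewrite lee_fin.
- exact/measurable_EFinP.
- by move=> t _; rewrite -EFinM lee_fin mulr_ge0.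
- by apply/measurable_EFinP; exact: measurable_funM.
Qed.

Lemma is_bochner_comb (X : normedModType R) (a : R) (f g : T -> X) I J :
  is_bochner mu D f I -> is_bochner mu D g J ->
  is_bochner mu D (fun t => a *: f t + g t) (a *: I + J).
Proof.
move=> bf bg; have mf := is_bochner_strongly_measurable bf.
have mg := is_bochner_strongly_measurable bg.
move: bf bg => [s [ss _ sf sfi sI]] [u [su _ ug ugi uJ]].
have ssu n : simple_function (a *: s n + u n) by exact: simple_function_comb.
exists (fun n => a *: s n + u n); split => //.
- move=> n x _; apply: le_lt_trans fD; apply: le_measure; rewrite ?inE//.
  by apply: measurableI => //; exact: (ssu n).2.
- by move=> t Dt; apply: cvgD; [apply: cvgZr; exact: sf|exact: ug].
- have cvg1 : (`|a|%:E * \int[mu]_(t in D) `|f t - s n t|%:E +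
      \int[mu]_(t in D) `|g t - u n t|%:E)%E @[n --> \oo] --> 0%E.
    rewrite -(adde0 0%E).
    by apply: cvgeD => //; rewrite -[X in _ --> X](mule0 `|a|%:E); exact: cvgeZl.
  apply: (squeeze_cvge _ (cvg_cst 0%E) cvg1); apply: nearW => n.
  apply/andP; split; first exact: integral_ge0.
  have mfs := strongly_measurable_normsub mD mf (ss n).
  have mgu := strongly_measurable_normsub mD mg (su n).
  rewrite -ge0_integralZl//; last exact/measurable_EFinP.
  rewrite -ge0_integralD//.
  + apply: ge0_le_int => //.
    * apply/measurable_EFinP; apply: strongly_measurable_normsub => //.
      exact: strongly_measurable_comb.
    * by apply: emeasurable_funD; apply/measurable_EFinP => //; exact: measurable_funM.
    * move=> t _; rewrite -EFinM -EFinD lee_fin -normrZ.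
      rewrite (_ : _ - _ = a *: (f t - s n t) + (g t - u n t)); first exact: ler_normD.
      by rewrite /= scalerBr opprD addrACA.
  + by apply/measurable_EFinP; exact: measurable_funM.
  + exact/measurable_EFinP.
- rewrite (_ : (fun n => _) = (fun n => a *: simple_integral mu D (s n) + simple_integral mu D (u n))).
    by apply: cvgD => //; exact: cvgZr.
  by apply/funext => n; exact: simple_integral_comb.
Qed.

Lemma is_bochner0 (X : normedModType R) : is_bochner mu D (fun=> 0 : X) 0.
Proof.
exists (fun _ _ => 0); split.
- by move=> n; exact: simple_function_cst.
- move=> n x _; apply: le_lt_trans fD; apply: le_measure; rewrite ?inE//.
  by apply: measurableI => //; exact: (simple_function_cst _).2.
- by move=> t _; exact: cvg_cst.
- rewrite (_ : (fun n => _) = cst 0%E); first exact: cvg_cst.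
  apply/funext => n; under eq_integral do rewrite subr0 normr0; exact: integral0.
- rewrite (_ : (fun n => _) = cst 0); first exact: cvg_cst.
  apply/funext => n; have [l [ul lP]] := simple_function_seq (@simple_function_cst _ T _ X 0).
  have := simple_integral_comp mD fD id (@simple_function_cst _ T _ X 0) ul lP.
  rewrite /comp => ->; rewrite big1// => z _.
  have [->|/eqP z0] := eqVneq z 0; first by rewrite scaler0.
  rewrite (_ : _ `&` _ = set0) ?measure0 ?scale0r//.
  by apply/seteqP; split => // t [_ /esym].
Qed.

(** The difference of I and J is an integral of the zero function, and the norm inequality bounds it
    by 0. *)
Lemma is_bochner_unique (X : normedModType R) (f : T -> X) I J :
  is_bochner mu D f I -> is_bochner mu D f J -> I = J.
Proof.
move=> bI bJ; have := is_bochner_comb (-1) bI bJ.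
have E t : D t -> -1 *: f t + f t = 0 by rewrite scaleN1r addNr.
move/(is_bochner_ext E)/(is_bochner_seminorm (norm_bounded_seminorm X)).
rewrite (eq_integral (cst 0%E)); last by move=> t _; rewrite normr0.
rewrite integral0 lee_fin normr_le0 scaleN1r addrC subr_eq0 => /eqP ->.
by [].
Qed.

Lemma is_bochner_map (X Y : normedModType R) (phi : X -> Y) (f : T -> X) I :
  (forall a x y, phi (a *: x + y) = a *: phi x + phi y) ->
  (exists2 C, 0 <= C & forall x, `|phi x| <= C * `|x|) ->
  is_bochner mu D f I -> is_bochner mu D (fun t => phi (f t)) (phi I).
Proof.
move=> lphi [C C0 phiC] bf; have mf := is_bochner_strongly_measurable bf.
have phi0 : phi 0 = 0.
  have := lphi (-1) 0 0; rewrite scaler0 addr0 scaleN1r addNr => ->; exact: erefl.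
have phiB x y : phi (x - y) = phi x - phi y.
  by rewrite addrC -scaleN1r lphi scaleN1r addrC.
have cphi : continuous phi.
  move=> x; apply/cvgrPdist_lt => e e0.
  have C1 : 0 < C + 1 by rewrite ltr_wpDl.
  near=> y; rewrite -phiB (le_lt_trans (phiC _))//.
  apply: (@le_lt_trans _ _ ((C + 1) * `|x - y|)); first by rewrite ler_wpM2r// lerDl.
  rewrite mulrC -ltr_pdivlMr//; near: y.
  by apply: cvgr_dist_lt; rewrite ?divr_gt0.
move: bf => [s [ss _ sf sfi sI]].
have ssp n : simple_function (phi \o s n) by exact: simple_function_comp.
exists (fun n => phi \o s n); split => //.
- move=> n x _; apply: le_lt_trans fD; apply: le_measure; rewrite ?inE//.
  by apply: measurableI => //; exact: (ssp n).2.
- by move=> t Dt; apply: continuous_cvg; [exact: cphi|exact: sf].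
- have cvg1 : (C%:E * \int[mu]_(t in D) `|f t - s n t|%:E)%E @[n --> \oo] --> 0%E.
    by rewrite -[X in _ --> X](mule0 C%:E); exact: cvgeZl.
  apply: (squeeze_cvge _ (cvg_cst 0%E) cvg1); apply: nearW => n.
  apply/andP; split; first exact: integral_ge0.
  have mfs := strongly_measurable_normsub mD mf (ss n).
  rewrite -ge0_integralZl//; last exact/measurable_EFinP.
  apply: ge0_le_int => //.
  + apply/measurable_EFinP; apply: strongly_measurable_normsub => //.
    exact: strongly_measurable_comp.
  + by apply/measurable_EFinP; exact: measurable_funM.
  + by move=> t _; rewrite -EFinM lee_fin -phiB.
- rewrite (_ : (fun n => _) = (fun n => phi (simple_integral mu D (s n)))).
    by apply: continuous_cvg => //; exact: cphi.
  by apply/funext => n; exact: simple_integral_map.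
Unshelve. all: by end_near. Qed.

(** Some approximant is at finite L1 distance from f, so f is integrable; the integrals of the
    approximants then converge to both values. *)
Lemma is_bochner_real (f : T -> R^o) (I : R^o) : is_bochner mu D f I ->
  mu.-integrable D (EFin \o f) /\ (\int[mu]_(t in D) f t)%R = I.
Proof.
move=> bf; have mf := is_bochner_strongly_measurable bf.
move: (bf) => [s [ss _ sf sfi sI]].
have mfs n := strongly_measurable_normsub mD mf (ss n).
have si (u : T -> R^o) : simple_function u -> mu.-integrable D (EFin \o u).
  move=> su; apply/integrableP; split.
    apply/measurable_EFinP; apply: strongly_measurable_real => //.
    by exists (fun=> u); split => // t _; exact: cvg_cst.
  have [l [ul lP]] := simple_function_seq su.
  have /= -> := integral_simple_function mD fD (fun x : R^o => normr_ge0 x) su ul lP.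
  exact: ltry.
have [n fsn] : exists n, (\int[mu]_(t in D) `|f t - s n t|%:E < +oo)%E.
  have : \forall n \near \oo, (\int[mu]_(t in D) `|f t - s n t|%:E < 1)%E.
    exact: cvge0_near_lt.
  by move=> [n _ /(_ n (leqnn _)) h]; exists n; rewrite (lt_trans h)// ltry.
have fsi : mu.-integrable D (EFin \o (fun t => f t - s n t)).
  apply/integrableP; split => //.
  have ms : strongly_measurable D (s n) by exists (fun=> s n); split => // t _; exact: cvg_cst.
  apply/measurable_EFinP; apply: measurable_funB; exact: strongly_measurable_real.
have fi : mu.-integrable D (EFin \o f).
  have := integrableD mD fsi (si _ (ss n)).
  apply: eq_integrable => // t _ /=; by rewrite -EFinD subrK.
split => //.
have bRf : (fun n => simple_integral mu D (s n) : R^o) @ \oo --> ((\int[mu]_(t in D) f t)%R : R^o).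
  apply/cvgrPdist_le => e e0.
  have : \forall n \near \oo, (\int[mu]_(t in D) `|f t - s n t|%:E < e%:E)%E.
    exact: cvge0_near_lt.
  apply: filterS => m mlt.
  have -> : simple_integral mu D (s m) = (\int[mu]_(t in D) s m t)%R.
    by rewrite /Rintegral (integral_simple_real mD fD (ss m)).
  rewrite -RintegralB//; last exact: si.
  apply: (le_trans (le_normr_Rintegral mD _)).
    have := integrableB mD fi (si _ (ss m)).
    by apply: eq_integrable.
  rewrite -lee_fin fineK; first exact: ltW.
  by rewrite ge0_fin_numE ?(lt_trans mlt) ?ltry// integral_ge0.
by rewrite -(cvg_lim _ sI)//; rewrite -(cvg_lim _ bRf).
Qed.

(** Dominated convergence sends the L1 distances of the approximants to 0, so their integrals form a
    Cauchy sequence. *)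
Lemma is_bochner_exists (X : normedModType R) (f : T -> X) : seq_complete X ->
  strongly_measurable D f -> (\int[mu]_(t in D) `|f t|%:E < +oo)%E ->
  exists I, is_bochner mu D f I.
Proof.
move=> cX mf foo; have [s [ss sf sb]] := strongly_measurable_approx mD mf.
have mnf : measurable_fun D (fun t => `|f t|).
  exact: strongly_measurable_seminorm (norm_bounded_seminorm X) mf.
have mfs n := strongly_measurable_normsub mD mf (ss n).
have sfi : (\int[mu]_(t in D) `|f t - s n t|%:E)%E @[n --> \oo] --> 0%E.
  have [|||||_ _] := @dominated_convergence _ T R mu D mD
    (fun n t => `|f t - s n t|%:E) (cst 0%E) (fun t => `|f t|%:E).
  - by move=> n; exact/measurable_EFinP.
  - exact: measurable_cst.
  - apply: aeW => t Dt; apply: cvg_EFin; first exact: nearW.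
    by apply/(cvg_real_norm (fun n => s n t) (f t)); exact: sf.
  - apply/integrableP; split; first exact/measurable_EFinP.
    by under eq_integral do rewrite abse_EFin normr_id.
  - by apply: aeW => t n Dt; rewrite abse_EFin normr_id lee_fin sb.
  by rewrite integral0.
have cs : forall e, 0 < e -> exists N, forall m n, (N <= m)%N -> (N <= n)%N ->
    `|simple_integral mu D (s m) - simple_integral mu D (s n)| < e.
  move=> e e0; have e20 : 0 < e / 2 by rewrite divr_gt0.
  have : \forall n \near \oo, (\int[mu]_(t in D) `|f t - s n t|%:E < (e / 2)%:E)%E.
    exact: cvge0_near_lt.
  move=> [N _ NP]; exists N => m n Nm Nn.
  rewrite -lte_fin.
  have -> : simple_integral mu D (s m) - simple_integral mu D (s n) =
      simple_integral mu D (-1 *: s n + s m).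
    by rewrite simple_integral_comb// scaleN1r addrC.
  have snm : simple_function (-1 *: s n + s m) by exact: simple_function_comb.
  apply: (le_lt_trans (simple_integral_seminorm mD fD (norm_bounded_seminorm X) snm)).
  apply: (@le_lt_trans _ _ (\int[mu]_(t in D) `|f t - s n t|%:E + \int[mu]_(t in D) `|f t - s m t|%:E)%E).
    rewrite -ge0_integralD//; try exact/measurable_EFinP.
    apply: ge0_le_int => //.
    - apply/measurable_EFinP/strongly_measurable_seminorm => //; first exact: norm_bounded_seminorm.
      by exists (fun=> -1 *: s n + s m); split => // t _; exact: cvg_cst.
    - by apply: emeasurable_funD; exact/measurable_EFinP.
    - move=> t _; rewrite -EFinD lee_fin -(normrN (f t - s m t)).
      rewrite (_ : (_ *: _ + _) t = (f t - s n t) + - (f t - s m t)); first exact: ler_normD.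
      by rewrite opprB [RHS]addrC subrKA -[RHS]addrC -[- s n t]scaleN1r.
  by rewrite [e]splitr EFinD lteD//; exact: NP.
have [I sI] := cX _ cs.
exists I; exists s; split => // n x _; apply: le_lt_trans fD.
by apply: le_measure; rewrite ?inE//; apply: measurableI => //; exact: (ss n).2.
Qed.

Lemma is_bochner_ae_unique (X : normedModType R) (f g : T -> X) I J :
  {ae mu, forall t, D t -> f t = g t} ->
  is_bochner mu D f I -> is_bochner mu D g J -> I = J.
Proof.
move=> fg bI bJ; have bIJ := is_bochner_comb (-1) bI bJ.
have := is_bochner_seminorm (norm_bounded_seminorm X) bIJ.
rewrite (ae_eq_integral (cst 0%E))//.
- by rewrite integral0 lee_fin normr_le0 scaleN1r addrC subr_eq0 => /eqP ->.
- apply/measurable_EFinP; apply: strongly_measurable_seminorm => //.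
    exact: norm_bounded_seminorm.
  exact: is_bochner_strongly_measurable bIJ.
- by apply: filterS fg => t fgt Dt; rewrite fgt// scaleN1r addNr normr0.
Qed.

(** Extension by zero: it allows integrals over adjacent intervals to be added as integrals over one
    interval. *)
Lemma is_bochner_patch (X : normedModType R) (D1 : set T) (f : T -> X) I :
  measurable D1 -> D1 `<=` D -> is_bochner mu D1 f I ->
  is_bochner mu D (fun t => if t \in D1 then f t else 0) I.
Proof.
move=> mD1 D1D [s [ss sD sf sfi sI]].
pose s' n t := if t \in D1 then s n t else 0.
have ss' n : simple_function (s' n).
  by apply: simple_function_patch => //; exact: simple_function_cst.
have f1 : (mu D1 < +oo)%E by apply: le_lt_trans fD; apply: le_measure; rewrite ?inE.
have E n : simple_integral mu D (s' n) = simple_integral mu D1 (s n).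
  have st : simple_function (fun t => (s n t, s' n t) : (X * X)%type).
    exact: simple_function_pair.
  have [l [ul lP]] := simple_function_seq st.
  have := simple_integral_comp mD fD snd st ul lP.
  rewrite -[_ \o _]/(s' n) => ->.
  have := simple_integral_comp mD1 f1 fst st ul lP.
  rewrite -[_ \o _]/(s n) => ->.
  (* On D1 both coordinates agree, and elsewhere the second is 0; hence a pair with x <> y misses D1
     and meets D only if y = 0. *)
  apply: eq_bigr => -[x y] _ /=.
  have [->|/eqP xy] := eqVneq x y.
    have [->|/eqP y0] := eqVneq y 0; first by rewrite !scaler0.
    congr (fine (mu _) *: _); apply/seteqP; split => t [Dt /= [st1 st2]];
      split; rewrite /= ?st1 ?st2//; last exact: D1D.
    by move: st2; rewrite /s'; case: ifPn; rewrite ?inE// => _ /esym.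
  have -> : D1 `&` (fun t => (s n t, s' n t)) @^-1` [set (x, y)] = set0.
    apply/seteqP; split => // t [D1t /= [st1 st2]]; apply: xy.
    by rewrite -st1 -st2 /s' mem_set.
  rewrite measure0 scale0r.
  have [->|/eqP y0] := eqVneq y 0; first by rewrite scaler0.
  rewrite (_ : _ `&` _ = set0) ?measure0 ?scale0r//.
  apply/seteqP; split => // t [Dt /= [st1 st2]].
  by move: st2; rewrite /s'; case: ifPn => _ h; [apply: xy; rewrite -st1|apply: y0].
exists s'; split => //.
- move=> n x _; apply: le_lt_trans fD; apply: le_measure; rewrite ?inE//.
  by apply: measurableI => //; exact: (ss' n).2.
- move=> t Dt; rewrite /s'; case: ifPn => [|_]; last exact: cvg_cst.
  by rewrite inE; exact: sf.
- rewrite (_ : (fun n => _) = (fun n => \int[mu]_(t in D1) `|f t - s n t|%:E)%E)//.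
  apply/funext => n; rewrite [in RHS]integral_mkcond [in LHS]integral_mkcond.
  apply: eq_integral => t _; rewrite /s' !patchE.
  case: ifPn => // Dt; first by case: ifPn => // _; rewrite subr0 normr0.
  by rewrite ifF//; apply: contraNF Dt; rewrite !inE; exact: D1D.
- by rewrite (_ : (fun n => _) = (fun n => simple_integral mu D1 (s n)))//; apply/funext.
Qed.

End bochner_theory.

(** * Additivity over adjacent intervals *)

Section bochner_lebesgue.
Context {R : realType} (X : normedModType R).
Notation leb := (@lebesgue_measure R).

Lemma lebesgue_oo_fin (a b : R) : (leb `]a, b[ < +oo)%E.
Proof. by rewrite lebesgue_measure_itv /=; case: ifP => _; rewrite ?ltry. Qed.

(** After extension by zero, the sum of the integrands over ]a, b[ and ]b, c[ agrees with f except
    at b, a null set. *)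
Lemma is_bochner_itvU (a b c : R) (f : R -> X) I J K : a <= b -> b <= c ->
  is_bochner leb `]a, b[ f I -> is_bochner leb `]b, c[ f J ->
  is_bochner leb `]a, c[ f K -> K = I + J.
Proof.
move=> ab bc bI bJ bK.
have mac : measurable (`]a, c[ : set (measurableTypeR R)) by exact: measurable_itv.
have fac := lebesgue_oo_fin a c.
have /(is_bochner_patch mac fac) pI := bI.
have /(is_bochner_patch mac fac) pJ := bJ.
have {}pI := pI (measurable_itv _) (subset_itvl _).
have {}pJ := pJ (measurable_itv _) (subset_itvr _).
have {}pI : is_bochner leb `]a, c[ (fun t => if t \in `]a, b[%classic then f t else 0) I.
  by apply: pI; rewrite bnd_simp.
have {}pJ : is_bochner leb `]a, c[ (fun t => if t \in `]b, c[%classic then f t else 0) J.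
  by apply: pJ; rewrite bnd_simp.
have bIJ := is_bochner_comb mac fac 1 pI pJ; rewrite -[I]scale1r.
apply: (is_bochner_ae_unique mac fac _ bK bIJ).
exists [set b]; split; [exact: measurable_set1|exact: lebesgue_measure_set1|].
move=> t /= tN; apply: contrapT => tb; apply: tN.
rewrite in_itv/= => /andP[at_ tc]; rewrite !mem_setE !in_itv/= at_ tc scale1r andbT.
have [tb'|tb'|tb'] := ltgtP t b; rewrite ?addr0 ?add0r//.
Qed.

End bochner_lebesgue.

(** * Continuity and right derivatives *)

Section interval_continuity.
Context {R : realType} (X : normedModType R).
Implicit Types (u v : R -> X) (a b t : R).

Definition cont_on a b u := forall t, a <= t <= b -> forall e, 0 < e ->
  exists2 del, 0 < del & forall s, a <= s <= b -> `|s - t| < del -> `|u s - u t| < e.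

Lemma cont_onS a b a' b' u : a <= a' -> b' <= b -> cont_on a b u -> cont_on a' b' u.
Proof.
move=> aa bb cu t /andP[at_ tb] e e0.
have [|del d0 dP] := cu t _ e e0; first by rewrite (le_trans aa)//= (le_trans tb).
exists del => // s /andP[as_ sb]; apply: dP.
by rewrite (le_trans aa)//= (le_trans sb).
Qed.

Lemma cont_on_ext a b u v : (forall t, a <= t <= b -> u t = v t) ->
  cont_on a b u -> cont_on a b v.
Proof.
move=> uv cu t tab e e0; have [del d0 dP] := cu t tab e e0.
by exists del => // s sab st; rewrite -!uv//; exact: dP.
Qed.

Lemma cont_on_comb a b (k l : R) u v : cont_on a b u -> cont_on a b v ->
  cont_on a b (fun t => k *: u t + l *: v t).
Proof.
move=> cu cv t tab e e0.
pose c := `|k| + `|l| + 1; have c0 : 0 < c by rewrite /c ltr_wpDl ?addr_ge0.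
have ec : 0 < e / c by rewrite divr_gt0.
have [d1 d10 d1P] := cu t tab _ ec; have [d2 d20 d2P] := cv t tab _ ec.
exists (Num.min d1 d2); first by rewrite lt_min d10.
move=> s sab; rewrite lt_min => /andP[s1 s2].
rewrite opprD addrACA -!scalerBr (le_lt_trans (ler_normD _ _))// !normrZ.
apply: (@le_lt_trans _ _ (`|k| * (e / c) + `|l| * (e / c))).
  by apply: lerD; apply: ler_wpM2l => //; apply: ltW; [exact: d1P|exact: d2P].
rewrite -mulrDl mulrCA -ltr_pdivlMl// mulVf ?gt_eqF// ltr_pdivrMr// mul1r.
by rewrite ltrDl.
Qed.

Lemma cont_on_cst a b (x : X) : cont_on a b (fun=> x).
Proof. by move=> t tab e e0; exists 1 => // s _ _; rewrite subrr normr0. Qed.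

Lemma cont_on_id_scale a b (x : X) : cont_on a b (fun t => t *: x).
Proof.
move=> t tab e e0; exists (e / (`|x| + 1)); first by rewrite divr_gt0// ltr_wpDl.
move=> s _; rewrite ltr_pdivlMr ?ltr_wpDl// => st.
rewrite -scalerBl normrZ (le_lt_trans _ st)//.
by rewrite ler_wpM2l// lerDl.
Qed.

Lemma within_cvgP (A : set R) (f : R -> X) t (l : X) :
  f s @[s --> within A (nbhs t)] --> l <-> forall e, 0 < e ->
  exists2 del, 0 < del & forall s, A s -> `|s - t| < del -> `|f s - l| < e.
Proof.
split=> [/cvgrPdist_lt h e e0|h].
  have /nbhs_ballP[del /= d0 dP] := h e e0; exists del => // s As st.
  by rewrite distrC; apply: dP => //; rewrite /ball /= distrC.
apply/cvgrPdist_lt => e e0; have [del d0 dP] := h e e0.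
apply/nbhs_ballP; exists del => // s /=; rewrite /ball /= => st As.
by rewrite distrC; apply: dP => //; rewrite distrC.
Qed.

Lemma dwithin_cvgP (A : set R) (f : R -> X) t (l : X) :
  f s @[s --> within A t^'] --> l <-> forall e, 0 < e ->
  exists2 del, 0 < del & forall s, A s -> s != t -> `|s - t| < del -> `|f s - l| < e.
Proof.
split=> [/cvgrPdist_lt h e e0|h].
  have /nbhs_ballP[del /= d0 dP] := h e e0; exists del => // s As st1 st.
  by rewrite distrC; apply: dP => //; rewrite /ball /= distrC.
apply/cvgrPdist_lt => e e0; have [del d0 dP] := h e e0.
apply/nbhs_ballP; exists del => // s /=; rewrite /ball /= => st st1 As.
by rewrite distrC; apply: dP => //; rewrite distrC.
Qed.

Lemma dnbhs_cvgP (f : R -> X) t (l : X) :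
  f s @[s --> t^'] --> l <-> forall e, 0 < e ->
  exists2 del, 0 < del & forall s, s != t -> `|s - t| < del -> `|f s - l| < e.
Proof.
split=> [/cvgrPdist_lt h e e0|h].
  have /nbhs_ballP[del /= d0 dP] := h e e0; exists del => // s st1 st.
  by rewrite distrC; apply: dP => //; rewrite /ball /= distrC.
apply/cvgrPdist_lt => e e0; have [del d0 dP] := h e e0.
apply/nbhs_ballP; exists del => // s /=; rewrite /ball /= => st st1.
by rewrite distrC; apply: dP => //; rewrite distrC.
Qed.

Lemma right_cvgP (f : R -> X) (l : X) :
  f h @[h --> 0^'+] --> l <-> forall e, 0 < e ->
  exists2 del, 0 < del & forall h, 0 < h -> h < del -> `|f h - l| < e.
Proof.
split=> [/cvgrPdist_lt h e e0|h].
  have /nbhs_ballP[del /= d0 dP] := h e e0; exists del => // s s0 st.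
  by rewrite distrC; apply: dP => //; rewrite /ball /= sub0r normrN gtr0_norm.
apply/cvgrPdist_lt => e e0; have [del d0 dP] := h e e0.
apply/nbhs_ballP; exists del => // s /=; rewrite /ball /= sub0r normrN => st s0.
by rewrite distrC; apply: dP => //; rewrite (le_lt_trans (ler_norm _)).
Qed.

Lemma C0_ge0P u : C0_ge0 u <-> forall t, 0 <= t -> forall e, 0 < e ->
  exists2 del, 0 < del & forall s, 0 <= s -> `|s - t| < del -> `|u s - u t| < e.
Proof.
rewrite /C0_ge0 (@subspace_continuousP R `[0, +oo[ X u); split=> h t t0.
  have /h/within_cvgP ct : `[0, +oo[%classic t by rewrite /= in_itv/= t0.
  move=> e /ct[del d0 dP]; exists del => // s s0; apply: dP.
  by rewrite /= in_itv/= s0.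
apply/within_cvgP => e e0; move: t0; rewrite /= in_itv/= andbT => t0.
have [del d0 dP] := h t t0 e e0; exists del => // s.
by rewrite /= in_itv/= andbT; exact: dP.
Qed.

Lemma C0_ge0_cont_on u b : C0_ge0 u -> cont_on 0 b u.
Proof.
move=> /C0_ge0P cu t /andP[t0 _] e e0; have [del d0 dP] := cu t t0 e e0.
by exists del => // s /andP[s0 _]; exact: dP.
Qed.

Lemma cont_on_C0_ge0 u : (forall b, 0 < b -> cont_on 0 b u) -> C0_ge0 u.
Proof.
move=> cu; apply/C0_ge0P => t t0 e e0.
(* The interval reaches beyond t so that it contains a neighbourhood of t in the half-line. *)
have [||del d0 dP] := cu (t + 1) _ t _ e e0; first by rewrite ltr_wpDl.
  by rewrite t0 lerDl ler01.
exists (Num.min del 1); first by rewrite lt_min d0 ltr01.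
move=> s s0; rewrite lt_min => /andP[sd s1]; apply: dP => //.
by rewrite s0 /= -lerBlDl (le_trans (ler_norm _))// ltW.
Qed.

Lemma C0_ge0_ext u v : (forall t, 0 <= t -> u t = v t) -> C0_ge0 u -> C0_ge0 v.
Proof.
move=> uv cu; apply: cont_on_C0_ge0 => b b0.
by apply: (@cont_on_ext _ _ u) => [t /andP[t0 _]|]; [exact: uv|exact: C0_ge0_cont_on].
Qed.

Lemma C0_ge0_comb (k l : R) u v : C0_ge0 u -> C0_ge0 v ->
  C0_ge0 (fun t => k *: u t + l *: v t).
Proof.
by move=> cu cv; apply: cont_on_C0_ge0 => b b0; apply: cont_on_comb; exact: C0_ge0_cont_on.
Qed.

Lemma cont_on_within a b u : cont_on a b u -> {within `[a, b], continuous u}.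
Proof.
move=> cu; apply/(@subspace_continuousP R `[a, b] X u) => t; rewrite /= in_itv/= => tab.
apply/within_cvgP => e e0; have [del d0 dP] := cu t tab e e0.
by exists del => // s; rewrite /= in_itv/=; exact: dP.
Qed.

End interval_continuity.

(** * Mean value inequalities for right derivatives *)

Section mean_value.
Context {R : realType}.

(** Let c be the supremum of the points up to which the slope from a stays below e + eta. Continuity
    extends the bound to c, and if c < b the hypothesis at c carries it beyond c. *)
Lemma right_slope_le (g : R -> R) (a b e : R) : a <= b -> cont_on a b (g : R -> R^o) ->
  (forall t, a <= t < b -> forall eta, 0 < eta -> exists2 del, 0 < del &
    forall h, 0 < h -> h < del -> g (t + h) - g t <= (e + eta) * h) ->
  g b - g a <= e * (b - a).
Proof.
move=> ab cg hg; apply/ler_addgt0Pr => eps eps0.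
wlog {ab} ab : / a < b.
  move: ab; rewrite le_eqVlt => /orP[/eqP -> _|ab]; last exact.
  by rewrite !subrr mulr0 add0r ltW.
(* The excess eta in the slope costs exactly eps over the whole interval. *)
pose eta := eps / (b - a); have ba0 : 0 < b - a by rewrite subr_gt0.
have eta0 : 0 < eta by rewrite divr_gt0.
have -> : e * (b - a) + eps = (e + eta) * (b - a).
  by rewrite mulrDl /eta divfK ?gt_eqF.
pose A : set R := [set t | a <= t <= b /\ forall s, a <= s <= t -> g s - g a <= (e + eta) * (s - a)].
have Aa : A a.
  split; first by rewrite lexx ltW.
  by move=> s; rewrite -eq_le => /eqP <-; rewrite !subrr mulr0.
have ubA : ubound A b by move=> t [/andP[]].
have hsA : has_sup A by split; [exists a|exists b].
pose c := sup A; have ac : a <= c by apply: ub_le_sup => //; exists b.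
have cb : c <= b by apply: ge_sup => //; exists a.
have below s : a <= s -> s < c -> g s - g a <= (e + eta) * (s - a).
  move=> as_ sc; have := @sup_adherent _ A (c - s) _ hsA.
  rewrite subr_gt0 => /(_ sc)[t [_ At]]; rewrite subKr => st.
  by apply: At; rewrite as_ ltW.
have cc : g c - g a <= (e + eta) * (c - a).
  move: ac; rewrite le_eqVlt => /orP[/eqP <-|ac]; first by rewrite !subrr mulr0.
  apply/ler_addgt0Pr => r r0.
  have r20 : 0 < r / 2 by rewrite divr_gt0.
  have [|del d0 dP] := cg c _ _ r20; first by rewrite ltW.
  (* The slope e + eta may be negative; k bounds its absolute value, so stepping back by h <= r / (2
     k) changes the linear term by at most r / 2. *)
  pose k := `|e + eta| + 1; have k0 : 0 < k by rewrite /k ltr_wpDl.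
  pose h := Num.min (Num.min (del / 2) (c - a)) (r / 2 / k).
  have h0 : 0 < h by rewrite !lt_min divr_gt0//= subr_gt0 ac divr_gt0.
  have hd : h < del.
    by rewrite /h !gt_min ltr_pdivrMr// ltr_pMr// ltr1n.
  have hca : h <= c - a by rewrite /h !ge_min lexx !orbT.
  have hr : k * h <= r / 2 by rewrite mulrC -ler_pdivlMr// /h !ge_min lexx !orbT.
  have ach : a <= c - h by rewrite lerBrDl -lerBrDr.
  have chc : c - h < c by rewrite ltrBlDr ltrDl.
  have b1 : g (c - h) - g a <= (e + eta) * (c - h - a) := below _ ach chc.
  have b2 : `|g (c - h) - g c| < r / 2.
    apply: dP; first by rewrite ach (le_trans (ltW chc)).
    by rewrite [c - h]addrC addrK normrN gtr0_norm.
  have b3 : - ((e + eta) * h) <= k * h.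
    by rewrite -mulNr ler_pM2r// (le_trans (ler_norm _))// normrN lerDl.
  move: b2; rewrite ltr_norml => /andP[b2 _].
  move: (g (c - h)) b1 b2 => gc b1 b2; nra.
move: cb; rewrite le_eqVlt => /orP[/eqP <- //|cb].
exfalso; have [|del d0 dP] := hg c _ _ eta0; first by rewrite ac.
pose h := Num.min (del / 2) (b - c).
have h0 : 0 < h by rewrite lt_min divr_gt0//= subr_gt0.
have hd : h < del by rewrite /h gt_min ltr_pdivrMr// ltr_pMr// ltr1n.
have hbc : h <= b - c by rewrite /h ge_min lexx orbT.
have : A (c + h).
  split; first by rewrite (le_trans ac) /= ?lerDl ?(ltW h0)// -lerBrDl.
  move=> s /andP[as_ sch]; have [sc|cs] := ltP s c; first exact: below.
  move: cs; rewrite le_eqVlt => /orP[/eqP <- //|cs].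
  have := dP (s - c); rewrite subr_gt0 cs => /(_ isT).
  rewrite (@le_lt_trans _ _ h) ?lerBlDl// => /(_ isT).
  rewrite [c + _]addrC subrK => b1; nra.
move=> /(ub_le_sup (proj2 hsA)); rewrite -/c leNgt ltrDl h0.
by [].
Qed.

Variable X : normedModType R.

(** The scalar inequality applies to t -> |v t - v a|, whose increments are at most the norms of
    those of v by the triangle inequality. *)
Lemma right_deriv_bound (v : R -> X) (a b e : R) : a <= b -> cont_on a b v ->
  (forall t, a <= t < b -> forall eta, 0 < eta -> exists2 del, 0 < del &
    forall h, 0 < h -> h < del -> `|v (t + h) - v t| <= (e + eta) * h) ->
  `|v b - v a| <= e * (b - a).
Proof.
move=> ab cv hv.
have := @right_slope_le (fun t => `|v t - v a|) a b e ab.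
rewrite subrr normr0 subr0; apply.
- move=> t tab eps eps0; have [del d0 dP] := cv t tab eps eps0.
  exists del => // s sab st; apply: le_lt_trans (dP s sab st).
  apply: (le_trans (ler_dist_dist _ _)).
  by rewrite opprB addrA subrK.
- move=> t tab eta eta0; have [del d0 dP] := hv t tab eta eta0.
  exists del => // h h0 hd; apply: le_trans (dP h h0 hd).
  rewrite lerBlDr; apply: le_trans (ler_normD _ _).
  by rewrite addrA subrK.
Qed.

Definition right_deriv (v : R -> X) t (l : X) :=
  h^-1 *: (v (t + h) - v t) @[h --> 0^'+] --> l.

Lemma right_derivP (v : R -> X) t (l : X) : right_deriv v t l <->
  forall e, 0 < e -> exists2 del, 0 < del &
    forall h, 0 < h -> h < del -> `|v (t + h) - v t - h *: l| <= e * h.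
Proof.
have E h : 0 < h -> `|v (t + h) - v t - h *: l| = h * `|h^-1 *: (v (t + h) - v t) - l|.
  move=> h0; rewrite -[X in X * _](gtr0_norm h0) -normrZ scalerBr scalerA divff ?gt_eqF//.
  by rewrite scale1r.
split=> [/right_cvgP hv e e0|hv].
  have [del d0 dP] := hv e e0; exists del => // h h0 hd.
  by rewrite E// mulrC ler_pM2r// ltW// dP.
apply/right_cvgP => e e0; have e20 : 0 < e / 2 by rewrite divr_gt0.
have [del d0 dP] := hv _ e20; exists del => // h h0 hd.
have := dP h h0 hd; rewrite E// mulrC ler_pM2r// => /le_lt_trans; apply.
by rewrite ltr_pdivrMr// ltr_pMr// ltr1n.
Qed.

(** Subtracting the linear function t -> t l reduces this to [right_deriv_bound]. It controls a
    difference quotient by the oscillation of the right derivative. *)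
Lemma right_deriv_close (v : R -> X) (k : R -> X) (l : X) (a b e : R) : a <= b ->
  cont_on a b v -> (forall t, a <= t < b -> right_deriv v t (k t)) ->
  (forall t, a <= t < b -> `|k t - l| <= e) ->
  `|v b - v a - (b - a) *: l| <= e * (b - a).
Proof.
move=> ab cv vk kl; pose w t := v t - t *: l.
have wE s t : w s - w t = v s - v t - (s - t) *: l.
  by rewrite /w scalerBl !opprD !opprK [LHS]addrACA.
rewrite -wE; apply: right_deriv_bound => //.
  have := cont_on_comb 1 (-1) cv (@cont_on_id_scale _ _ a b l).
  by apply: cont_on_ext => t _; rewrite scale1r scaleN1r.
move=> t tab eta eta0; have /right_derivP/(_ eta eta0)[del d0 dP] := vk t tab.
exists del => // h h0 hd; rewrite wE [t + h]addrC addrK [h + t]addrC.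
have -> : v (t + h) - v t - h *: l = (v (t + h) - v t - h *: k t) + h *: (k t - l).
  by rewrite scalerBr addrA subrK.
rewrite (le_trans (ler_normD _ _))// mulrDl addrC lerD//; last exact: dP.
by rewrite normrZ gtr0_norm// mulrC ler_pM2r// kl.
Qed.

Lemma right_deriv0_cst (v : R -> X) a b : a <= b -> cont_on a b v ->
  (forall t, a <= t < b -> right_deriv v t 0) -> v b = v a.
Proof.
move=> ab cv dv.
have h : `|v b - v a - (b - a) *: 0| <= 0 * (b - a).
  by apply: (right_deriv_close ab cv dv) => t _; rewrite subr0 normr0.
by apply/eqP; move: h; rewrite scaler0 subr0 mul0r normr_le0 subr_eq0.
Qed.

Lemma right_deriv_ext (u v : R -> X) t l : (forall s, t <= s -> u s = v s) ->
  right_deriv u t l -> right_deriv v t l.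
Proof.
move=> uv /right_derivP du; apply/right_derivP => e e0.
have [del d0 dP] := du e e0; exists del => // h h0 hd.
by rewrite -!uv// ?lerDl ?(ltW h0)//; exact: dP.
Qed.

Lemma right_deriv_comb (a b : R) (u v : R -> X) t k l :
  right_deriv u t k -> right_deriv v t l ->
  right_deriv (fun s => a *: u s + b *: v s) t (a *: k + b *: l).
Proof.
move=> du dv; rewrite /right_deriv.
have -> : (fun h => h^-1 *: (a *: u (t + h) + b *: v (t + h) - (a *: u t + b *: v t))) =
   (fun h => a *: (h^-1 *: (u (t + h) - u t)) + b *: (h^-1 *: (v (t + h) - v t))).
  apply/funext => h; rewrite !scalerA ![_ * h^-1]mulrC -!scalerA -scalerDr.
  by congr (_ *: _); rewrite !scalerBr opprD addrACA.
by apply: cvgD; apply: cvgZr.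
Qed.

(** On a short interval with end point t, on either side of it, k stays within e / 2 of k t, and
    [right_deriv_close] carries this over to the difference quotient. Left quotients thus converge
    although only right derivatives are given. *)
Lemma C1_right_deriv (v k : R -> X) : C0_ge0 v -> C0_ge0 k ->
  (forall t, 0 <= t -> right_deriv v t (k t)) ->
  forall t, 0 <= t -> (s - t)^-1 *: (v s - v t) @[s --> within `[0, +oo[ t^'] --> k t.
Proof.
move=> cv /C0_ge0P ck dv t t0; apply/dwithin_cvgP => e e0.
have e20 : 0 < e / 2 by rewrite divr_gt0.
have [del d0 dP] := ck t t0 _ e20; exists del => // s.
rewrite /= in_itv/= andbT => s0 st sd.
have key a b : 0 <= a -> a < b -> (forall r, a <= r <= b -> `|r - t| < del) ->
    `|(b - a)^-1 *: (v b - v a) - k t| < e.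
  move=> a0 ab abt.
  have := @right_deriv_close v k (k t) a b (e / 2) (ltW ab).
  have cvab : cont_on a b v.
    by apply: (@cont_onS _ _ 0 b) => //; exact: C0_ge0_cont_on.
  move=> /(_ cvab) h.
  have ba0 : 0 < b - a by rewrite subr_gt0.
  have -> : (b - a)^-1 *: (v b - v a) - k t = (b - a)^-1 *: (v b - v a - (b - a) *: k t).
    by rewrite [in RHS]scalerBr scalerA mulVf ?scale1r// gt_eqF.
  rewrite normrZ gtr0_norm ?invr_gt0// mulrC ltr_pdivrMr//.
  apply: (@le_lt_trans _ _ (e / 2 * (b - a))).
    apply: h => r /andP[ar rb]; first exact: dv (le_trans a0 ar).
    by apply/ltW/dP; [exact: le_trans ar|apply: abt; rewrite ar ltW].
  by rewrite ltr_pM2r// ltr_pdivrMr// ltr_pMr// ltr1n.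
have [ts|ts|ts] := ltgtP t s; last by rewrite ts eqxx in st.
- apply: key => // r /andP[tr rs].
  rewrite ger0_norm ?subr_ge0//; apply: le_lt_trans sd.
  by rewrite ger0_norm ?subr_ge0 ?(ltW ts)// lerB.
- rewrite -(opprB t s) invrN scaleNr -scalerN opprB.
  apply: key => // r /andP[sr rt].
  rewrite distrC ger0_norm ?subr_ge0//; apply: le_lt_trans sd.
  by rewrite distrC ger0_norm ?subr_ge0 ?(ltW ts)// lerB.
Qed.

End mean_value.

(** Compactness of [a, b] replaces thresholds valid near each s by a single one; this makes
    estimates for small h uniform along an integrand. *)
Lemma segment_uniform (R : realType) (a b : R) (P : R -> R -> Prop) :
  (forall s, a <= s <= b -> exists2 del, 0 < del & forall s' h, a <= s' <= b ->
     `|s' - s| < del -> 0 < h -> h < del -> P s' h) ->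
  exists2 del, 0 < del & forall s h, a <= s <= b -> 0 < h -> h < del -> P s h.
Proof.
move=> hP; have /compact_near_coveringP/near_covering_withinP cab := @segment_compact R a b.
have : \forall h \near (0 : R)^'+, `[a, b]%classic `<=` P ^~ h.
  apply: (cab _ _ (fun h s => P s h)) => s; rewrite /= in_itv/= => sab.
  have [del d0 dP] := hP s sab.
  exists (ball s del, [set h | 0 < h /\ h < del]) => /=.
    split; first exact: nbhsx_ballx.
    apply/nbhs_ballP; exists del => // h /=; rewrite /ball /= sub0r normrN => hd h0.
    by split => //; rewrite (le_lt_trans (ler_norm _)).
  move=> [s' h] [/= ss [h0 hd]]; rewrite in_itv/= => s'ab.
  by apply: dP => //; rewrite distrC.
move=> /nbhs_ballP[del /= d0 dP]; exists del => // s h sab h0 hd.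
have /= := dP h; rewrite /ball /= sub0r normrN gtr0_norm// => /(_ hd h0 s).
by apply; rewrite /= in_itv.
Qed.

(** * Integrals of continuous functions and their primitives *)

Section continuous_bochner.
Context {R : realType} (X : normedModType R).
Notation leb := (@lebesgue_measure R).
Implicit Types (u v : R -> X) (a b : R).

Lemma cont_on_map (Y : normedModType R) (phi : X -> Y) a b u :
  continuous phi -> cont_on a b u -> cont_on a b (phi \o u).
Proof.
move=> cphi cu t tab e e0.
have /cvgrPdist_lt/(_ e e0)/nbhs_ballP[r /= r0 rP] := cphi (u t).
have [del d0 dP] := cu t tab r r0; exists del => // s sab st.
by rewrite distrC; apply: rP; rewrite -ball_normE /= distrC; exact: dP.
Qed.

Lemma cont_on_bounded a b u : a <= b -> cont_on a b u ->
  exists2 M, 0 <= M & forall t, a <= t <= b -> `|u t| <= M.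
Proof.
move=> ab cu.
have cnu : {within `[a, b], continuous (fun t => `|u t|)}.
  apply: (@cont_on_within _ R^o).
  by apply: (@cont_on_map R^o (fun x : X => `|x|) a b u) => // x; exact: norm_continuous.
have [c _ cP] := EVT_max ab cnu; by exists `|u c| => // t tab; apply: cP; rewrite in_itv.
Qed.

(** The values of u at the rationals of ]a, b[ approach every value of u there, so
    [strongly_measurable_crit] applies. *)
Lemma cont_on_smeas a b u : cont_on a b u ->
  strongly_measurable (`]a, b[ : set (measurableTypeR R)) u.
Proof.
move=> cu; pose q i := if unpickle i is Some r then
  if a < ratr r < b then u (ratr r) else 0 else 0.
have [|||s [ss sf _]] := @strongly_measurable_crit _ (measurableTypeR R) R X `]a, b[%classic u q.
- exact: measurable_itv.
- move=> x e; rewrite /= in_itv/= => /andP[ax xb] e0.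
  have [|del d0 dP] := cu x _ e e0; first by rewrite !ltW.
  have [|r] := @rat_in_itvoo R x (Num.min b (x + del)).
    by rewrite lt_min xb ltrDl.
  rewrite in_itv/= lt_min => /andP[xr /andP[rb rd]].
  exists (pickle r); rewrite /q pickleK (lt_trans ax)//= rb distrC.
  apply: dP; first by rewrite !ltW// (lt_trans ax).
  by rewrite gtr0_norm ?subr_gt0// ltrBlDl.
- move=> i; apply: subspace_continuous_measurable_fun; first exact: measurable_itv.
  have : {within `[a, b], continuous (fun t => `|u t - q i|)}.
    apply: (@cont_on_within _ R^o); apply: (@cont_on_map R^o (fun x => `|x - q i|)) => //.
    move=> z; apply: (@continuous_comp _ _ _ (fun z => z - q i)); last exact: norm_continuous.
    by apply: cvgB; [exact: cvg_id|exact: cvg_cst].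
  by apply: continuous_subspaceW; exact: subset_itv_oo_cc.
- by exists s.
Qed.

Lemma lebesgue_oo a b : a <= b -> leb `]a, b[ = (b - a)%:E.
Proof.
rewrite le_eqVlt => /orP[/eqP ->|ab];
  by rewrite lebesgue_measure_itv/= lte_fin ?ltxx ?subrr// ab.
Qed.

Lemma is_bochner_cst a b (x : X) : a <= b -> is_bochner leb `]a, b[ (fun=> x) ((b - a) *: x).
Proof.
move=> ab; have mD : measurable (`]a, b[ : set (measurableTypeR R)) by exact: measurable_itv.
have fD := lebesgue_oo_fin a b.
have sx : simple_function (fun _ : measurableTypeR R => x) by exact: simple_function_cst.
exists (fun _ _ => x); split => //.
- move=> n y _; apply: le_lt_trans fD; apply: le_measure; rewrite ?inE//.
  by apply: measurableI => //; exact: sx.2.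
- by move=> t _; exact: cvg_cst.
- rewrite (_ : (fun n => _) = cst 0%E); first exact: cvg_cst.
  by apply/funext => n; under eq_integral do rewrite subrr normr0; exact: integral0.
- rewrite (_ : (fun n => _) = cst ((b - a) *: x)); first exact: cvg_cst.
  apply/funext => n.
  have := @simple_integral_comp _ _ _ leb _ mD fD X X id _ [:: x] sx isT.
  rewrite /comp => ->; last by move=> t; rewrite inE.
  rewrite big_seq1 (_ : _ @^-1` _ = setT); last by apply/seteqP; split.
  by rewrite setIT -[X in fine X](esym (lebesgue_oo ab)).
Qed.

Lemma is_bochner_close a b u I (x : X) e : a <= b -> is_bochner leb `]a, b[ u I ->
  (forall t, a < t < b -> `|u t - x| <= e) -> `|I - (b - a) *: x| <= e * (b - a).
Proof.
move=> ab bI ux; have mD : measurable (`]a, b[ : set (measurableTypeR R)) by exact: measurable_itv.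
have fD := lebesgue_oo_fin a b.
(* For a = b the hypothesis on u is void and e may be negative, so this case is settled directly. *)
move: (ab); rewrite le_eqVlt => /orP[/eqP E|ab'].
  have -> : I = 0.
    apply: (is_bochner_ae_unique mD fD _ bI (is_bochner0 mD fD X)).
    by apply: aeW => t /=; rewrite in_itv/= E; case: ltgtP.
  by rewrite E subrr scale0r subrr normr0 mulr0.
have e0 : 0 <= e.
  have [r ab2] := rat_in_itvoo ab'; move: ab2; rewrite in_itv/= => /ux.
  exact: le_trans.
have := is_bochner_comb mD fD (-1) (is_bochner_cst x ab) bI.
move=> bc; have := is_bochner_seminorm mD fD (norm_bounded_seminorm X) bc.
rewrite scaleN1r addrC => /le_trans h; rewrite -lee_fin; apply: h.
apply: (@le_trans _ _ (e%:E * leb `]a, b[)%E); last first.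
  by rewrite lebesgue_oo.
rewrite -integral_cst//; apply: ge0_le_integral => //.
- apply/measurable_EFinP; apply: strongly_measurable_seminorm => //; first exact: norm_bounded_seminorm.
  exact: is_bochner_strongly_measurable bc.
- by move=> t; rewrite /= in_itv/= => /ux; rewrite lee_fin scaleN1r addrC.
Qed.

Lemma is_bochner_bound a b u I e : a <= b -> is_bochner leb `]a, b[ u I ->
  (forall t, a < t < b -> `|u t| <= e) -> `|I| <= e * (b - a).
Proof.
move=> ab bI ue; have := @is_bochner_close a b u I 0 e ab bI.
by rewrite scaler0 subr0; apply => t /ue; rewrite subr0.
Qed.

Lemma is_bochner_point a u I : is_bochner leb `]a, a[ u I -> I = 0.
Proof.
move=> bI; have := @is_bochner_close a a u I 0 0 (lexx _) bI.
rewrite scaler0 subr0 mul0r normr_le0 => h; apply/eqP; apply: h => t.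
by case: ltgtP.
Qed.

Hypothesis cX : seq_complete X.

Lemma cont_on_bochner a b u : a <= b -> cont_on a b u -> exists I, is_bochner leb `]a, b[ u I.
Proof.
move=> ab cu; have mD : measurable (`]a, b[ : set (measurableTypeR R)) by exact: measurable_itv.
have fD := lebesgue_oo_fin a b; have mu := cont_on_smeas cu.
apply: is_bochner_exists => //.
have [M M0 uM] := cont_on_bounded ab cu.
apply: (@le_lt_trans _ _ (M%:E * leb `]a, b[)%E); last by rewrite lte_mul_pinfty.
rewrite -integral_cst//; apply: ge0_le_integral => //.
- by apply/measurable_EFinP; apply: strongly_measurable_seminorm => //; exact: norm_bounded_seminorm.
- by move=> t; rewrite /= in_itv/= => /andP[at_ tb]; rewrite lee_fin uM// !ltW.
Qed.

(** Increments of J are integrals over the intermediate interval; boundedness of u then gives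
    continuity of J, and continuity of u its right derivative. *)
Lemma primitive_exists u : C0_ge0 u -> exists J : R -> X,
  [/\ forall t, 0 <= t -> is_bochner leb `]0, t[ u (J t), J 0 = 0,
      C0_ge0 J & forall t, 0 <= t -> right_deriv J t (u t)].
Proof.
move=> cu.
have /choice[J JP] t : exists I, 0 <= t -> is_bochner leb `]0, t[ u I.
  have [t0|t0] := leP 0 t; last by exists 0.
  by have [I IP] := cont_on_bochner t0 (C0_ge0_cont_on cu); exists I.
have diff s t : 0 <= s -> s <= t -> exists2 I, is_bochner leb `]s, t[ u I & J t = J s + I.
  move=> s0 st; have [|I IP] := @cont_on_bochner s t u st.
    by apply: (@cont_onS _ _ 0 t) => //; exact: C0_ge0_cont_on.
  exists I => //; apply: (is_bochner_itvU s0 st _ IP); apply: JP => //.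
  exact: le_trans st.
exists J; split => //; first by apply: is_bochner_point; exact: JP.
- apply: cont_on_C0_ge0 => b b0 t /andP[t0 tb] e e0.
  have [M M0 uM] := cont_on_bounded (ltW b0) (C0_ge0_cont_on cu (b := b)).
  have M1 : 0 < M + 1 by rewrite ltr_wpDl.
  exists (e / (M + 1)); first by rewrite divr_gt0.
  have key r s : 0 <= r -> r <= s -> s <= b -> `|J s - J r| <= M * (s - r).
    move=> r0 rs sb; have [I bI ->] := diff r s r0 rs.
    rewrite addrC addKr; apply: (is_bochner_bound rs bI) => z /andP[rz zs].
    by rewrite uM// (le_trans r0) ?(ltW rz)//= (le_trans (ltW zs)).
  move=> s /andP[s0 sb]; rewrite ltr_pdivlMr// => st.
  have Mle (z : R) : 0 <= z -> M * z <= z * (M + 1) by move=> z0; rewrite mulrC ler_wpM2l// lerDl.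
  have [ts|/ltW ts] := leP t s.
    apply: le_lt_trans (key _ _ t0 ts sb) _; apply: le_lt_trans st.
    by rewrite ger0_norm ?Mle// subr_ge0.
  rewrite distrC; apply: le_lt_trans (key _ _ s0 ts tb) _; apply: le_lt_trans st.
  by rewrite distrC ger0_norm ?Mle// subr_ge0.
- move=> t t0; apply/right_derivP => e e0.
  have /C0_ge0P cu' := cu; have [del d0 dP] := cu' t t0 e e0.
  exists del => // h h0 hd; have th : t <= t + h by rewrite lerDl ltW.
  have [I bI ->] := diff t (t + h) t0 th.
  rewrite [J t + I]addrC addrK -[X in X *: _](addrK t) [h + t]addrC -[X in _ * X](addrK t) [h + t]addrC.
  apply: (is_bochner_close th bI) => s /andP[ts sth].
  apply/ltW/dP; first exact: le_trans (ltW ts).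
  by rewrite gtr0_norm ?subr_gt0// ltrBlDl (lt_trans sth)// ltrD2l.
Qed.

End continuous_bochner.

(** * Bounded forms and semigroups *)

Lemma right_cvg_ext (R : realType) (X : normedModType R) (f g : R -> X) (l : X) :
  (forall h, 0 < h -> f h = g h) -> f h @[h --> 0^'+] --> l -> g h @[h --> 0^'+] --> l.
Proof.
move=> fg /right_cvgP fl; apply/right_cvgP => e e0; have [del d0 dP] := fl e e0.
by exists del => // h h0 hd; rewrite -fg//; exact: dP.
Qed.

Lemma right_deriv_cont (R : realType) (X : normedModType R) (v : R -> X) t l : right_deriv v t l ->
  v (t + h) @[h --> 0^'+] --> v t.
Proof.
move=> dv; have h0 : h *: (h^-1 *: (v (t + h) - v t)) + v t @[h --> 0^'+] --> (0 : R) *: l + v t.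
  apply: cvgD; last exact: cvg_cst.
  by apply: cvgZ => //; apply: cvg_at_right_filter; exact: cvg_id.
rewrite scale0r add0r in h0; apply: right_cvg_ext h0 => h h0.
by rewrite scalerA divff ?gt_eqF// scale1r subrK.
Qed.

Lemma right_deriv_scale (R : realType) (X : normedModType R) (a : R -> R) (u : R -> X) t k l :
  right_deriv (a : R -> R^o) t k ->
  right_deriv u t l -> right_deriv (fun s => a s *: u s) t (a t *: l + k *: u t).
Proof.
move=> da du; have ca := right_deriv_cont da.
have h0 : a (t + h) *: (h^-1 *: (u (t + h) - u t)) + (h^-1 *: (a (t + h) - a t : R^o)) *: u t
    @[h --> 0^'+] --> a t *: l + k *: u t.
  by apply: cvgD; apply: cvgZ => //; exact: cvg_cst.
apply: right_cvg_ext h0 => h _.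
rewrite -[h^-1 *: (_ - _ : R^o)]/(h^-1 * (a (t + h) - a t)) scalerA mulrC -!scalerA -scalerDr.
by congr (_ *: _); rewrite scalerBr scalerBl addrA subrK.
Qed.

Lemma is_derive_right_deriv (R : realType) (f : R -> R) (t l : R) :
  is_derive t (1 : R) f l -> right_deriv (f : R -> R^o) t l.
Proof.
move=> [dv <-]; have /cvg_ex[k kP] := dv.
have -> : 'D_1 f t = k by exact: cvg_lim.
move/dnbhs_cvgP : kP => kP; apply/right_cvgP => e e0.
have [del d0 dP] := kP e e0; exists del => // h h0 hd.
have := dP h; rewrite gt_eqF// subr0 gtr0_norm// => /(_ isT hd).
by rewrite /= -[h *: 1]/(h * 1) mulr1 [h + t]addrC.
Qed.

Lemma right_deriv_expR (R : realType) (k t : R) :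
  right_deriv (fun s => expR (k * s) : R^o) t (k * expR (k * t)).
Proof.
apply: is_derive_right_deriv.
have dk : is_derive t (1 : R) (fun s : R => k * s) k.
  by have := is_deriveZ k (is_derive_id t (1 : R)); rewrite /GRing.scale /= mulr1.
by have := @is_derive1_comp _ expR (fun s => k * s) t _ _ (is_derive_expR _) dk; rewrite mulrC.
Qed.

Section bounded_form.
Context {R : realType} (X : normedModType R).

Definition bounded_form (b : X -> X -> R) (C : R) :=
  [/\ forall x y, b x y = b y x, forall a x x' y, b (a *: x + x') y = a * b x y + b x' y,
      forall x y, `|b x y| <= C * `|x| * `|y|, forall x, 0 <= b x x & 0 <= C].

Variables (b : X -> X -> R) (C : R).
Hypothesis hb : bounded_form b C.

Let bC x y : b x y = b y x. Proof. by case: hb. Qed.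
Let b_ge0 x : 0 <= b x x. Proof. by case: hb. Qed.
Let b_bound x y : `|b x y| <= C * `|x| * `|y|. Proof. by case: hb. Qed.
Let C0 : 0 <= C. Proof. by case: hb. Qed.

Lemma bformDl x x' y : b (x + x') y = b x y + b x' y.
Proof. by have [_ bl _ _ _] := hb; have := bl 1 x x' y; rewrite scale1r mul1r. Qed.

Lemma bform0l y : b 0 y = 0.
Proof. by have [_ bl _ _ _] := hb; have := bl (-1) 0 0 y; rewrite scaler0 addr0 mulN1r addNr. Qed.

Lemma bformZl a x y : b (a *: x) y = a * b x y.
Proof. by have [_ bl _ _ _] := hb; have := bl a x 0 y; rewrite addr0 bform0l addr0. Qed.

Lemma bformNl x y : b (- x) y = - b x y.
Proof. by rewrite -scaleN1r bformZl mulN1r. Qed.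

Lemma bformDr x y y' : b x (y + y') = b x y + b x y'.
Proof. by rewrite bC bformDl !(bC x). Qed.

Lemma bformZr a x y : b x (a *: y) = a * b x y.
Proof. by rewrite bC bformZl bC. Qed.

Lemma bformNr x y : b x (- y) = - b x y.
Proof. by rewrite -scaleN1r bformZr mulN1r. Qed.

Lemma bform_cvg (I : Type) (F : set_system I) (FF : ProperFilter F) (f g : I -> X) x y :
  f @ F --> x -> g @ F --> y -> b (f i) (g i) @[i --> F] --> b x y.
Proof.
move=> fx gy.
have h0 : C * `|f i - x| * `|g i| + C * `|x| * `|g i - y| @[i --> F] --> 0.
  rewrite (_ : 0 = C * `|x - x| * `|y| + C * `|x| * `|y - y|); last first.
    by rewrite !subrr !normr0 mulr0 mul0r mulr0 addr0.
  apply: cvgD; apply: cvgM.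
  - by apply: cvgMr; apply: cvg_norm; apply: cvgB => //; exact: cvg_cst.
  - exact: cvg_norm.
  - exact: cvg_cst.
  - by apply: cvg_norm; apply: cvgB => //; exact: cvg_cst.
apply/cvgrPdist_lt => e e0; move/cvgr0Pnorm_lt : h0 => /(_ e e0).
apply: filterS => i; apply: le_lt_trans; rewrite distrC.
have -> : b (f i) (g i) - b x y = b (f i - x) (g i) + b x (g i - y).
  by rewrite bformDl bformNl bformDr bformNr; ring.
apply: le_trans (ler_norm _); apply: (le_trans (ler_normD _ _)).
by rewrite lerD.
Qed.

Lemma bform_continuous : continuous (fun z : (X * X)%type => b z.1 z.2).
Proof. by move=> z; apply: bform_cvg; [exact: cvg_fst|exact: cvg_snd]. Qed.

(** Positivity of the form at 2 l x + y and at 2 l x - y, divided by 4 l, gives the two signs. *)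
Lemma bform_amgm x y l : 0 < l -> `|b x y| <= l * b x x + b y y / (4 * l).
Proof.
move=> l0.
have h s : 0 <= l * b x x + s * b x y + s ^+ 2 * b y y / (4 * l).
  have := b_ge0 ((2 * l) *: x + s *: y).
  rewrite bformDl !bformDr !(bformZl, bformZr) (bC y x) => h.
  have -> : l * b x x + s * b x y + s ^+ 2 * b y y / (4 * l) =
    (2 * l * (2 * l * b x x) + s * (2 * l * b x y) + (2 * l * (s * b x y) + s * (s * b y y))) / (4 * l).
    by field; rewrite gt_eqF.
  rewrite divr_ge0 ?mulr_ge0 ?(ltW l0)//; apply: le_trans h _.
  by rewrite le_eqVlt; apply/orP; left; apply/eqP; ring.
have := h 1; have := h (-1); rewrite sqrrN expr1n !mul1r mulN1r.
by move=> h1 h2; rewrite ler_norml; apply/andP; split; lra.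
Qed.

Lemma bform_cauchy_schwarz x y : b x y ^+ 2 <= b x x * b y y.
Proof.
have h p q : 0 <= p ^+ 2 * b x x + 2 * p * q * b x y + q ^+ 2 * b y y.
  have := b_ge0 (p *: x + q *: y).
  rewrite bformDl !bformDr !(bformZl, bformZr) (bC y x) => /le_trans; apply.
  by rewrite le_eqVlt; apply/orP; left; apply/eqP; ring.
(* The form may be degenerate: b x x = 0 has to force b x y = 0. Otherwise the multiple of x chosen
   below makes the quadratic expression equal to -1. *)
have [xx0|xx0] := eqVneq (b x x) 0.
  have [->|xy0] := eqVneq (b x y) 0; first by rewrite expr0n mulr_ge0.
  have := h (- (1 + b y y) / (2 * b x y)) 1.
  rewrite xx0 mulr0 add0r mulr1 expr1n mul1r.
  have -> : 2 * (- (1 + b y y) / (2 * b x y)) * b x y = - (1 + b y y) by field.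
  by rewrite opprD subrK oppr_ge0 ler10.
have xx1 : 0 < b x x by rewrite lt0r xx0 b_ge0.
have := h (b x y) (- b x x).
have -> : b x y ^+ 2 * b x x + 2 * b x y * - b x x * b x y + (- b x x) ^+ 2 * b y y =
  b x x * (b x x * b y y - b x y ^+ 2) by ring.
by rewrite pmulr_rge0// subr_ge0.
Qed.

Definition form_norm x := Num.sqrt (b x x).

Lemma form_normK x : form_norm x ^+ 2 = b x x.
Proof. by rewrite sqr_sqrtr. Qed.

Lemma form_norm_seminorm : bounded_seminorm form_norm.
Proof.
split.
- move=> x y; rewrite -(@ler_pXn2r _ 2) ?nnegrE ?addr_ge0 ?sqrtr_ge0//.
  rewrite form_normK sqrrD !form_normK bformDl !bformDr (bC y x).
  have cs : b x y <= form_norm x * form_norm y.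
    apply: (le_trans (ler_norm _)); rewrite -sqrtrM// -sqrtr_sqr ler_sqrt ?mulr_ge0//.
    exact: bform_cauchy_schwarz.
  by rewrite mulr2n; lra.
- by move=> a x; rewrite /form_norm bformZl bformZr mulrA -expr2 sqrtrM ?sqr_ge0// sqrtr_sqr.
- exists (Num.sqrt C) => [|x]; first exact: sqrtr_ge0.
  rewrite /form_norm -[`|x|]ger0_norm// -sqrtr_sqr -sqrtrM//.
  apply: ler_wsqrtr; rewrite expr2 mulrA; apply: le_trans (b_bound x x).
  exact: ler_norm.
Qed.

(** By symmetry the increment of b (v, v) is b (v (t + h) - v t, v (t + h) + v t), and the quotient
    converges because b is jointly continuous. *)
Lemma right_deriv_form (v : R -> X) t l : right_deriv v t l ->
  right_deriv (fun s => b (v s) (v s) : R^o) t (2 * b l (v t)).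
Proof.
move=> dv; have cv := right_deriv_cont dv.
have h0 : b (h^-1 *: (v (t + h) - v t)) (v (t + h) + v t) @[h --> 0^'+] --> b l (v t + v t).
  by apply: bform_cvg => //; apply: cvgD => //; exact: cvg_cst.
rewrite -mulr2n -scaler_nat bformZr in h0; apply: right_cvg_ext h0 => h _.
by rewrite bformZl bformDr !bformDl !bformNl (bC (v t) (v (t + h))) /GRing.scale /=; ring.
Qed.

End bounded_form.

(** * Strongly continuous semigroups and their generators *)

Section semigroup.
Context {R : realType} (X : normedModType R) (S : R -> X -> X).
Hypothesis cX : seq_complete X.
Hypothesis hS : C0_semigroup S.
Notation leb := (@lebesgue_measure R).

Lemma semigroup_linear t : 0 <= t -> forall a x y, S t (a *: x + y) = a *: S t x + S t y.
Proof. by case: hS => h _ _ _ /h[]. Qed.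

Lemma semigroup0 t : 0 <= t -> S t 0 = 0.
Proof.
move=> t0; have := semigroup_linear t0 (-1) 0 0.
by rewrite scaler0 addr0 scaleN1r addNr.
Qed.

Lemma semigroupD t x y : 0 <= t -> S t (x + y) = S t x + S t y.
Proof. by move=> t0; have := semigroup_linear t0 1 x y; rewrite !scale1r. Qed.

Lemma semigroupZ t a x : 0 <= t -> S t (a *: x) = a *: S t x.
Proof. by move=> t0; have := semigroup_linear t0 a x 0; rewrite semigroup0// !addr0. Qed.

Lemma semigroupB t x y : 0 <= t -> S t (x - y) = S t x - S t y.
Proof. by move=> t0; rewrite semigroupD// -scaleN1r semigroupZ// scaleN1r. Qed.

Lemma semigroup_bounded_at t : 0 <= t -> exists2 C, 0 <= C & forall x, `|S t x| <= C * `|x|.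
Proof.
move=> t0; have [/(_ t t0)[_ cS] _ _ _] := hS.
have /cvgrPdist_lt/(_ 1 ltr01)/nbhs_ballP[r /= r0 rP] := cS 0.
exists (2 / r) => [|x]; first by rewrite divr_ge0// ltW.
have [->|x0] := eqVneq x 0; first by rewrite semigroup0// !normr0 mulr0.
have nx : 0 < `|x| by rewrite normr_gt0.
pose k := r / 2 / `|x|; have k0 : 0 < k by rewrite !divr_gt0.
have nk : `|k *: x| = r / 2 by rewrite normrZ gtr0_norm// divfK ?gt_eqF.
have := rP (k *: x); rewrite -ball_normE /= sub0r normrN nk.
rewrite ltr_pdivrMr// ltr_pMr// ltr1n => /(_ isT).
rewrite semigroup0// sub0r normrN semigroupZ// normrZ gtr0_norm//.
rewrite mulrC -ltr_pdivlMr// mul1r => /ltW h; apply: (le_trans h).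
by rewrite /k invf_div mulrC invf_div.
Qed.

Lemma semigroup_right_cont x e : 0 < e ->
  exists2 del, 0 < del & forall h, 0 <= h -> h < del -> `|S h x - x| < e.
Proof.
move=> e0; have [_ S0 _ /(_ x)/right_cvgP/(_ e e0)[del d0 dP]] := hS.
exists del => // h; rewrite le_eqVlt => /orP[/eqP <- _|]; last exact: dP.
by rewrite S0 subrr normr0.
Qed.

(* Uniform boundedness by a gliding hump: if it fails near 0, a series of small
   vectors y_k is built whose sum x has S (t_k) x unbounded for some t_k -> 0. *)
Lemma semigroup_bounded_near0 : exists2 del, 0 < del &
  exists2 M, 0 <= M & forall t x, 0 <= t -> t < del -> `|S t x| <= M * `|x|.
Proof.
apply: contrapT => H.
(* A triple (t, y, C): a time t < 1 / (k + 1), a perturbation with |y| <= c and |S t (x + y)| >= k +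
   1, and a bound C of S t. Either z or -z serves as y, because 2 S t z is the difference of S t (x
   + z) and S t (x - z). *)
have hump (k : nat) (x : X) (c : R) : 0 < c -> exists p : R * X * R,
    [/\ 0 <= p.1.1 /\ p.1.1 < k.+1%:R^-1, `|p.1.2| <= c, k.+1%:R <= `|S p.1.1 (x + p.1.2)|,
        0 <= p.2 & forall z, `|S p.1.1 z| <= p.2 * `|z|].
  move=> c0.
  have [t [y [t0 tk yM]]] : exists t y, [/\ 0 <= t, t < k.+1%:R^-1 &
      k.+1%:R / c * `|y| < `|S t y|].
    apply: contrapT => h; apply: H; exists k.+1%:R^-1; first by rewrite invr_gt0.
    exists (k.+1%:R / c); first by rewrite divr_ge0// ltW.
    move=> t x' t0 tk; rewrite leNgt; apply/negP => h'; apply: h.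
    by exists t, x'.
  have [C C0 CP] := semigroup_bounded_at t0.
  have y0 : 0 < `|y|.
    rewrite normr_gt0; apply: contraTneq yM => ->.
    by rewrite semigroup0// !normr0 mulr0 ltxx.
  pose z := (c / `|y|) *: y.
  have nz : `|z| = c by rewrite normrZ ger0_norm ?divr_ge0 ?ltW// divfK ?gt_eqF.
  have Sz : k.+1%:R <= `|S t z|.
    rewrite semigroupZ// normrZ ger0_norm; last by rewrite divr_ge0// ltW.
    rewrite mulrAC ler_pdivlMr// -ler_pdivrMl//.
    by apply: le_trans (ltW yM); rewrite mulrA [c^-1 * _]mulrC.
  have : 2 * k.+1%:R <= `|S t (x + z)| + `|S t (x - z)|.
    apply: (@le_trans _ _ (2 * `|S t z|)); first by rewrite ler_pM2l.
    rewrite -[2 in leLHS]ger0_norm// -normrZ.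
    have -> : 2 *: S t z = S t (x + z) - S t (x - z).
      by rewrite semigroupD// semigroupB// opprB addrC addrA subrK scaler_nat mulr2n.
    exact: ler_normB.
  have [h _|h h2] := leP k.+1%:R `|S t (x + z)|.
    by exists (t, z, C); split; rewrite //= nz.
  exists (t, - z, C); split; rewrite /= ?normrN ?nz//.
  by move: h h2; lra.
have /choice[g gP] (kxc : nat * X * R) : exists p : R * X * R, 0 < kxc.2 ->
    [/\ 0 <= p.1.1 /\ p.1.1 < kxc.1.1.+1%:R^-1, `|p.1.2| <= kxc.2,
     kxc.1.1.+1%:R <= `|S p.1.1 (kxc.1.2 + p.1.2)|,
        0 <= p.2 & forall z, `|S p.1.1 z| <= p.2 * `|z|].
  case: kxc => -[k x] c /=; have [c0|c0] := ltP 0 c; last by exists 0.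
  by have [p pP] := hump k x c c0; exists p.
(* A partial sum together with the size allowed for the next perturbation. Halving makes the series
   converge; the second bound keeps all later perturbations from moving the value of S (t_k) by more
   than 1. *)
pose fix st (k : nat) : X * R := if k is k'.+1 then
  let xc := st k' in let p := g (k', xc.1, xc.2) in
  (xc.1 + p.1.2, Num.min (xc.2 / 2) (2 * (1 + p.2))^-1)
  else (0, 1).
have c0 k : 0 < (st k).2.
  elim: k => //= k IH; rewrite lt_min divr_gt0//= invr_gt0 mulr_gt0//.
  by have [_ _ _ C0 _] := gP (k, (st k).1, (st k).2) IH; rewrite ltr_wpDr.
have step k := gP (k, (st k).1, (st k).2) (c0 k).
(* Twice the allowed size at stage k dominates the sum of all perturbations from stage k on; adding
   twice the remaining size makes the induction close. *)
have dist m k : (k <= m)%N -> `|(st m).1 - (st k).1| + 2 * (st m).2 <= 2 * (st k).2.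
  elim: m => [|m IH].
    by rewrite leqn0 => /eqP ->; rewrite subrr normr0 add0r.
  rewrite leq_eqVlt => /orP[/eqP ->|]; first by rewrite subrr normr0 add0r.
  rewrite ltnS => /IH {}IH; have [_ yc _ _ _] := step m.
  have -> : (st m.+1).1 = (st m).1 + (g (m, (st m).1, (st m).2)).1.2 by [].
  have : (st m.+1).2 <= (st m).2 / 2 by rewrite /= ge_min lexx.
  move: yc; set y := (_.1.2) => /= yc h2.
  have := ler_normD ((st m).1 - (st k).1) y.
  rewrite [_ + y - _]addrAC; lra.
have csmall k : (st k).2 <= 2^-1 ^+ k.
  elim: k => [|k IH]; first by rewrite expr0.
  rewrite exprS /= ge_min; apply/orP; left; rewrite mulrC ler_pM2l//.
have [|x stx] := cX (u := fun k => (st k).1).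
  move=> e e0; have e40 : 0 < e / 4 by rewrite divr_gt0.
  have h0 : (2^-1 : R) ^+ k @[k --> \oo] --> 0.
    by apply: cvg_expr; rewrite ger0_norm// invf_lt1// ltr1n.
  move/cvgr0Pnorm_lt : h0 => /(_ _ e40)[N _ NP].
  have /= := NP N (leqnn _); rewrite ger0_norm ?exprn_ge0// => h.
  have D m : (N <= m)%N -> `|(st m).1 - (st N).1| < e / 2.
    move=> /dist; have := csmall N; have := c0 m; lra.
  exists N => m n /D Nm /D Nn; rewrite -(subrKA (st N).1) (le_lt_trans (ler_normD _ _))//.
  by rewrite [e]splitr ltrD// distrC.
have lim k : `|x - (st k).1| <= 2 * (st k).2.
  have : `|(st m).1 - (st k).1| @[m --> \oo] --> `|x - (st k).1|.
    by apply: cvg_norm; apply: cvgB => //; exact: cvg_cst.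
  move=> /cvgr_to_le; apply; exists k => // m /= /dist; have := c0 m; lra.
have big k : k%:R <= `|S (g (k, (st k).1, (st k).2)).1.1 x|.
  have [[t0 _] _ Sk C0 CP] := step k; move: Sk C0 CP t0.
  have := lim k.+1; rewrite /=; set p := g _ => xk Sk C0 CP t0.
  have -> : x = (st k).1 + p.1.2 + (x - ((st k).1 + p.1.2)) by rewrite addrC subrK.
  rewrite semigroupD//.
  have h1 := CP (x - ((st k).1 + p.1.2)).
  have h2 : `|S p.1.1 (x - ((st k).1 + p.1.2))| <= 1.
    apply: le_trans h1 _.
    have p1 : 0 < 1 + p.2 by rewrite ltr_wpDr.
    apply: (@le_trans _ _ (p.2 * (2 * (2 * (1 + p.2))^-1))).
      apply: ler_wpM2l => //; apply: le_trans xk _.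
      by rewrite ler_pM2l// ge_min lexx orbT.
    have -> : 2 * (2 * (1 + p.2))^-1 = (1 + p.2)^-1 by rewrite invfM mulrA mulfV// mul1r.
    by rewrite ler_pdivrMr// mul1r lerDr.
  have := lerB_normD (S p.1.1 ((st k).1 + p.1.2)) (S p.1.1 (x - ((st k).1 + p.1.2))).
  move: Sk h2; rewrite /= -natr1; lra.
have [del d0 dP] := semigroup_right_cont x ltr01.
(* For k above this value, t_k < del, hence |S (t_k) x| < |x| + 1 by continuity of the orbit at 0,
   whereas [big] gives at least k. *)
have /archi_boundP : 0 <= `|x| + 1 + del^-1.
  by rewrite !addr_ge0// invr_ge0 ltW.
set k := Num.bound _ => kb.
have [[t0 tk] _ _ _ _] := step k.
have := dP _ t0; have := big k; set t := (_.1.1) in t0 tk * => h1.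
have h2 : t < del.
  apply: (lt_trans tk); rewrite -[del]invrK ltf_pV2 ?posrE ?invr_gt0//.
  rewrite -natr1; have := normr_ge0 x; lra.
move=> /(_ h2); have := lerB_dist (S t x) x.
have : 0 < del^-1 by rewrite invr_gt0.
lra.
Qed.

(** The interval [0, T] is covered by finitely many steps of length del / 2, each of which costs a
    factor N; as N >= 1, the bound for the last step serves all times. *)
Lemma semigroup_bounded T : exists2 M, 1 <= M &
  forall t x, 0 <= t <= T -> `|S t x| <= M * `|x|.
Proof.
have [del d0 [M M0 MP]] := semigroup_bounded_near0.
pose N := M + 1; have N1 : 1 <= N by rewrite lerDr.
pose r := del / 2; have r0 : 0 < r by rewrite divr_gt0.
have rd : r < del by rewrite ltr_pdivrMr// ltr_pMr// ltr1n.
have NP t x : 0 <= t -> t <= r -> `|S t x| <= N * `|x|.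
  move=> t0 tr; apply: (le_trans (MP t x t0 (le_lt_trans tr rd))).
  by rewrite ler_wpM2r// lerDl.
have step n t x : 0 <= t -> t <= r *+ n -> `|S t x| <= N ^+ n * `|x|.
  elim: n t x => [|n IH] t x t0.
    rewrite mulr0n => t0'; have -> : t = 0 by apply/eqP; rewrite eq_le t0 t0'.
    by have [_ -> _ _] := hS; rewrite expr0 mul1r.
  have [tn _|tn] := leP t (r *+ n).
    apply: (le_trans (IH t x t0 tn)); rewrite ler_wpM2r// exprS ler_peMl//.
    by rewrite exprn_ge0// (le_trans _ N1).
  rewrite mulrSr -lerBlDl => tr.
  have tn0 : 0 <= t - r *+ n by rewrite subr_ge0 ltW.
  have rn0 : 0 <= r *+ n by rewrite mulrn_wge0// ltW.
  rewrite -(subrK (r *+ n) t); have [_ _ -> // _] := hS.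
  apply: (le_trans (NP _ _ tn0 tr)); rewrite exprS -mulrA ler_wpM2l ?(le_trans _ N1)//.
  exact: IH.
have /archi_boundP : 0 <= `|T| / r by rewrite divr_ge0// ltW.
set n := Num.bound _ => nb; exists (N ^+ n); first by rewrite exprn_ege1.
move=> t x /andP[t0 tT]; apply: step => //.
rewrite -mulr_natl -ler_pdivrMr//; apply: le_trans (ltW nb).
by rewrite ler_pM2r ?invr_gt0// (le_trans tT)// ler_norm.
Qed.

(** With r the smaller of the two times, the increment is S r (S h x - x); continuity from the left
    therefore rests on the uniform bound for S r. *)
Lemma semigroup_cont_on x b : cont_on 0 b (fun t => S t x).
Proof.
move=> t /andP[t0 tb] e e0; have [M M1 MP] := semigroup_bounded b.
have M0 : 0 < M by rewrite (lt_le_trans _ M1).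
have eM : 0 < e / M by rewrite divr_gt0.
have [del d0 dP] := semigroup_right_cont x eM; exists del => // s /andP[s0 sb] st.
have key r h : 0 <= r -> 0 <= h -> r + h <= b -> h < del -> `|S (r + h) x - S r x| < e.
  move=> r0 h0 rhb hd; have [_ _ -> // _] := hS; rewrite -semigroupB//.
  apply: (@le_lt_trans _ _ (M * `|S h x - x|)).
    by apply: MP; rewrite r0 (le_trans _ rhb)// lerDl.
  by rewrite mulrC -ltr_pdivlMr// dP.
have [ts|/ltW ts] := leP t s.
  have := key t (s - t); rewrite [t + _]addrC subrK; apply => //; rewrite ?subr_ge0//.
  by apply: le_lt_trans st; exact: ler_norm.
rewrite distrC; have := key s (t - s); rewrite [s + _]addrC subrK; apply => //; rewrite ?subr_ge0//.
by apply: le_lt_trans st; rewrite distrC; exact: ler_norm.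
Qed.

Lemma semigroup_C0 x : C0_ge0 (fun t => S t x).
Proof. by apply: cont_on_C0_ge0 => b _; exact: semigroup_cont_on. Qed.

Lemma semigroup_conv_cont a t (u : R -> X) : 0 <= a -> cont_on a t u ->
  cont_on a t (fun s => S (t - s) (u s)).
Proof.
move=> a0 cu s /andP[as_ st] e e0; have [M M1 MP] := semigroup_bounded t.
have M0 : 0 < M by rewrite (lt_le_trans _ M1).
have eM : 0 < e / 2 / M by rewrite !divr_gt0.
have e20 : 0 < e / 2 by rewrite divr_gt0.
have ts b : a <= b <= t -> 0 <= t - b <= t.
  by move=> /andP[ab bt]; rewrite subr_ge0 bt lerBlDr lerDl (le_trans a0).
have [|d1 d10 d1P] := cu s _ _ eM; first by rewrite as_.
have [|d2 d20 d2P] := @semigroup_cont_on (u s) t (t - s) _ _ e20; first by rewrite ts// as_.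
exists (Num.min d1 d2); first by rewrite lt_min d10.
move=> r art; rewrite lt_min => /andP[r1 r2].
have tr := ts r art; have /andP[tr0 _] := tr.
rewrite -(subrKA (S (t - r) (u s))) (le_lt_trans (ler_normD _ _))//.
rewrite [e]splitr ltrD//.
  rewrite -semigroupB// (le_lt_trans (MP _ _ tr))// mulrC -ltr_pdivlMr//.
  exact: d1P.
by apply: d2P => //; rewrite (_ : t - r - (t - s) = - (r - s)) ?normrN//; ring.
Qed.

Variable A : X -> X -> Prop.
Hypothesis hA : generates A S.

Lemma generator_right_deriv x y t : A x y -> 0 <= t -> right_deriv (fun s => S s x) t (S t y).
Proof.
move=> /hA Axy t0; have [/(_ t t0)[_ cS] _ SD _] := hS.
apply: right_cvg_ext (cvg_comp _ _ Axy (cS y)) => h /ltW h0.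
by rewrite /= semigroupZ// semigroupB// SD.
Qed.

Lemma generator_semigroup x y t : A x y -> 0 <= t -> A (S t x) (S t y).
Proof.
move=> Axy t0; apply/hA; apply: right_cvg_ext (generator_right_deriv Axy t0) => h /ltW h0.
by have [_ _ SD _] := hS; rewrite [t + h]addrC SD.
Qed.

Lemma generator_comb a x y x' y' : A x y -> A x' y' -> A (a *: x + x') (a *: y + y').
Proof.
move=> /hA xy /hA xy'; apply/hA.
have h : a *: (h^-1 *: (S h x - x)) + h^-1 *: (S h x' - x') @[h --> 0^'+] --> a *: y + y'.
  by apply: cvgD => //; apply: cvgZr.
apply: right_cvg_ext h => h /ltW h0.
by rewrite semigroup_linear// opprD [in RHS]addrACA -scalerBr [RHS]scalerDr !scalerA mulrC.
Qed.

(** The orbit of x has right derivative S r y, so its first-order error is governed by the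
    oscillation of the orbit of y. *)
Lemma generator_quotient x y h e : A x y -> 0 <= h ->
  (forall r, 0 <= r <= h -> `|S r y - y| <= e) -> `|S h x - x - h *: y| <= e * h.
Proof.
move=> Axy h0 re; have [_ S0 _ _] := hS.
have := @right_deriv_close _ _ (fun s => S s x) (fun s => S s y) y 0 h e h0.
rewrite S0 subr0; apply; first exact: semigroup_cont_on.
  by move=> t /andP[t0 _]; exact: generator_right_deriv.
by move=> t /andP[t0 th]; rewrite re// t0 ltW.
Qed.

(** S r shifts the window of integration: it turns the primitive J h into J (h + r) - J r. The
    generator quotient at J h is thus the difference of the quotients of J at h and at 0. *)
Lemma generator_integral x h I : 0 <= h -> is_bochner leb `]0, h[ (fun s => S s x) I ->
  A I (S h x - x).
Proof.
move=> h0 bI; have [J [JP J0 cJ dJ]] := primitive_exists cX (@semigroup_C0 x).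
have IJ : I = J h.
  apply: is_bochner_unique bI (JP _ h0); [exact: measurable_itv|exact: lebesgue_oo_fin].
have [_ S0 SD _] := hS.
have key r : 0 <= r -> S r (J h) = J (h + r) - J r.
  (* As functions of the upper limit b, S r (J b) and J (b + r) have the same right derivative S (b
     + r) x; at b = 0 they differ by J r. *)
  move=> r0; pose w b := -1 *: S r (J b) + 1 *: J (b + r).
  have SrC : continuous (S r) by have [/(_ r r0)[]] := hS.
  have cw : cont_on 0 h w.
    apply: cont_on_comb; first by apply: (cont_on_map SrC); exact: C0_ge0_cont_on.
    move=> t /andP[t0 th] e e0.
    have [|del d0 dP] := C0_ge0_cont_on (b := h + r) cJ (t := t + r) _ e0.
      by rewrite addr_ge0//= lerD2r.
    exists del => // s /andP[s0 sh] st; apply: dP; first by rewrite addr_ge0//= lerD2r.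
    by rewrite opprD addrACA subrr addr0.
  have : w h = w 0.
    apply: (right_deriv0_cst h0 cw) => t /andP[t0 th].
    rewrite (_ : 0 = -1 *: S r (S t x) + 1 *: S (t + r) x); last first.
      by rewrite scaleN1r scale1r addrC [t + r]addrC SD// subrr.
    apply: right_deriv_comb.
      apply: right_cvg_ext (cvg_comp _ _ (dJ t t0) (SrC (S t x))) => k /ltW k0.
      by rewrite /= semigroupZ// semigroupB.
    apply: right_cvg_ext (dJ (t + r) _) => [k k0|]; last by rewrite addr_ge0.
    by rewrite [t + r + k]addrAC.
  rewrite /w J0 semigroup0// scaler0 !scale1r !add0r scaleN1r.
  by move=> <-; rewrite opprD opprK addrCA subrr addr0.
apply/hA; rewrite IJ.
have : r^-1 *: (J (h + r) - J h) - r^-1 *: (J (0 + r) - J 0) @[r --> 0^'+] --> S h x - x.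
  apply: cvgB; first exact: dJ.
  by rewrite -[X in _ --> X](S0 x); exact: (dJ 0 (lexx _)).
apply: right_cvg_ext => r /ltW r0.
by rewrite key// add0r J0 subr0 -scalerBr addrAC.
Qed.

Lemma generator_average x h : 0 < h -> exists2 z, A z (h^-1 *: (S h x - x)) &
  forall e, (forall r, 0 < r < h -> `|S r x - x| <= e) -> `|z - x| <= e.
Proof.
move=> h0; have [I bI] := cont_on_bochner cX (ltW h0) (@semigroup_cont_on x h).
exists (h^-1 *: I).
  have := generator_comb h^-1 (generator_integral (ltW h0) bI).
  have A0 : A 0 0.
    apply/hA; apply: right_cvg_ext (cvg_cst (0 : X)) => r /ltW r0.
    by rewrite semigroup0// subr0 scaler0.
  by move=> /(_ 0 0 A0); rewrite !addr0.
move=> e re; have := is_bochner_close (ltW h0) bI re; rewrite subr0.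
have -> : I - h *: x = h *: (h^-1 *: I - x).
  by rewrite scalerBr scalerA divff ?gt_eqF// scale1r.
by rewrite normrZ gtr0_norm// mulrC ler_pM2r.
Qed.

(* The domain of A^2 is dense: averages of x lie in D(A), and averages of a
   vector of D(A) lie in D(A^2). *)
Lemma generator_domain2_dense x e : 0 < e -> exists y y' y'',
  [/\ A y y', A y' y'' & `|y - x| < e].
Proof.
move=> e0; have e20 : 0 < e / 2 by rewrite divr_gt0.
have e40 : 0 < e / 2 / 2 by rewrite divr_gt0.
have avg z : exists h z', [/\ 0 < h, A z' (h^-1 *: (S h z - z)) & `|z' - z| < e / 2].
  have [del d0 dP] := semigroup_right_cont z e40.
  have [z' Az' zP] := generator_average z d0.
  exists del, z'; split => //; apply: (@le_lt_trans _ _ (e / 2 / 2)).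
    by apply: zP => r /andP[r0 rd]; apply/ltW/dP => //; exact: ltW.
  by rewrite ltr_pdivrMr// ltr_pMr// ltr1n.
have [h [z [h0 Az zx]]] := avg x.
have [k [y [k0 Ay yz]]] := avg z.
exists y, (k^-1 *: (S k z - z)); eexists; split; first exact: Ay; last first.
  by rewrite -(subrKA z) (le_lt_trans (ler_normD _ _))// [e]splitr ltrD.
(* The value of A at y is a multiple of S k z - z, which lies in D(A) because z and S k z do. *)
have ASz := generator_semigroup Az (ltW k0).
have := generator_comb (-1) Az ASz; rewrite scaleN1r addrC => h1.
have A0 : A 0 0.
  apply/hA; apply: right_cvg_ext (cvg_cst (0 : X)) => r /ltW r0.
  by rewrite semigroup0// subr0 scaler0.
by have := generator_comb k^-1 h1 A0; rewrite addr0; exact.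
Qed.

Section energy.
Variables (B : X -> X -> R) (C omega : R).
Hypotheses (hB : bounded_form B C)
  (Bdiss : forall x y z, A x y -> A y z -> B x y <= omega * B x x).
Notation N := (form_norm B).

(** An orbit that starts in D(A^2) stays there, so dissipativity holds along it and exp(-2 omega s)
    B (S s y, S s y) has a nonpositive right derivative. Both sides of the bound are continuous in
    x, hence it extends from the dense subspace. *)
Lemma semigroup_energy x t : 0 <= t -> N (S t x) <= expR (omega * t) * N x.
Proof.
move=> t0; have [BC _ _ _ _] := hB.
have core y y' y'' : A y y' -> A y' y'' -> N (S t y) <= expR (omega * t) * N y.
  move=> Ay Ay'; pose g s := B (S s y) (S s y).
  have dg s : 0 <= s -> right_deriv (fun s => expR (- (2 * omega) * s) * g s : R^o) s
      (expR (- (2 * omega) * s) * (2 * B (S s y') (S s y)) + - (2 * omega) * expR (- (2 * omega) * s) * g s).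
    move=> s0; apply: (@right_deriv_scale R R^o); first exact: right_deriv_expR.
    by apply: (right_deriv_form hB); exact: generator_right_deriv.
  have cg : C0_ge0 (g : R -> R^o).
    apply: cont_on_C0_ge0 => b b0 s sb e e0.
    have /andP[s0 _] := sb.
    have cP : B (S r y) (S r y) @[r --> within `[0, +oo[ (nbhs s)] --> B (S s y) (S s y).
      have cS : S r y @[r --> within `[0, +oo[ (nbhs s)] --> S s y.
        have /C0_ge0P cS := @semigroup_C0 y; apply/within_cvgP => r r0.
        have [del d0 dP] := cS s s0 r r0; exists del => // z.
        by rewrite /= in_itv/= andbT; exact: dP.
      by apply: (bform_cvg hB) => //; apply: within_nbhs_proper; apply: subset_closure;
        rewrite /= in_itv/= s0.
    move/(@within_cvgP _ R^o) : cP => /(_ e e0)[del d0 dP]; exists del => // r /andP[r0 _].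
    by apply: dP; rewrite /= in_itv/= r0.
  have cE : C0_ge0 (fun s => expR (- (2 * omega) * s) : R^o).
    apply: (@continuous_subspaceT R R^o) => s.
    apply: continuous_comp; last exact: continuous_expR.
    by apply: cvgM; [exact: cvg_cst|exact: cvg_id].
  have cEg : cont_on 0 t (fun s => expR (- (2 * omega) * s) * g s : R^o).
    apply: C0_ge0_cont_on => s.
    by apply: (@cvgM _ _ _ _ (fun s => expR (- (2 * omega) * s))); [exact: cE|exact: cg].
  have := right_slope_le (e := 0) t0 cEg.
  rewrite mul0r mulr0 expR0 mul1r subr_le0 => h.
  have {}h : expR (- (2 * omega) * t) * g t <= g 0.
    apply: h => s /andP[s0 st] eta eta0.
    have /right_derivP/(_ eta eta0)[del d0 dP] := dg s s0; exists del => // r r0 rd.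
    have := dP r r0 rd; set l := _ * _ + _ * _; set D := _ - _.
    have l0 : l <= 0.
      have -> : l = expR (- (2 * omega) * s) * (2 * (B (S s y) (S s y') - omega * g s)).
        by rewrite /l (BC (S s y')); ring.
      rewrite pmulr_rle0 ?expR_gt0// pmulr_rle0// subr_le0.
      apply: Bdiss; apply: generator_semigroup; by [exact: Ay|exact: Ay'|].
    move=> /(le_trans (ler_norm _)); rewrite lerBlDr add0r => /le_trans; apply.
    by rewrite gerDl /GRing.scale /= mulr_ge0_le0// ltW.
  have [_ S0 _ _] := hS; rewrite /g S0 in h.
  rewrite -[leRHS]ger0_norm; last by rewrite mulr_ge0 ?expR_ge0 ?sqrtr_ge0.
  rewrite -sqrtr_sqr; apply: ler_wsqrtr; rewrite exprMn (form_normK hB) -expRM_natl.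
  rewrite -ler_pdivrMl ?expR_gt0// -expRN; apply: le_trans h.
  by rewrite mulNr mulrA mulr_natl.
have cp := bseminorm_continuous (form_norm_seminorm hB).
have [/(_ t t0)[_ cS] _ _ _] := hS.
apply/ler_addgt0Pr => e e0; have e20 : 0 < e / 2 by rewrite divr_gt0.
have cL : continuous (fun z => N (S t z) - expR (omega * t) * N z : R^o).
  move=> z; apply: cvgB; first by apply: (continuous_comp (cS z)); exact: cp.
  by apply: cvgM; [exact: cvg_cst|exact: cp].
have /cvgrPdist_lt/(_ e e0)/nbhs_ballP[r /= r0 rP] := cL x.
have [y [y' [y'' [Ay Ay' yx]]]] := generator_domain2_dense x r0.
have := rP y; rewrite -ball_normE /= distrC => /(_ yx).
have := core _ _ _ Ay Ay'; move=> h /(le_lt_trans (ler_norm _)).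
move: (expR _ * N x) (expR _ * N y) h => c d; lra.
Qed.

End energy.

End semigroup.

(** * Mild solutions *)

(** Integrating a Young inequality with parameter l and then minimising over l gives Cauchy-Schwarz.
    If L or G vanishes the minimum may not be attained, and a large or a small l is taken
    instead. *)
Lemma le_sqrt_of_amgm (R : realType) (x L G : R) : 0 <= L -> 0 <= G ->
  (forall l, 0 < l -> 2 * x <= l * L + G / l) -> x <= Num.sqrt (L * G).
Proof.
move=> L0 G0 h.
have [LG|LG] := leP (L * G) 0.
  have LG0 : L * G = 0 by apply/eqP; rewrite eq_le LG mulr_ge0.
  rewrite LG0 sqrtr0; apply/ler_addgt0Pr => e e0; rewrite add0r.
  move/eqP : LG0; rewrite mulf_eq0 => /orP[]/eqP E.
    have := h ((G + 1) / e); rewrite divr_gt0 ?ltr_wpDl// => /(_ isT).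
    rewrite E mulr0 add0r invf_div mulrA => h'.
    have : G * e / (G + 1) <= e.
      by rewrite ler_pdivrMr ?ltr_wpDl// mulrC ler_pM2l// lerDl.
    by move: (G * e / (G + 1)) h' => z; lra.
  have := h (e / (L + 1)); rewrite divr_gt0 ?ltr_wpDl// => /(_ isT).
  rewrite E mul0r addr0 => h'.
  have : e / (L + 1) * L <= e.
    by rewrite mulrAC ler_pdivrMr ?ltr_wpDl// ler_pM2l// lerDl.
  by move: (e / (L + 1) * L) h' => z; lra.
have L1 : 0 < L by rewrite lt0r L0 andbT; apply: contraTneq LG => ->; rewrite mul0r ltxx.
have G1 : 0 < G by rewrite lt0r G0 andbT; apply: contraTneq LG => ->; rewrite mulr0 ltxx.
set s := Num.sqrt (L * G); have s0 : 0 < s by rewrite sqrtr_gt0.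
have ss : s ^+ 2 = L * G by rewrite sqr_sqrtr// mulr_ge0.
(* The minimiser: there both summands equal s. *)
have := h (s / L); rewrite divr_gt0// => /(_ isT).
rewrite divfK ?gt_eqF//; have -> : G / (s / L) = s.
  by rewrite invf_div mulrA [G * L]mulrC -ss expr2 mulfK// gt_eqF.
by rewrite -mulr2n -[s *+ 2]mulr_natl ler_pM2l.
Qed.

Section mild.
Context {R : realType} (X : normedModType R) (S : R -> X -> X).
Hypothesis cX : seq_complete X.
Hypothesis hS : C0_semigroup S.
Notation leb := (@lebesgue_measure R).
Implicit Types (F : R -> X) (q : X -> R).

Let mI (a b : R) : measurable (`]a, b[ : set (measurableTypeR R)).
Proof. exact: measurable_itv. Qed.

(** When F is replaced by a simple function, the integrand is patched from the continuous functions
    r -> S (t - r) x, one for each value x; continuity of S (t - r) passes this to the limit. *)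
Lemma conv_smeas F a t : 0 <= a ->
  strongly_measurable (`]0, +oo[ : set (measurableTypeR R)) F ->
  strongly_measurable (`]a, t[ : set (measurableTypeR R)) (fun s => S (t - s) (F s)).
Proof.
move=> a0 [s [ss sF]].
have ts r : r \in `]a, t[ -> 0 <= t - r.
  by rewrite in_itv/= subr_ge0 => /andP[_ /ltW].
apply: (@strongly_measurable_cvg _ (measurableTypeR R) R X _ (fun n r => S (t - r) (s n r))) => //; last first.
  move=> r /= /[dup] /ts tr; rewrite in_itv/= => /andP[ar rt].
  have [/(_ _ tr)[_ cS] _ _ _] := hS.
  apply: continuous_cvg; first exact: cS.
  by apply: sF; rewrite /= in_itv/= (le_lt_trans a0).
move=> n; have [l [ul lP]] := simple_function_seq (ss n).
(* The list holds the values already treated, with 0 in place of the integrand for the others, so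
   that induction adds one value at a time. *)
suff : strongly_measurable (`]a, t[ : set (measurableTypeR R))
    (fun r => if s n r \in l then S (t - r) (s n r) else 0).
  by apply: strongly_measurable_ext => r _; rewrite lP.
elim: l {ul lP} => [|x l IH]; first exact: strongly_measurable_cst.
apply: (@strongly_measurable_ext _ (measurableTypeR R) R X _ (fun r => if r \in s n @^-1` [set x] then S (t - r) x else
   if s n r \in l then S (t - r) (s n r) else 0)).
  move=> r _; rewrite inE; have [sx|sx] := eqVneq (s n r) x.
    by rewrite mem_set// sx.
  by rewrite memNset//; apply/eqP.
apply: strongly_measurable_patch; first exact: (ss n).2.
  apply: strongly_measurable_sub (@subIsetl _ _ _) _.
  apply: (@cont_on_smeas _ X a t (fun r => S (t - r) x)).
  exact: (semigroup_conv_cont cX hS a0 (cont_on_cst x)).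
exact: strongly_measurable_sub (@subDsetl _ _ _) IH.
Qed.

Lemma L2loc_seminorm F q T : L2loc F -> bounded_seminorm q -> 0 < T ->
  measurable_fun (`]0, T[ : set (measurableTypeR R)) (fun s => q (F s)) /\
  leb.-integrable `]0, T[ (fun s => (q (F s) ^+ 2)%:E).
Proof.
move=> [mF FT] hq T0; have q0 := bseminorm_ge0 hq; have [_ _ [C C0 qC]] := hq.
have mF' : strongly_measurable (`]0, T[ : set (measurableTypeR R)) F.
  apply: strongly_measurable_sub mF => s /=; rewrite !in_itv/= => /andP[-> _]//.
have mq := strongly_measurable_seminorm (mI 0 T) hq mF'.
have mn := strongly_measurable_seminorm (mI 0 T) (norm_bounded_seminorm X) mF'.
split => //; apply/integrableP; split.
  by apply/measurable_EFinP; exact: measurable_funX.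
apply: (@le_lt_trans _ _ (\int[leb]_(s in `]0%R, T[) ((C ^+ 2)%:E * (`|F s| ^+ 2)%:E))%E); last first.
  rewrite ge0_integralZl//; first by rewrite lte_mul_pinfty ?lee_fin ?sqr_ge0//; exact: FT.
    by apply/measurable_EFinP; exact: measurable_funX.
  by rewrite lee_fin sqr_ge0.
apply: ge0_le_integral => //.
- by apply: measurableT_comp => //; apply/measurable_EFinP; exact: measurable_funX.
- by apply/measurable_EFinP; apply: measurable_funM => //; exact: measurable_funX.
- move=> s _; rewrite abse_EFin ger0_norm ?sqr_ge0// -EFinM lee_fin -exprMn.
  by rewrite lerXn2r ?nnegrE// mulr_ge0.
Qed.

(** Stated for any seminorm with its own growth bound: the norm yields continuity of the
    convolution, the energy norm the final estimate. The factor t - a under the root makes short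
    intervals contribute little. *)
Lemma conv_bound q K T F a t I : bounded_seminorm q -> 0 <= K ->
  (forall r x, 0 <= r <= T -> q (S r x) <= K * q x) -> L2loc F ->
  0 <= a -> a <= t -> t <= T -> 0 < T ->
  is_bochner leb `]a, t[ (fun s => S (t - s) (F s)) I ->
  q I <= K * Num.sqrt ((t - a) * \int[leb]_(s in `]0, T[) (q (F s) ^+ 2)).
Proof.
move=> hq K0 qS hF a0 at_ tT T0 bI.
have q0 := bseminorm_ge0 hq.
have [mq iq] := L2loc_seminorm hF hq T0.
have sub : (`]a, t[ : set R) `<=` `]0, T[.
  move=> s /=; rewrite !in_itv/= => /andP[as_ st].
  by rewrite (le_lt_trans a0)//= (lt_le_trans st).
have mqa : measurable_fun (`]a, t[ : set (measurableTypeR R)) (fun s => q (F s)).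
  exact: measurable_funS mq.
have mqc : measurable_fun (`]a, t[ : set (measurableTypeR R)) (fun s => q (S (t - s) (F s))).
  apply: strongly_measurable_seminorm => //; exact: is_bochner_strongly_measurable bI.
have leI := is_bochner_seminorm (mI a t) (lebesgue_oo_fin a t) hq bI.
set G := (\int[leb]_(s in _) _)%R.
have G0 : 0 <= G by apply: Rintegral_ge0 => s _; rewrite sqr_ge0.
have GE : (\int[leb]_(s in `]0%R, T[) (q (F s) ^+ 2)%:E)%E = G%:E.
  by rewrite /G /Rintegral fineK//; apply: integrable_fin_num.
(* The inequality 2 q <= l + q^2 / l is integrated; [le_sqrt_of_amgm] then chooses l. *)
have key l : 0 < l -> 2 * q I <= K * (l * (t - a) + G / l).
  move=> l0; rewrite -lee_fin.
  rewrite EFinM; apply: (@le_trans _ _ (2%:E * \int[leb]_(s in `]a, t[) (q (S (t - s) (F s)))%:E)%E).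
    by rewrite lee_pmul2l// lte_fin.
  apply: (@le_trans _ _ (\int[leb]_(s in `]a, t[) (K%:E * (l%:E + (l^-1)%:E * (q (F s) ^+ 2)%:E)))%E).
    rewrite -ge0_integralZl//; [|exact/measurable_EFinP|by move=> s _; rewrite lee_fin].
    apply: ge0_le_integral => //.
    - by move=> s _; rewrite -EFinM lee_fin mulr_ge0.
    - by apply/measurable_EFinP; exact: measurable_funM.
    - apply/measurable_EFinP; apply: measurable_funM => //; apply: measurable_funD => //.
      by apply: measurable_funM => //; exact: measurable_funX.
    - move=> s; rewrite /= in_itv/= => /andP[as_ st]; rewrite -?EFinM -?EFinD -?EFinM lee_fin.
      apply: (@le_trans _ _ (K * (2 * q (F s)))).
        rewrite mulrCA ler_pM2l//; apply: qS.
        by rewrite subr_ge0 ltW//= lerBlDr (le_trans tT)// lerDl (le_trans a0)// ltW.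
      rewrite ler_wpM2l// -subr_ge0.
      have -> : l + l^-1 * q (F s) ^+ 2 - 2 * q (F s) = l^-1 * (l - q (F s)) ^+ 2.
        by field; rewrite gt_eqF.
      by rewrite mulr_ge0 ?sqr_ge0// invr_ge0 ltW.
  rewrite ge0_integralZl//; last 2 first.
  - apply: emeasurable_funD => //; apply/measurable_EFinP.
    by apply: measurable_funM => //; exact: measurable_funX.
  - move=> s _; rewrite -EFinM -EFinD lee_fin addr_ge0 ?(ltW l0)// mulr_ge0 ?sqr_ge0//.
    by rewrite invr_ge0 ltW.
  rewrite EFinM lee_wpmul2l ?lee_fin//.
  rewrite ge0_integralD//; last 3 first.
  - by move=> s _; rewrite lee_fin ltW.
  - by move=> s _; rewrite -EFinM lee_fin mulr_ge0 ?sqr_ge0// invr_ge0 ltW.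
  - by apply/measurable_EFinP; apply: measurable_funM => //; exact: measurable_funX.
  rewrite integral_cst// EFinD leeD//.
    by rewrite -[X in (_ * X)%E](esym (lebesgue_oo at_)) -EFinM.
  rewrite ge0_integralZl//; last 3 first.
  - by apply/measurable_EFinP; exact: measurable_funX.
  - by move=> s _; rewrite lee_fin sqr_ge0.
  - by rewrite lee_fin invr_ge0 ltW.
  rewrite EFinM muleC -GE; apply: lee_wpmul2r; first by rewrite lee_fin invr_ge0 ltW.
  apply: ge0_subset_integral => //.
  - by apply/measurable_EFinP; exact: measurable_funX.
  - by move=> s _; rewrite lee_fin sqr_ge0.
have [K1|K1] := ltP 0 K; last first.
  have K00 : K = 0 by apply/eqP; rewrite eq_le K1 K0.
  have := key 1 ltr01; rewrite K00 !mul0r; have := q0 I; lra.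
rewrite -ler_pdivrMl//; apply: le_sqrt_of_amgm => //; first by rewrite subr_ge0.
by move=> l /key; rewrite mulrCA ler_pdivrMl.
Qed.

(** The bound |F| <= 1 + |F|^2 turns local square-integrability into local integrability. *)
Lemma conv_exists F a t : L2loc F -> 0 <= a -> a <= t ->
  exists I, is_bochner leb `]a, t[ (fun s => S (t - s) (F s)) I.
Proof.
move=> hF a0 at_; apply: is_bochner_exists => //; first exact: lebesgue_oo_fin.
  by apply: conv_smeas => //; case: hF.
have [M M1 MP] := semigroup_bounded cX hS t.
have M0 : 0 <= M by rewrite (le_trans _ M1).
have T0 : 0 < t + 1 by rewrite ltr_wpDl// (le_trans a0).
have [mq iq] := L2loc_seminorm hF (norm_bounded_seminorm X) T0.
have sub : (`]a, t[ : set R) `<=` `]0, t + 1[.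
  move=> s /=; rewrite !in_itv/= => /andP[as_ st].
  by rewrite (le_lt_trans a0)//= (lt_trans st)// ltrDl.
have iq' : leb.-integrable `]a, t[ (fun s => (`|F s| ^+ 2)%:E) by exact: integrableS iq.
have i1 : leb.-integrable `]a, t[ (EFin \o cst 1).
  apply/integrableP; split; first by apply/measurable_EFinP; exact: measurable_cst.
  rewrite (eq_integral (cst 1%E)); last by move=> s _; rewrite /= normr1.
  by rewrite integral_cst// mul1e; exact: lebesgue_oo_fin.
have := integrableD (mI a t) i1 iq'.
move=> /(integrableZl (mI a t) M) /integrableP[_].
apply: le_lt_trans; apply: ge0_le_integral => //.
- apply/measurable_EFinP/strongly_measurable_seminorm => //; first exact: norm_bounded_seminorm.
  by apply: conv_smeas => //; case: hF.
- have mq' := measurable_funS (mI 0 (t + 1)) sub mq.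
  apply: measurableT_comp => //; apply/measurable_EFinP.
  by apply: measurable_funM => //; apply: measurable_funD => //; exact: measurable_funX.
- move=> s; rewrite /= in_itv/= => /andP[as_ st].
  rewrite -?EFinD -?EFinM ?abse_EFin lee_fin; apply: le_trans (ler_norm _).
  apply: (@le_trans _ _ (M * `|F s|)).
    by apply: MP; rewrite subr_ge0 ltW//= lerBlDr lerDl (le_trans a0)// ltW.
  rewrite ler_wpM2l//; set n := `|F s|.
  by have := sqr_ge0 (n - 1); rewrite sqrrB1 -mulr_natl; have := normr_ge0 (F s); rewrite -/n; nra.
Qed.

Lemma conv_function F : L2loc F -> exists v : R -> X,
  forall t, 0 <= t -> is_bochner leb `]0, t[ (fun s => S (t - s) (F s)) (v t).
Proof.
move=> hF; have /choice[v vP] t : exists I, 0 <= t ->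
    is_bochner leb `]0, t[ (fun s => S (t - s) (F s)) I.
  have [t0|t0] := leP 0 t; last by exists 0.
  by have [I bI] := conv_exists hF (lexx 0) t0; exists I.
by exists v.
Qed.

(** * Continuity and right differentiability of the convolution *)

Section fixed_forcing.
Variables (F : R -> X) (v : R -> X).
Hypothesis hF : L2loc F.
Hypothesis hv : forall t, 0 <= t -> is_bochner leb `]0, t[ (fun s => S (t - s) (F s)) (v t).

(** S (t - a) maps the integral up to a to the part of the integral up to t that precedes a, so the
    convolution restarts at a from v a. *)
Lemma conv_split a t : 0 <= a -> a <= t ->
  exists2 I, is_bochner leb `]a, t[ (fun s => S (t - s) (F s)) I & v t = S (t - a) (v a) + I.
Proof.
move=> a0 at_; have [I bI] := conv_exists hF a0 at_; exists I => //.
have ta : 0 <= t - a by rewrite subr_ge0.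
apply: (is_bochner_itvU a0 at_ _ bI (hv (le_trans a0 at_))).
have := is_bochner_map (mI 0 a) (lebesgue_oo_fin 0 a) (semigroup_linear hS ta)
  (semigroup_bounded_at hS ta) (hv a0).
apply: is_bochner_ext => s; rewrite /= in_itv/= => /andP[s0 sa].
have [_ _ SD _] := hS; rewrite -SD// ?subr_ge0 ?(ltW sa)//.
by rewrite addrA subrK.
Qed.

(** Both v s and v t are expressed from a common earlier time a. The orbit of v a is continuous, and
    the integrals from a are small with the length of their intervals. *)
Lemma conv_C0 : C0_ge0 v.
Proof.
apply: cont_on_C0_ge0 => b b0 t /andP[t0 tb] e e0.
have b1 : 0 < b + 1 by rewrite ltr_wpDr.
have [M M1 MP] := semigroup_bounded cX hS (b + 1).
have M0 : 0 < M by rewrite (lt_le_trans _ M1).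
set G := (\int[leb]_(s in `]0%R, (b + 1)%R[) (`|F s| ^+ 2))%R.
have G0 : 0 <= G by apply: Rintegral_ge0 => s _; rewrite sqr_ge0.
have bound a s I : 0 <= a -> a <= s -> s <= b ->
    is_bochner leb `]a, s[ (fun r => S (s - r) (F r)) I -> `|I| <= M * Num.sqrt ((s - a) * G).
  move=> a0 as_ sb bI.
  apply: (conv_bound (norm_bounded_seminorm X) (ltW M0) MP hF a0 as_ _ b1 bI).
  by rewrite (le_trans sb)// lerDl.
(* The intervals from a have length at most 2 eta, and 2 eta (G + 1) is the square of e / (4 M). *)
pose eta := (e / 4 / M) ^+ 2 / (2 * (G + 1)).
have G1 : 0 < G + 1 by rewrite ltr_wpDl.
have eM : 0 < e / 4 / M by rewrite !divr_gt0.
have eta0 : 0 < eta by rewrite divr_gt0// ?exprn_gt0// mulr_gt0.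
pose a := Num.max 0 (t - eta).
have a0 : 0 <= a by rewrite le_max lexx.
have at_ : a <= t by rewrite ge_max t0/= lerBlDr lerDl ltW.
have ta : t - a <= eta by rewrite lerBlDr -lerBlDl le_max lexx orbT.
have small s I : a <= s -> s <= b -> s - t <= eta ->
    is_bochner leb `]a, s[ (fun r => S (s - r) (F r)) I -> `|I| <= e / 4.
  move=> as_ sb st bI; apply: (le_trans (bound a s I a0 as_ sb bI)).
  rewrite mulrC -ler_pdivlMr// -[leRHS]ger0_norm ?(ltW eM)// -sqrtr_sqr.
  apply: ler_wsqrtr.
  apply: (@le_trans _ _ ((2 * eta) * (G + 1))).
    apply: ler_pM => //; rewrite ?subr_ge0// ?lerDl//.
    have -> : s - a = (s - t) + (t - a) by rewrite addrA subrK.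
    by rewrite mulr_natl mulr2n lerD.
  by rewrite /eta le_eqVlt; apply/orP; left; apply/eqP; field; rewrite !gt_eqF.
have e20 : 0 < e / 2 by rewrite divr_gt0.
have [|d2 d20 d2P] := semigroup_cont_on cX hS (v a) (b := b) (t := t - a) _ e20.
  by rewrite subr_ge0 at_ (le_trans _ tb)// lerBlDr lerDl.
have [I bI tE] := conv_split a0 at_.
(* at t = 0 the point a is t itself, otherwise a < t leaves room on the left *)
pose d1 := if t == 0 then 1 else t - a.
have d10 : 0 < d1.
  rewrite /d1; case: eqVneq => // tn0; rewrite subr_gt0 gt_max lt0r tn0 t0/=.
  by rewrite ltrBlDr ltrDl.
exists (Num.min (Num.min d1 d2) eta); first by rewrite !lt_min d10 d20.
move=> s /andP[s0 sb]; rewrite !lt_min => /andP[/andP[sd1 sd2] se].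
have as_ : a <= s.
  move: sd1; rewrite /d1; case: eqVneq => [t00 _|_ sd1].
    by rewrite (le_trans _ s0)// /a t00 sub0r ge_max lexx oppr_le0 ltW.
  move: sd1; rewrite ltr_norml => /andP[+ _].
  by rewrite opprB ltrBrDr subrK => /ltW.
have [J bJ sE] := conv_split a0 as_.
have hI := small _ _ at_ tb _ bI; have hJ := small _ _ as_ sb _ bJ.
have {}hI : `|I| <= e / 4 by apply: hI; rewrite subrr ltW.
have {}hJ : `|J| <= e / 4 by apply: hJ; rewrite (le_trans (ler_norm _))// ltW.
rewrite tE sE opprD addrACA.
have : `|S (s - a) (v a) - S (t - a) (v a)| < e / 2.
  apply: d2P; first by rewrite subr_ge0 as_ (le_trans _ sb)// lerBlDr lerDl.
  by rewrite opprB addrA subrK.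
have := ler_normD (S (s - a) (v a) - S (t - a) (v a)) (J - I).
have := ler_normB J I; lra.
Qed.

(** By [conv_split] at t this is the mean over ]t, t + h[ of an integrand that tends to F t. *)
Lemma conv_right_increment t : 0 <= t -> C0_ge0 F ->
  h^-1 *: (v (t + h) - S h (v t)) @[h --> 0^'+] --> F t.
Proof.
move=> t0 cF; apply/right_cvgP => e e0.
have [M M1 MP] := semigroup_bounded cX hS 1.
have M0 : 0 < M by rewrite (lt_le_trans _ M1).
have eM : 0 < e / 2 / 2 / M by rewrite !divr_gt0.
have e40 : 0 < e / 2 / 2 by rewrite !divr_gt0.
have /C0_ge0P/(_ t t0 _ eM)[d1 d10 d1P] := cF.
have [d2 d20 d2P] := semigroup_right_cont hS (F t) e40.
exists (Num.min (Num.min d1 d2) 1); first by rewrite !lt_min d10 d20 ltr01.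
move=> h h0; rewrite !lt_min => /andP[/andP[hd1 hd2] h1].
have th : t <= t + h by rewrite lerDl ltW.
have [I bI ->] := conv_split t0 th.
have hE : t + h - t = h by rewrite addrAC subrr add0r.
rewrite hE [S h _ + I]addrC addrK.
have : `|I - (t + h - t) *: F t| <= e / 2 * (t + h - t).
  apply: (is_bochner_close th bI) => s /andP[ts sth].
  have r0 : 0 <= t + h - s by rewrite subr_ge0 ltW.
  have rh : t + h - s <= h by rewrite lerBlDr [t + h]addrC lerD2l ltW.
  rewrite -(subrKA (S (t + h - s) (F t))) [e / 2]splitr (le_trans (ler_normD _ _))// lerD//.
    rewrite -(semigroupB hS)// (le_trans (MP _ _ _))//.
      by rewrite r0 (le_trans rh)// ltW.
    rewrite mulrC -ler_pdivlMr//; apply/ltW/d1P; first exact: le_trans (ltW ts).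
    by rewrite gtr0_norm ?subr_gt0// ltrBlDl (lt_trans sth)// ltrD2l.
  by apply/ltW/d2P => //; exact: le_lt_trans hd2.
rewrite hE => hI.
have -> : h^-1 *: I - F t = h^-1 *: (I - h *: F t).
  by rewrite scalerBr scalerA mulVf ?scale1r// gt_eqF.
rewrite normrZ gtr0_norm ?invr_gt0// mulrC ltr_pdivrMr//.
apply: (le_lt_trans hI); rewrite ltr_pM2r// ltr_pdivrMr// ltr_pMr// ltr1n.
by [].
Qed.

Variable A : X -> X -> Prop.
Hypothesis hA : generates A S.

(** The increment of v is S h (v t) - v t plus v (t + h) - S h (v t), and the quotient of the latter
    tends to F t. Right differentiability at t thus amounts to v t being in the domain. *)
Lemma conv_generator t k : 0 <= t -> C0_ge0 F -> right_deriv v t k <-> A (v t) (k - F t).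
Proof.
move=> t0 cF; have inc := conv_right_increment t0 cF; rewrite hA; split => h.
  apply: right_cvg_ext (cvgB h inc) => r _.
  by rewrite -scalerBr opprB addrC addrA subrK.
rewrite /right_deriv -[k](subrK (F t)); apply: right_cvg_ext (cvgD h inc) => r _.
by rewrite -scalerDr addrC addrA subrK.
Qed.

(** A continuous right derivative of the convolution suffices: [conv_generator] turns it into
    membership in the domain and [C1_right_deriv] into a derivative. *)
Lemma mild_classical V0 Y0 (k : R -> X) : C0_ge0 F -> A V0 Y0 -> C0_ge0 k ->
  (forall t, 0 <= t -> right_deriv v t (k t)) ->
  classical_solution A V0 F (fun t => S t V0 + v t).
Proof.
move=> cF AV ck dk.
have cV : C0_ge0 (fun t => S t V0 + v t).
  have := C0_ge0_comb (k := 1) (l := 1) (@semigroup_C0 _ _ _ cX hS V0) conv_C0.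
  by apply: C0_ge0_ext => t _; rewrite !scale1r.
have cV' : C0_ge0 (fun t => S t Y0 + k t).
  have := C0_ge0_comb (k := 1) (l := 1) (@semigroup_C0 _ _ _ cX hS Y0) ck.
  by apply: C0_ge0_ext => t _; rewrite !scale1r.
have dV t : 0 <= t -> right_deriv (fun t => S t V0 + v t) t (S t Y0 + k t).
  move=> t0; have := right_deriv_comb (a := 1) (b := 1) (generator_right_deriv hS hA AV t0) (dk t t0).
  by rewrite !scale1r; apply: right_deriv_ext => s _; rewrite !scale1r.
have CV := C1_right_deriv cV cV' dV.
have AVt t : 0 <= t -> A (S t V0 + v t) (S t Y0 + (k t - F t)).
  move=> t0; have := generator_comb hS hA 1 (generator_semigroup hS hA AV t0).
  by move=> /(_ _ _ ((conv_generator _ t0 cF).1 (dk t t0))); rewrite !scale1r.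
split.
- by exists (fun t => S t Y0 + k t).
- exists (fun t => S t Y0 + (k t - F t)) => // t t0.
  have cW : C0_ge0 (fun t => S t Y0 + (k t - F t)).
    have := C0_ge0_comb (k := 1) (l := -1) cV' cF.
    by apply: C0_ge0_ext => s _; rewrite scale1r scaleN1r addrA.
  rewrite -[X in _ --> X](addr0 (0 : R)).
  by apply: cvgD; apply/(@within_cvgP _ R^o) => e e0;
    [have /C0_ge0P/(_ t t0 e e0)[d d0 dP] := cV|have /C0_ge0P/(_ t t0 e e0)[d d0 dP] := cW];
    exists d => // s; rewrite /= in_itv/= andbT subr0 normr_id; exact: dP.
- have v0 : v 0 = 0 by apply: is_bochner_point; exact: hv.
  by have [_ -> _ _] := hS; rewrite v0 addr0.
- move=> t t0; exists (S t Y0 + (k t - F t)); first exact: AVt (ltW t0).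
  have /dwithin_cvgP h := CV t (ltW t0).
  rewrite -addrA subrK; apply/dnbhs_cvgP => e e0; have [d d0 dP] := h e e0.
  (* For |s - t| < t the point s stays in the half-line, so the limit within it is a two-sided
     one. *)
  exists (Num.min d t); first by rewrite lt_min d0.
  move=> s st; rewrite lt_min => /andP[sd]; rewrite ltr_norml => /andP[s0 _].
  apply: dP => //; rewrite /= in_itv/= andbT.
  by move: s0; rewrite ltrBrDr addNr => /ltW.
Qed.

End fixed_forcing.

End mild.

(** * Forcing of class C^1 or continuous into the domain *)

Section regular_forcing.
Context {R : realType} (X : normedModType R) (S : R -> X -> X).
Hypothesis cX : seq_complete X.
Hypothesis hS : C0_semigroup S.
Notation leb := (@lebesgue_measure R).

Lemma C0_L2loc (u : R -> X) : C0_ge0 u -> L2loc u.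
Proof.
move=> cu.
have sn (b : R) : strongly_measurable (`]0, b[ : set (measurableTypeR R)) u.
  exact: cont_on_smeas (C0_ge0_cont_on cu).
split.
  apply: (@strongly_measurable_cvg _ (measurableTypeR R) R X _
    (fun n t => if t \in (`]0, n%:R[%classic : set R) then u t else 0)).
  - exact: measurable_itv.
  - move=> n; apply: strongly_measurable_patch; first exact: measurable_itv.
      exact: strongly_measurable_sub (@subIsetr _ _ _) (sn _).
    exact: strongly_measurable_cst.
  - move=> t; rewrite /= in_itv/= andbT => t0; apply/cvgrPdist_lt => e e0.
    have /archi_boundP : 0 <= t by exact: ltW.
    set N := Num.bound _ => tN; exists N => // n /= Nn.
    rewrite mem_set ?subrr ?normr0//= in_itv/= t0 (lt_le_trans tN)//.
    by rewrite ler_nat.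
move=> T T0; have [M M0 MP] := cont_on_bounded (ltW T0) (C0_ge0_cont_on cu (b := T)).
apply: (@le_lt_trans _ _ ((M ^+ 2)%:E * leb `]0%R, T[)%E); last first.
  by rewrite lte_mul_pinfty ?lee_fin ?sqr_ge0//; exact: lebesgue_oo_fin.
have mT : measurable (`]0, T[ : set (measurableTypeR R)) by exact: measurable_itv.
rewrite -integral_cst//; apply: ge0_le_integral => //.
- apply/measurable_EFinP; apply: measurable_funX.
  exact: strongly_measurable_seminorm (norm_bounded_seminorm X) (sn T).
- move=> t; rewrite /= in_itv/= => /andP[t0 tT]; rewrite lee_fin.
  by rewrite lerXn2r ?nnegrE// MP// !ltW.
Qed.

(** As functions of the upper limit t both integrals vanish at 0 and have the right derivative u (t
    + h), so they coincide. *)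
Lemma is_bochner_shift (u : R -> X) h t I : C0_ge0 u -> 0 <= h -> 0 <= t ->
  is_bochner leb `]h, t + h[ u I -> is_bochner leb `]0, t[ (fun s => u (s + h)) I.
Proof.
move=> cu h0 t0 bI.
have [J [JP J0 cJ dJ]] := primitive_exists cX cu.
have shift (w : R -> X) : C0_ge0 w -> C0_ge0 (fun s => w (s + h)).
  move=> /C0_ge0P cw; apply/C0_ge0P => s s0 e e0.
  have [|d d0 dP] := cw (s + h) _ e e0; first by rewrite addr_ge0.
  exists d => // r r0 rs; apply: dP; first by rewrite addr_ge0.
  by rewrite opprD addrACA subrr addr0.
have [K [KP K0 cK dK]] := primitive_exists cX (shift _ cu).
have th : 0 <= t + h by rewrite addr_ge0.
have hth : h <= t + h by rewrite lerDr.
have IE := is_bochner_itvU h0 hth (JP h h0) bI (JP _ th).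
suff -> : I = K t by exact: KP.
have cw : cont_on 0 t (fun b => 1 *: K b + (-1) *: J (b + h)).
  by apply: C0_ge0_cont_on; apply: C0_ge0_comb => //; exact: shift.
have := right_deriv0_cst t0 cw.
rewrite K0 scaler0 !add0r !scale1r !scaleN1r IE => E.
have {}E : K t - (J h + I) = - J h.
  apply: E => s /andP[s0 st].
  have -> : 0 = 1 *: u (s + h) + (-1) *: u (s + h) by rewrite scale1r scaleN1r subrr.
  apply: right_deriv_comb; first exact: dK.
  have sh : 0 <= s + h by rewrite addr_ge0.
  apply: right_cvg_ext (dJ (s + h) sh) => k _.
  by rewrite [s + h + k]addrAC.
by move/eqP: E; rewrite subr_eq addKr => /eqP.
Qed.

(** Freezing u beyond b makes it continuous on the half-line. This is for integrands S (b - s) (F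
    s), whose time is negative for s > b. *)
Lemma cont_on_minr (u : R -> X) b : 0 <= b -> cont_on 0 b u -> C0_ge0 (fun s => u (Num.min s b)).
Proof.
move=> b0 cu; apply/C0_ge0P => t t0 e e0.
have [|d d0 dP] := cu (Num.min t b) _ e e0; first by rewrite le_min t0 b0 ge_min lexx orbT.
exists d => // s s0 st; apply: dP; first by rewrite le_min s0 b0 ge_min lexx orbT.
apply: le_lt_trans st; rewrite /Num.min; case: ltP => sb; case: ltP => tb //.
- rewrite !ler0_norm ?subr_le0 ?(ltW sb) ?(le_trans (ltW sb))//.
  by rewrite lerN2 lerD2l lerN2.
- rewrite !ger0_norm ?subr_ge0 ?(ltW tb) ?(le_trans (ltW tb))//.
  by rewrite lerD2r.
- by rewrite subrr normr0.
Qed.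

Variable A : X -> X -> Prop.
Hypothesis hA : generates A S.
Variables (F v : R -> X).
Hypothesis hF : L2loc F.
Hypothesis hv : forall t, 0 <= t -> is_bochner leb `]0, t[ (fun s => S (t - s) (F s)) (v t).

Lemma conv_unique t I : 0 <= t ->
  is_bochner leb `]0, t[ (fun s => S (t - s) (F s)) I -> I = v t.
Proof.
move=> t0 bI; apply: is_bochner_unique bI (hv t0).
  exact: measurable_itv.
exact: lebesgue_oo_fin.
Qed.

(* The difference quotients of S along the integrand converge to their generator
   values uniformly on [0,t], so the generator commutes with the integral. *)
Lemma right_deriv_domain_forcing : C0_ge0_domain A F -> exists k : R -> X,
  [/\ C0_ge0 F, C0_ge0 k & forall t, 0 <= t -> right_deriv v t (k t)].
Proof.
move=> [W AF cFW].
have cF : C0_ge0 F.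
  apply/C0_ge0P => t t0 e e0; have /(@within_cvgP _ R^o)/(_ e e0)[d d0 dP] := cFW t t0.
  exists d => // s s0 /(dP s); rewrite /= in_itv/= s0 subr0 => /(_ isT).
  rewrite ger0_norm ?addr_ge0// => h; apply: le_lt_trans h; by rewrite lerDl.
have cW : C0_ge0 W.
  apply/C0_ge0P => t t0 e e0; have /(@within_cvgP _ R^o)/(_ e e0)[d d0 dP] := cFW t t0.
  exists d => // s s0 /(dP s); rewrite /= in_itv/= s0 subr0 => /(_ isT).
  rewrite ger0_norm ?addr_ge0// => h; apply: le_lt_trans h; by rewrite lerDr.
have [w wP] := conv_function cX hS (C0_L2loc cW).
have cw := conv_C0 cX hS (C0_L2loc cW) wP.
(* The expected derivative: the generator taken under the integral, plus F t. *)
exists (fun t => w t + F t); split => //.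
  have := C0_ge0_comb (k := 1) (l := 1) cw cF.
  by apply: C0_ge0_ext => t _; rewrite !scale1r.
move=> t t0; apply/(conv_generator cX hS hF hv hA _ t0 cF); rewrite addrK; apply/hA.
(* An error e' in the integrand over ]0, t[ amounts to e' t, which is less than e. *)
apply/right_cvgP => e e0; pose e' := e / (2 * (t + 1)).
have t1 : 0 < t + 1 by rewrite ltr_wpDl.
have e'0 : 0 < e' by rewrite divr_gt0// mulr_gt0.
have cu := semigroup_conv_cont cX hS (lexx 0) (C0_ge0_cont_on cW (b := t)).
have [s sab|del d0 dP] := @segment_uniform R 0 t
    (fun s h => `|S h (S (t - s) (W s)) - S (t - s) (W s)| <= e').
  have [M M1 MP] := semigroup_bounded cX hS 1.
  have M0 : 0 < M by rewrite (lt_le_trans _ M1).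
  have e3 : 0 < e' / 3 / M by rewrite divr_gt0// divr_gt0.
  have e4 : 0 < e' / 3 by rewrite divr_gt0.
  have [d1 d10 d1P] := cu s sab _ e3.
  have [d2 d20 d2P] := semigroup_right_cont hS (S (t - s) (W s)) e4.
  exists (Num.min (Num.min d1 d2) 1); first by rewrite !lt_min d10 d20 ltr01.
  move=> r h rab; rewrite !lt_min => /andP[/andP[r1 _] _] h0 /andP[/andP[_ h2] h1].
  have := d1P r rab r1; have := d2P h (ltW h0) h2.
  set x := S (t - s) _; set y := S (t - r) _ => a1 a2.
  have a3 : `|S h y - S h x| <= e' / 3.
    rewrite -(semigroupB hS _ _ (ltW h0)); apply: (le_trans (MP _ _ _)).
      by rewrite !ltW.
    by rewrite mulrC -ler_pdivlMr// ltW.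
  have a4 : `|y - x| <= e' / 3.
    by apply/ltW/(lt_le_trans a2); rewrite ler_pdivrMr// ler_peMr// ltW.
  change (`|S h y - y| <= e').
  have -> : S h y - y = (S h y - S h x) + (S h x - x) - (y - x).
    by rewrite addrA subrK opprB addrA subrK.
  have := ler_normB (S h y - S h x + (S h x - x)) (y - x).
  have := ler_normD (S h y - S h x) (S h x - x); lra.
exists del => // h h0 hd.
have h0' := ltW h0.
have mI : measurable (`]0, t[ : set (measurableTypeR R)) by exact: measurable_itv.
have fI := lebesgue_oo_fin 0 t.
have b1 := is_bochner_map mI fI (semigroup_linear hS h0')
  (semigroup_bounded_at hS h0') (hv t0).
have b2 := is_bochner_comb mI fI (-1) (hv t0) b1.
(* [is_bochner_comb] rescales only its first integral, hence the zero integral as the second. *)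
have b3 := is_bochner_comb mI fI h^-1 b2 (is_bochner0 mI fI X).
have b4 := is_bochner_comb mI fI (-1) (wP t t0) b3.
have : `|-1 *: w t + (h^-1 *: (-1 *: v t + S h (v t)) + 0)| <= e' * (t - 0).
  apply: (is_bochner_bound t0 b4) => s /andP[s0 st].
  have ts : 0 <= t - s by rewrite subr_ge0 ltW.
  rewrite addr0 !scaleN1r addrC [- _ + S h _]addrC.
  have AS := generator_semigroup hS hA (AF s (ltW s0)) ts.
  have := generator_quotient cX hS hA AS h0' (e := e').
  have sst : 0 <= s <= t by rewrite !ltW.
  move=> h1; have {}h1 := h1 _.
  have -> : h^-1 *: (S h (S (t - s) (F s)) - S (t - s) (F s)) - S (t - s) (W s) =
     h^-1 *: (S h (S (t - s) (F s)) - S (t - s) (F s) - h *: S (t - s) (W s)).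
    by rewrite [RHS]scalerBr scalerA mulVf ?scale1r// gt_eqF.
  rewrite normrZ gtr0_norm ?invr_gt0// mulrC ler_pdivrMr//; apply: h1 => r /andP[].
  rewrite le_eqVlt => /orP[/eqP <- _|r0 rh].
    by have [_ -> _ _] := hS; rewrite subrr normr0 ltW.
  exact: dP (le_lt_trans rh hd).
rewrite addr0 !scaleN1r addrC [- _ + S h _]addrC subr0 => /le_lt_trans; apply.
rewrite /e' mulrAC ltr_pdivrMr ?mulr_gt0// ltr_pM2l//; lra.
Qed.

(** Substituting s + h for s, v (t + h) is S t (v h) plus the integral over ]0, t[ of S (t - s) (F
    (s + h)). The quotient of v thus splits into S t applied to the quotient of v at 0, which tends
    to S t (F 0), and the convolution of the quotient of F, which tends to that of F'. *)
Lemma right_deriv_C1_forcing : C1_ge0 F -> exists k : R -> X,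
  [/\ C0_ge0 F, C0_ge0 k & forall t, 0 <= t -> right_deriv v t (k t)].
Proof.
move=> [F' cF' dF'].
have dF t : 0 <= t -> right_deriv F t (F' t).
  move=> t0; apply/right_cvgP => e e0.
  have /dwithin_cvgP/(_ e e0)[d d0 dP] := dF' t t0.
  exists d => // h h0 hd; have := dP (t + h).
  rewrite /= in_itv/= andbT addr_ge0 ?(ltW h0)// -subr_eq0 addrAC subrr add0r gt_eqF//.
  by rewrite gtr0_norm// => /(_ isT isT hd).
have cF : C0_ge0 F.
  apply/C0_ge0P => t t0 e e0.
  have /dwithin_cvgP/(_ 1 ltr01)[d d0 dP] := dF' t t0.
  pose L := `|F' t| + 1; have L0 : 0 < L by rewrite ltr_wpDl.
  exists (Num.min d (e / L)); first by rewrite lt_min d0 divr_gt0.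
  move=> s s0; rewrite lt_min => /andP[sd se].
  have [->|st] := eqVneq s t; first by rewrite subrr normr0.
  have := dP s _ st sd; rewrite /= in_itv/= andbT => /(_ s0) h.
  have st0 : s - t != 0 by rewrite subr_eq0.
  have -> : F s - F t = (s - t) *: ((s - t)^-1 *: (F s - F t)).
    by rewrite scalerA mulfV// scale1r.
  rewrite normrZ; apply: (@le_lt_trans _ _ (`|s - t| * L)); last by rewrite -ltr_pdivlMr.
  rewrite ler_wpM2l// /L -lerBlDl; apply: le_trans (ltW h).
  exact: lerB_dist.
have [w wP] := conv_function cX hS (C0_L2loc cF').
have cw := conv_C0 cX hS (C0_L2loc cF') wP.
exists (fun t => S t (F 0) + w t); split => //.
  have := C0_ge0_comb (k := 1) (l := 1) (@semigroup_C0 _ _ _ cX hS (F 0)) cw.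
  by apply: C0_ge0_ext => t _; rewrite !scale1r.
move=> t t0; have [_ S0 SD _] := hS.
have v0 : v 0 = 0 by apply: is_bochner_point; exact: hv.
have first : h^-1 *: S t (v h) @[h --> 0^'+] --> S t (F 0).
  have [/(_ t t0)[_ cS] _ _ _] := hS.
  have inc := conv_right_increment cX hS hF hv (lexx 0) cF.
  apply: right_cvg_ext (cvg_comp _ _ inc (cS _)) => h /ltW h0.
  by rewrite /= v0 (semigroup0 hS h0) subr0 add0r (semigroupZ hS).
have second : h^-1 *: (v (t + h) - S t (v h) - v t) @[h --> 0^'+] --> w t.
  apply/right_cvgP => e e0.
  have [M M1 MP] := semigroup_bounded cX hS t.
  have M0 : 0 < M by rewrite (lt_le_trans _ M1).
  have t1 : 0 < t + 1 by rewrite ltr_wpDl.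
  pose e' := e / (2 * (t + 1)) / M.
  have e'0 : 0 < e' by rewrite divr_gt0// divr_gt0// mulr_gt0.
  have [s sab|del d0 dP] := @segment_uniform R 0 t
    (fun s h => forall r, 0 <= r < h -> `|F' (s + r) - F' s| <= e').
    have e'20 : 0 < e' / 2 by rewrite divr_gt0.
    have /andP[s0 st] := sab.
    have /C0_ge0P/(_ s s0 _ e'20)[d d0 dP] := cF'.
    exists (d / 2); first by rewrite divr_gt0.
    move=> s' h /andP[s'0 s't] s's h0 hd r /andP[r0 rh].
    rewrite -(subrKA (F' s)) (le_trans (ler_normD _ _))// [e']splitr lerD//.
      apply/ltW/dP; first by rewrite addr_ge0.
      have := ler_normD (s' - s) r; rewrite [_ + r - _]addrAC (ger0_norm r0).
      move: s's hd rh; lra.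
    rewrite distrC; apply/ltW/dP => //; apply: lt_trans s's _.
    by rewrite ltr_pdivrMr// ltr_pMr// ltr1n.
  exists del => // h h0 hd; have h0' := ltW h0.
  have mI : measurable (`]0, t[ : set (measurableTypeR R)) by exact: measurable_itv.
  have fI := lebesgue_oo_fin 0 t.
  have th0 : 0 <= t + h by rewrite addr_ge0.
  have hth : h <= t + h by rewrite lerDr.
  have [I bI vE] := conv_split cX hS hF hv h0' hth.
  rewrite addrK in vE.
  have cu : cont_on 0 (t + h) (fun s => S (t + h - s) (F s)).
    exact: (semigroup_conv_cont cX hS (lexx 0) (C0_ge0_cont_on cF)).
  (* The integrand is frozen at t + h, beyond which the time t + h - s is negative. *)
  have bI' : is_bochner leb `]0, t[ (fun s => S (t - s) (F (s + h))) I.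
    have : is_bochner leb `]0, t[ (fun s => S (t + h - Num.min (s + h) (t + h)) (F (Num.min (s + h) (t + h)))) I.
      apply: (is_bochner_shift (cont_on_minr th0 cu)) => //.
      apply: is_bochner_ext bI => s; rewrite /= in_itv/= => /andP[_ /ltW sth].
      by rewrite min_l.
    apply: is_bochner_ext => s; rewrite /= in_itv/= => /andP[_ /ltW st].
    by rewrite min_l ?lerD2r// opprD addrACA subrr addr0.
  have b2 := is_bochner_comb mI fI (-1) (hv t0) bI'.
  have b3 := is_bochner_comb mI fI h^-1 b2 (is_bochner0 mI fI X).
  have b4 := is_bochner_comb mI fI (-1) (wP t t0) b3.
  have : `|-1 *: w t + (h^-1 *: (-1 *: v t + I) + 0)| <= M * e' * (t - 0).
    apply: (is_bochner_bound t0 b4) => s /andP[s0 st].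
    have ts : 0 <= t - s by rewrite subr_ge0 ltW.
    rewrite addr0 !scaleN1r addrC [- _ + S _ _]addrC.
    have -> : h^-1 *: (S (t - s) (F (s + h)) - S (t - s) (F s)) - S (t - s) (F' s) =
        S (t - s) (h^-1 *: (F (s + h) - F s - h *: F' s)).
      rewrite [h^-1 *: (F _ - _ - _)]scalerBr scalerA mulVf ?gt_eqF// scale1r.
      by rewrite [RHS](semigroupB hS)// (semigroupZ hS)// (semigroupB hS).
    apply: (le_trans (MP _ _ _)); first by rewrite ts lerBlDr lerDl ltW.
    rewrite ler_pM2l// normrZ gtr0_norm ?invr_gt0// mulrC ler_pdivrMr//.
    have ssh : s <= s + h by rewrite lerDl.
    have := @right_deriv_close _ _ F F' (F' s) s (s + h) e' ssh.
    rewrite [s + h - s]addrAC subrr add0r; apply.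
    - by apply: (@cont_onS _ _ 0 (s + h)) (C0_ge0_cont_on cF); [exact: ltW|].
    - by move=> r /andP[sr _]; apply: dF; exact: le_trans (ltW s0) sr.
    - move=> r /andP[sr rsh].
      have sst : 0 <= s <= t by rewrite !ltW.
      have := dP s h sst h0 hd (r - s).
      by rewrite [s + _]addrC subrK; apply; rewrite subr_ge0 sr ltrBlDl.
  rewrite addr0 !scaleN1r addrC subr0 vE [S t (v h) + I]addrC addrK [- v t + I]addrC.
  move=> /le_lt_trans; apply.
  rewrite /e' mulrCA mulfV ?mulr1 ?gt_eqF// mulrAC ltr_pdivrMr ?mulr_gt0// ltr_pM2l//; lra.
apply: right_cvg_ext (cvgD first second) => h _.
by rewrite -scalerDr addrA [S t (v h) + _]addrC subrK.
Qed.

Lemma regular_forcing_classical V0 : op_domain A V0 ->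
  C1_ge0 F \/ C0_ge0_domain A F -> classical_solution A V0 F (fun t => S t V0 + v t).
Proof.
move=> [Y0 AV] [/right_deriv_C1_forcing|/right_deriv_domain_forcing] [k [cF ck dk]];
exact: (mild_classical cX hS hF hv hA cF AV ck dk).
Qed.

End regular_forcing.

(** * Well-posedness of the abstract Cauchy problem *)

Section abstract_wellposedness.
Context {R : realType} (X : normedModType R) (S : R -> X -> X) (A : X -> X -> Prop).
Hypotheses (cX : seq_complete X) (hS : C0_semigroup S) (hA : generates A S).
Variables (B : X -> X -> R) (C omega : R).
Hypotheses (hB : bounded_form B C)
  (Bdiss : forall x y z, A x y -> A y z -> B x y <= omega * B x x) (omega0 : 0 <= omega).

Theorem abstract_cauchy_wellposed (V0 : X) (F : R -> X) : L2loc F ->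
    exists V : R -> X,
      [/\ mild_solution S V0 F V,
          forall W, mild_solution S V0 F W -> forall t, 0 <= t -> W t = V t,
          forall T t, 0 < T -> 0 <= t <= T ->
            form_norm B (V t) <=
              expR ((omega + 1) * T) * form_norm B V0 +
              expR ((omega + 1) * T) *
                Num.sqrt (\int[lebesgue_measure]_(s in `]0, T[)
                            form_norm B (F s) ^+ 2) &
          op_domain A V0 -> C1_ge0 F \/ C0_ge0_domain A F ->
          classical_solution A V0 F V].
Proof.
move=> hF; have [v vP] := conv_function cX hS hF.
exists (fun t => S t V0 + v t); split.
- split; last by move=> t t0; exists (v t) => //; exact: vP.
  have := C0_ge0_comb (k := 1) (l := 1) (@semigroup_C0 _ _ _ cX hS V0) (conv_C0 cX hS hF vP).
  by apply: C0_ge0_ext => t _; rewrite !scale1r.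
(* The variation of constants formula determines W t, by uniqueness of Bochner integrals. *)
- by move=> W [_ WP] t t0; have [I bI ->] := WP t t0; rewrite (conv_unique vP t0 bI).
- move=> T t T0 /andP[t0 tT].
  have hp := form_norm_seminorm hB.
  have [pD _ _] := hp; have p0 := bseminorm_ge0 hp.
  have T0' := ltW T0.
  have dec r x : 0 <= r <= T -> form_norm B (S r x) <= expR (omega * T) * form_norm B x.
    move=> /andP[r0 rT]; apply: (le_trans (semigroup_energy cX hS hA hB Bdiss x r0)).
    by rewrite ler_wpM2r// ler_expR ler_wpM2l.
  have eT : expR (omega * T) <= expR ((omega + 1) * T).
    by rewrite ler_expR ler_wpM2r// lerDl.
  apply: (le_trans (pD _ _)); apply: lerD.
    by apply: (le_trans (dec _ _ _)); rewrite ?t0// ler_wpM2r.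
  apply: (le_trans (conv_bound hp (expR_ge0 _) dec hF (lexx 0) t0 tT T0 (vP t t0))).
  set G := (\int[_]_(s in _) _)%R.
  have G0 : 0 <= G by apply: Rintegral_ge0 => s _; rewrite sqr_ge0.
  rewrite subr0 sqrtrM// mulrA; apply: ler_wpM2r; first exact: sqrtr_ge0.
  rewrite mulrDl mul1r expRD ler_wpM2l ?expR_ge0//.
  apply: (@le_trans _ _ (1 + T)); last exact: expR_ge1Dx.
  have T1 : 0 <= 1 + T by rewrite addr_ge0.
  rewrite -[leRHS]ger0_norm// -sqrtr_sqr ler_wsqrtr//.
  by rewrite expr2; nra.
- by move=> *; exact: regular_forcing_classical.
Qed.

End abstract_wellposedness.

(** * Completeness of L2 *)

Section completeness.
Context {R : realType}.

Lemma seq_complete_rV n : seq_complete ('rV[R]_n.+1 : normedModType R).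
Proof.
move=> u cu; have : cauchy (u @ \oo).
  apply/cauchy_ballP => e e0; have [N NP] := cu e e0.
  near_simpl; exists ([set m | (N <= m)%N], [set m | (N <= m)%N]) => /=.
    by split; exists N.
  by move=> [i j] [/= Ni Nj]; rewrite -ball_normE /=; exact: NP.
by move=> /cauchy_cvg/cvg_ex.
Qed.

Lemma seq_complete_real : seq_complete (R^o : normedModType R).
Proof.
move=> u cu; have : cauchy (u @ \oo).
  apply/cauchy_ballP => e e0; have [N NP] := cu e e0.
  near_simpl; exists ([set m | (N <= m)%N], [set m | (N <= m)%N]) => /=.
    by split; exists N.
  by move=> [i j] [/= Ni Nj]; rewrite -ball_normE /=; exact: NP.
by move=> /cauchy_cvg/cvg_ex.
Qed.

Lemma seq_cauchy_fst (X Y : normedModType R) (u : nat -> (X * Y)%type) :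
  seq_cauchy u -> seq_cauchy (fun n => (u n).1).
Proof.
move=> cu e /cu[N NP]; exists N => m n Nm Nn; apply: le_lt_trans (NP m n Nm Nn).
by rewrite [leRHS]prod_normE le_max lexx.
Qed.

Lemma seq_cauchy_snd (X Y : normedModType R) (u : nat -> (X * Y)%type) :
  seq_cauchy u -> seq_cauchy (fun n => (u n).2).
Proof.
move=> cu e /cu[N NP]; exists N => m n Nm Nn; apply: le_lt_trans (NP m n Nm Nn).
by rewrite [leRHS]prod_normE le_max lexx orbT.
Qed.

Lemma cvg_prod_pair (X Y : normedModType R) (u : nat -> (X * Y)%type) (x : X) (y : Y) :
  (u n).1 @[n --> \oo] --> x -> (u n).2 @[n --> \oo] --> y -> u n @[n --> \oo] --> (x, y).
Proof.
move=> ux uy; have -> : u = (fun n => ((u n).1, (u n).2)).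
  by apply/funext => n; case: (u n).
exact: cvg_pair ux uy.
Qed.

Lemma seq_complete_prod (X Y : normedModType R) :
  seq_complete X -> seq_complete Y -> seq_complete ((X * Y)%type : normedModType R).
Proof.
move=> cX cY u cu.
have [x ux] := cX _ (seq_cauchy_fst cu).
have [y uy] := cY _ (seq_cauchy_snd cu).
by exists (x, y); exact: cvg_prod_pair.
Qed.

End completeness.

(** * Riesz-Fischer theorem for functions with values in a complete space *)

Section L2_theory.
Context {disp : measure_display} {T : measurableType disp} {R : realType}.
Variables (mu : {measure set T -> \bar R}) (X : normedModType R).
Implicit Types (u v : L2 mu X) (f g : T -> X).

Lemma L2_normE u : `|u| = L2_seminorm mu (L2repr u).
Proof. by []. Qed.

Lemma class_of_repr u : class_of u (L2repr u).
Proof. by exists (repr u) => //; rewrite reprK. Qed.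

Lemma class_of_sq_integrable u f : class_of u f -> sq_integrable mu f.
Proof. by move=> [h <- _]; exact: L2funP. Qed.

Lemma class_of_exists f : sq_integrable mu f -> exists u, class_of u f.
Proof.
move=> hf; have hf' : f \in @L2_pred _ _ _ mu X by rewrite inE.
by exists (\pi_(L2 mu X) (MkL2fun hf'))%qT; exists (MkL2fun hf').
Qed.

Lemma class_of_ae u f g : class_of u f -> class_of u g -> {ae mu, forall x, f x = g x}.
Proof.
move=> [h <- hu] [k <- ku]; apply/L2_eqP.
by move/eqP : (etrans hu (esym ku)); rewrite eqmodE.
Qed.

Lemma ae_class_of u f g : class_of u f -> sq_integrable mu g ->
  {ae mu, forall x, f x = g x} -> class_of u g.
Proof.
move=> [h <- hu] hg fg; have hg' : g \in @L2_pred _ _ _ mu X by rewrite inE.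
exists (MkL2fun hg') => //; rewrite -hu; apply/esym/eqP; rewrite eqmodE.
exact/L2_eqP.
Qed.

Lemma L2_norm_sqr u f : class_of u f ->
  ((`|u| ^+ 2)%:E = \int[mu]_x ((`|f x| ^+ 2)%:E))%E.
Proof.
move=> uf; have [[mr ir] [mf _]] := (class_of_sq_integrable (class_of_repr u), class_of_sq_integrable uf).
have mn g : strongly_measurable setT g -> measurable_fun setT (fun x => (`|g x| ^+ 2)%:E).
  by move=> mg; apply/measurable_EFinP; apply: measurable_funX; exact: strongly_measurable_norm.
rewrite L2_normE /L2_seminorm sqr_sqrtr; last by apply: Rintegral_ge0 => x _; rewrite sqr_ge0.
rewrite /Rintegral fineK; last by rewrite ge0_fin_numE// integral_ge0// => x _; rewrite lee_fin sqr_ge0.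
apply: ae_eq_integral => //; [exact: mn|exact: mn|].
apply: filterS (class_of_ae (class_of_repr u) uf) => x fx _.
by rewrite fx.
Qed.

Lemma class_ofB u v f g : class_of u f -> class_of v g -> class_of (u - v) (fun x => f x - g x).
Proof.
move=> uf vg; have := class_of_comb (-1) vg uf.
rewrite scaleN1r addrC; rewrite (_ : -1 *: g + f = (fun x => f x - g x))//.
by apply/funext => x; rewrite -[LHS]/(-1 *: g x + f x) scaleN1r addrC.
Qed.

Let mnorm2 f : strongly_measurable setT f -> measurable_fun setT (fun x => `|f x| ^+ 2).
Proof. by move=> mf; apply: measurable_funX; exact: strongly_measurable_norm. Qed.

Hypothesis cX : seq_complete X.

(** Along a fast subsequence the increments satisfy |d_k|^2 <= H 4^-k with H integrable, so the
    representatives converge off the null set where H is infinite. Setting them to 0 on this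
    measurable set gives convergence at every point, which [L2_pairing_cvg] needs for the
    measurability of a limit. *)
Lemma L2_riesz_fischer (u : nat -> L2 mu X) (f : nat -> T -> X) :
  seq_cauchy u ->
  (forall n, class_of (u n) (f n)) ->
  exists (phi : nat -> nat) (l : L2 mu X) (g : T -> X) (N : set T),
    [/\ measurable N, class_of l g, u n @[n --> \oo] --> l &
     forall x, (if x \in N then 0 else f (phi n) x) @[n --> \oo] --> g x].
Proof.
move=> cu uf.
have exp4 k : 4^-1 ^+ k = (2^-1 ^+ k) ^+ 2 :> R.
  by rewrite -exprM mulnC exprM; congr (_ ^+ k); rewrite expr2 -invfM -natrM.
have q0 k : 0 < 4^-1 ^+ k :> R by rewrite exprn_gt0// invr_gt0.
have /choice[psi psiP] k := cu _ (q0 k).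
(* The maximum makes the subsequence of indices nondecreasing. *)
pose phi k := \max_(i < k.+1) psi i.
have phiP k m n : (phi k <= m)%N -> (phi k <= n)%N -> `|u m - u n| < 4^-1 ^+ k.
  have pk : (psi k <= phi k)%N by exact: (@leq_bigmax _ (fun i : 'I_k.+1 => psi i) ord_max).
  by move=> km kn; apply: psiP; exact: leq_trans pk _.
have phiS k : (phi k <= phi k.+1)%N.
  by rewrite {2}/phi big_ord_recr /= leq_maxl.
have mf n : strongly_measurable setT (f n) by have [] := class_of_sq_integrable (uf n).
pose d k x := f (phi k.+1) x - f (phi k) x.
have md k : strongly_measurable setT (d k).
  have := strongly_measurable_comb2 1 (-1) (mf (phi k.+1)) (mf (phi k)).
  by apply: strongly_measurable_ext => x _; rewrite scale1r scaleN1r.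
(* The weight 4^k leaves a pointwise decay of order 4^-k, while the integrals of the terms, at most
   4^k (4^-k)^2, remain summable. *)
pose a k x : \bar R := (4 ^+ k * `|d k x| ^+ 2)%:E.
have a0 k x : (0 <= a k x)%E by rewrite lee_fin mulr_ge0 ?exprn_ge0 ?sqr_ge0.
have ma k : measurable_fun setT (a k).
  by apply/measurable_EFinP; apply: measurable_funM => //; exact: mnorm2.
pose H x : \bar R := (\sum_(k <oo) a k x)%E.
have mH : measurable_fun setT H.
  exact: (@ge0_emeasurable_sum _ _ _ _ a xpredT).
have iH : (\int[mu]_x H x <= 2%:E)%E.
  rewrite integral_nneseries//.
  apply: lime_le; first by apply: is_cvg_nneseries => n _ _; exact: integral_ge0.
  apply: nearW => n.
  (* A telescoping majorant of the partial sums: its increment (3/2) 4^-n exceeds the n-th term. *)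
  apply: (@le_trans _ _ (2 - 2 * 4^-1 ^+ n)%:E); last by rewrite lee_fin gerBl mulr_ge0// ltW.
  elim: n => [|n IH].
    by rewrite big_geq// expr0 lee_fin; lra.
  rewrite big_nat_recr//=; apply: (le_trans (leeD IH (lexx _))).
  have -> : (\int[mu]_x a n x = (4 ^+ n * `|u (phi n.+1) - u (phi n)| ^+ 2)%:E)%E.
    rewrite EFinM (L2_norm_sqr (class_ofB (uf _) (uf _))) -ge0_integralZl//.
    by apply/measurable_EFinP; exact: (mnorm2 (md n)).
  rewrite -EFinD lee_fin.
  have := phiP n _ _ (phiS n) (leqnn _).
  set z := `|_ - _| => zn.
  have z0 : 0 <= z by exact: normr_ge0.
  have : 4 ^+ n * z ^+ 2 <= 4^-1 ^+ n.
    apply: (@le_trans _ _ (4 ^+ n * (4^-1 ^+ n * 4^-1 ^+ n))).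
      by rewrite ler_pM2l ?exprn_gt0// expr2 ler_pM// ltW.
    by rewrite mulrA exprVn mulfV ?mul1r// expf_neq0.
  have := q0 n; rewrite [_ ^+ n.+1]exprS; move: (4^-1 ^+ n) (4 ^+ n * _) => y w; lra.
pose N := [set x | H x = +oo%E].
have mN : measurable N.
  by have := mH measurableT _ (emeasurable_set1 +oo%E); rewrite setTI.
have H0 x : (0 <= H x)%E by apply: nneseries_ge0 => k _ _; exact: a0.
have iHlt : (\int[mu]_x H x < +oo)%E by apply: le_lt_trans iH (ltry _).
have muN : mu N = 0.
  have : mu.-integrable setT H.
    apply/integrableP; split => //.
    by under eq_integral do rewrite gee0_abs//.
  move=> /(integrable_ae measurableT)[M [mM M0 NM]].
  apply: (subset_measure0 mN mM _ M0) => x /= Hx; apply: NM => /=.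
  by move=> /(_ I); rewrite Hx.
have Hd x k : ~ N x -> `|d k x| ^+ 2 <= fine (H x) * 4^-1 ^+ k.
  move=> Nx; have Hfin : H x \is a fin_num.
    by rewrite ge0_fin_numE// ltNge leye_eq; apply/eqP.
  have : (a k x <= H x)%E.
    have := @nneseries_lim_ge R (fun k => a k x) xpredT 0 k.+1.
    move=> /(_ (fun k _ _ => a0 k x)); apply: le_trans.
    by rewrite big_nat_recr//= leeDr//; apply: sume_ge0.
  rewrite -[H x]fineK// lee_fin => h.
  by rewrite exprVn ler_pdivlMr ?exprn_gt0// mulrC.
have Hd' x k : ~ N x -> `|d k x| <= Num.sqrt (fine (H x)) * 2^-1 ^+ k.
  move=> Nx; have h0 : 0 <= fine (H x) by rewrite fine_ge0.
  rewrite -[leLHS]ger0_norm// -sqrtr_sqr; apply: (le_trans (ler_wsqrtr (Hd x k Nx))).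
  rewrite sqrtrM// ler_wpM2l ?sqrtr_ge0//.
  by rewrite exp4 sqrtr_sqr ger0_norm ?exprn_ge0.
pose F k x := if x \in N then 0 else f (phi k) x.
have dist x k m : ~ N x -> (k <= m)%N ->
    `|F m x - F k x| <= Num.sqrt (fine (H x)) * (2 * 2^-1 ^+ k - 2 * 2^-1 ^+ m).
  move=> Nx; have FE j : F j x = f (phi j) x by rewrite /F memNset.
  elim: m => [|m IH].
    by rewrite leqn0 => /eqP ->; rewrite !subrr normr0 mulr0.
  rewrite leq_eqVlt => /orP[/eqP ->|]; first by rewrite !subrr normr0 mulr0.
  rewrite ltnS => /IH {}IH.
  rewrite -(subrKA (F m x)) addrC (le_trans (ler_normD _ _))//.
  have := Hd' x m Nx; rewrite /d -!FE.
  set s := Num.sqrt _ in IH *.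
  have -> : s * (2 * 2^-1 ^+ k - 2 * 2^-1 ^+ m.+1) =
     s * (2 * 2^-1 ^+ k - 2 * 2^-1 ^+ m) + s * 2^-1 ^+ m.
    by rewrite exprS; field.
  by move=> h; apply: lerD; [exact: IH|exact: h].
have geo : (2^-1 : R) ^+ k @[k --> \oo] --> 0.
  by apply: cvg_expr; rewrite ger0_norm// invf_lt1// ltr1n.
have /choice[g gP] x : exists y : X, F k x @[k --> \oo] --> y.
  have [Nx|Nx] := pselect (N x).
    exists 0; rewrite (_ : (fun k => _) = cst 0); first exact: cvg_cst.
    by apply/funext => k; rewrite /F mem_set.
  apply: cX => e e0; set s := Num.sqrt (fine (H x)) in dist.
  have s0 : 0 <= s by exact: sqrtr_ge0.
  pose r := e / (4 * (s + 1)); have r0 : 0 < r by rewrite divr_gt0// mulr_gt0// ltr_wpDl.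
  move/cvgr0Pnorm_lt : geo => /(_ r r0)[K _ /(_ K (leqnn _)) /=].
  rewrite ger0_norm ?exprn_ge0// => rK.
  have D m : (K <= m)%N -> `|F m x - F K x| < e / 2.
    move=> Km; apply: (le_lt_trans (dist x K m Nx Km)).
    apply: (@le_lt_trans _ _ ((s + 1) * (2 * 2^-1 ^+ K))).
      rewrite -/s; apply: ler_pM => //; rewrite ?lerDl//; last by rewrite gerBl mulr_ge0 ?exprn_ge0.
      rewrite subr_ge0 ler_pM2l// -(subnK Km) exprD ler_piMl ?exprn_ge0//.
      by rewrite exprn_ile1// invf_le1// ler1n.
    rewrite mulrCA mulrC; move: rK; rewrite /r ltr_pdivlMr ?mulr_gt0 ?ltr_wpDl//.
    move: (2^-1 ^+ K) => w; nra.
  exists K => m n /D Km /D Kn; rewrite -(subrKA (F K x)) (le_lt_trans (ler_normD _ _))//.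
  by rewrite [e]splitr ltrD// distrC.
have mF k : strongly_measurable setT (F k).
  apply: strongly_measurable_patch => //; first exact: strongly_measurable_cst.
  exact: strongly_measurable_sub (mf (phi k)).
have mg : strongly_measurable setT g.
  by apply: (strongly_measurable_cvg measurableT mF) => x _; exact: gP.
have gF x k : ~ N x -> `|g x - F k x| ^+ 2 <= fine (H x) * (4 * 4^-1 ^+ k).
  move=> Nx; have h0 : 0 <= fine (H x) by rewrite fine_ge0.
  set s := Num.sqrt (fine (H x)) in dist.
  have h : `|g x - F k x| <= s * (2 * 2^-1 ^+ k).
    have hc : `|F m x - F k x| @[m --> \oo] --> `|g x - F k x|.
      by apply: cvg_norm; apply: cvgB; [exact: gP|exact: cvg_cst].
    apply: (cvgr_to_le hc); exists k => // m /= km; apply: (le_trans (dist x k m Nx km)).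
    by rewrite ler_wpM2l ?sqrtr_ge0// gerBl mulr_ge0 ?exprn_ge0.
  have -> : fine (H x) * (4 * 4^-1 ^+ k) = (s * (2 * 2^-1 ^+ k)) ^+ 2.
    by rewrite [RHS]exprMn sqr_sqrtr//; congr (_ * _); rewrite exp4; ring.
  by rewrite lerXn2r ?nnegrE// mulr_ge0 ?sqrtr_ge0// mulr_ge0 ?exprn_ge0.
have aeN : {ae mu, forall x, ~ N x}.
  by exists N; split => // x /=; apply: contrapT.
(* The same H dominates the tails, so the subsequence also converges to g in L2. *)
have igF k : (\int[mu]_x ((`|g x - F k x| ^+ 2)%:E) <= (2 * (4 * 4^-1 ^+ k))%:E)%E.
  apply: (@le_trans _ _ (\int[mu]_x ((4 * 4^-1 ^+ k)%:E * H x))%E); last first.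
    rewrite ge0_integralZl// [2 * _]mulrC [X in (_ <= X)%E]EFinM; apply: lee_wpmul2l; last exact: iH.
    by rewrite lee_fin mulr_ge0 ?exprn_ge0.
  apply: ae_ge0_le_integral => //.
  - apply/measurable_EFinP; apply: mnorm2.
    have := strongly_measurable_comb2 1 (-1) mg (mF k).
    by apply: strongly_measurable_ext => x _; rewrite scale1r scaleN1r.
  - by move=> x _; rewrite mule_ge0// lee_fin mulr_ge0 ?exprn_ge0.
  - exact: measurable_funeM.
  - apply: filterS aeN => x Nx _; rewrite -[H x]fineK; last first.
      by rewrite ge0_fin_numE// ltNge leye_eq; apply/eqP.
    by rewrite -EFinM lee_fin mulrC; exact: gF.
have FuF k : class_of (u (phi k)) (F k).
  have hF : {ae mu, forall x, f (phi k) x = F k x}.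
    by apply: filterS aeN => x Nx; rewrite /F memNset.
  apply: (ae_class_of (uf _) _ hF); split => //.
  have [_] := class_of_sq_integrable (uf (phi k)).
  rewrite (@ae_eq_integral _ _ _ mu setT (fun x => (`|f (phi k) x| ^+ 2)%:E) (fun x => (`|F k x| ^+ 2)%:E))//.
  - by apply/measurable_EFinP; exact: mnorm2.
  - by apply/measurable_EFinP; exact: mnorm2.
  - by apply: filterS hF => x -> _.
have sg : sq_integrable mu g.
  have s1 : sq_integrable mu (fun x => g x - F 0 x).
    split; last exact: le_lt_trans (igF 0) (ltry _).
    have := strongly_measurable_comb2 1 (-1) mg (mF 0).
    by apply: strongly_measurable_ext => x _; rewrite scale1r scaleN1r.
  have [s2 _] := L2_add s1 (class_of_sq_integrable (FuF 0)).
  by move: s2; rewrite (_ : _ + _ = g)//; apply/funext => x /=; rewrite -[LHS]/(g x - F 0 x + F 0 x) subrK.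
have [l lg] := class_of_exists sg.
exists phi, l, g, N; split => //.
apply/cvgrPdist_lt => e e0.
have e20 : 0 < e / 2 by rewrite divr_gt0.
have lu k : `|l - u (phi k)| <= 3 * 2^-1 ^+ k.
  have := igF k; rewrite -(L2_norm_sqr (class_ofB lg (FuF k))) lee_fin => h.
  rewrite -(@ler_pXn2r _ 2) ?nnegrE ?mulr_ge0 ?exprn_ge0//; apply: (le_trans h).
  have -> : (3 * 2^-1 ^+ k) ^+ 2 = 9 * 4^-1 ^+ k :> R.
    by rewrite exp4; ring.
  by rewrite mulrA ler_wpM2r ?exprn_ge0//; lra.
have r0 : 0 < e / 8 by rewrite divr_gt0.
move/cvgr0Pnorm_lt : geo => /(_ _ r0)[K _ /(_ K (leqnn _)) /=].
rewrite ger0_norm ?exprn_ge0// => rK.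
exists (phi K) => // n /= Kn.
rewrite -(subrKA (u (phi K))) (le_lt_trans (ler_normD _ _))//.
have := lu K; have := phiP K _ _ (leqnn _) Kn.
have : 4^-1 ^+ K <= 2^-1 ^+ K :> R.
  by rewrite lerXn2r ?nnegrE//; lra.
lra.
Qed.

Lemma seq_complete_L2 : seq_complete (L2 mu X : normedModType R).
Proof.
move=> u cu; have [phi [l [g [N [_ _ ul _]]]]] := L2_riesz_fischer cu (fun n => class_of_repr (u n)).
by exists l.
Qed.

End L2_theory.

(** * Completeness of the phase space *)

Section pairing.
Context {disp : measure_display} {T : measurableType disp} {R : realType}.
Variables (mu : {measure set T -> \bar R}) (X : normedModType R).
Hypothesis fmu : (mu setT < +oo)%E.

(* Only h * w is assumed measurable: test functions are not known to be
   measurable for the Caratheodory sigma-algebra of domain_measure. *)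
Lemma L2_pairing_bound (f : T -> X) (h w : T -> R) C : sq_integrable mu f ->
  (forall x, `|h x| <= `|f x|) -> (forall x, `|w x| <= C) ->
  measurable_fun setT (fun x => h x * w x) ->
  mu.-integrable setT (EFin \o (fun x => h x * w x)) /\
  `|\int[mu]_x (h x * w x)|%R <= C * Num.sqrt (fine (mu setT) * \int[mu]_x (`|f x| ^+ 2))%R.
Proof.
move=> [mf fi] hf wC mhw.
have C0 : 0 <= C by apply: le_trans (wC point).
set m := fine (mu setT).
have mE : mu setT = m%:E by rewrite fineK// ge0_fin_numE.
rewrite -/m; set G := (\int[mu]_x (`|f x| ^+ 2))%R.
have G0 : 0 <= G by apply: Rintegral_ge0 => x _; rewrite sqr_ge0.
have GE : (\int[mu]_x (`|f x| ^+ 2)%:E)%E = G%:E.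
  by rewrite /G /Rintegral fineK// ge0_fin_numE// integral_ge0// => x _; rewrite lee_fin sqr_ge0.
have mf2 : measurable_fun setT (fun x => `|f x| ^+ 2).
  by apply: measurable_funX; exact: strongly_measurable_norm.
have key l : 0 < l -> (\int[mu]_x `|(h x * w x)%:E| <= (C / 2 * (l * m + G / l))%:E)%E.
  move=> l0; have l1 : 0 <= l^-1 by rewrite invr_ge0 ltW.
  have C2 : 0 <= C / 2 by rewrite divr_ge0.
  apply: (@le_trans _ _ (\int[mu]_x ((C / 2)%:E * (l%:E + (l^-1)%:E * (`|f x| ^+ 2)%:E)))%E).
    apply: ge0_le_integral => //.
    - by apply: measurableT_comp => //; exact/measurable_EFinP.
    - apply/measurable_EFinP; apply: measurable_funM => //; apply: measurable_funD => //.
      exact: measurable_funM.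
    - move=> x _; rewrite -?EFinM -?EFinD -?EFinM abse_EFin lee_fin normrM.
      apply: (@le_trans _ _ (`|f x| * C)); first by rewrite ler_pM.
      rewrite mulrC mulrAC -mulrA ler_wpM2l// ler_pdivlMr// -subr_ge0.
      have -> : l + l^-1 * `|f x| ^+ 2 - `|f x| * 2 = l^-1 * (l - `|f x|) ^+ 2.
        by field; rewrite gt_eqF.
      by rewrite mulr_ge0 ?sqr_ge0.
  have E1 : (forall x, setT x -> 0 <= (l^-1)%:E * (`|f x| ^+ 2)%:E)%E.
    by move=> x _; rewrite -EFinM lee_fin mulr_ge0 ?sqr_ge0.
  have m1 : measurable_fun setT (fun x => (l^-1)%:E * (`|f x| ^+ 2)%:E)%E.
    by apply/measurable_EFinP; exact: measurable_funM.
  rewrite ge0_integralZl//; last 2 first.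
  - by apply: emeasurable_funD.
  - by move=> x _; rewrite adde_ge0 ?E1// lee_fin ltW.
  rewrite ge0_integralD//; last by move=> x _; rewrite lee_fin ltW.
  rewrite integral_cst// mE ge0_integralZl//; last exact/measurable_EFinP.
  by rewrite GE [G / l]mulrC; exact: lexx.
have ihw : mu.-integrable setT (EFin \o (fun x => h x * w x)).
  apply/integrableP; split; first exact/measurable_EFinP.
  exact: le_lt_trans (key 1 ltr01) (ltry _).
split => //; apply: (le_trans (le_normr_Rintegral measurableT ihw)).
set I := (\int[mu]_x _)%R.
have IE : (I%:E = \int[mu]_x `|(h x * w x)%:E|)%E.
  rewrite /I /Rintegral fineK//.
  by rewrite ge0_fin_numE ?integral_ge0//; apply: le_lt_trans (key 1 ltr01) (ltry _).
have {}key l : 0 < l -> 2 * I <= C * (l * m + G / l).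
  by move=> /key; rewrite -IE lee_fin; move: (l * m + G / l) => z; lra.
have [C1|C1] := ltP 0 C; last first.
  have C00 : C = 0 by apply/eqP; rewrite eq_le C1 C0.
  by have := key 1 ltr01; rewrite C00 !mul0r; lra.
rewrite -ler_pdivrMl//; apply: le_sqrt_of_amgm => //; first exact: fine_ge0.
by move=> l /key; rewrite mulrCA ler_pdivrMl.
Qed.

End pairing.

(** * Bounded domains and test functions *)

Section bounded_domain.
Context {R : realType} {d : nat}.
Notation E := 'rV[R]_d.+1.
Variable Omega : set E.
Hypothesis bO : bounded_set Omega.

Let box_volume_ge0 (A : set E) : (0 <= box_volume A)%E.
Proof.
apply: le_ereal_inf_tmp => _ [a [b [ab _ ->]]].
by rewrite lee_fin; apply: prodr_ge0 => i _; rewrite subr_ge0.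
Qed.

Let box_volume0 : @box_volume R d set0 = 0%E.
Proof.
apply/eqP; rewrite eq_le box_volume_ge0 andbT; apply: ereal_inf_lbound.
by exists 0, 0; split => //; rewrite big_ord_recl subrr mul0r.
Qed.

(** The domain itself, which lies in a box, followed by empty sets is a cover of finite total
    volume. *)
Lemma domain_measure_fin : (domain_measure Omega setT < +oo)%E.
Proof.
have -> : domain_measure Omega setT = lebesgue_outer Omega.
  by rewrite -[LHS]/(lebesgue_outer (setT `&` Omega)) setTI.
pose C (k : nat) : set E := if k is 0%N then Omega else set0.
have lecov : (lebesgue_outer Omega <= \sum_(k <oo) box_volume (C k))%E.
  by apply: ereal_inf_lbound; exists C => // x Ox; exists 0%N.
apply: (le_lt_trans lecov).
have [M [_ MP]] := bO; have {}MP := MP (`|M| + 1) _.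
have M1 : M < `|M| + 1 by rewrite (le_lt_trans (ler_norm _))// ltrDl.
pose r := `|M| + 1.
have bfin : (box_volume Omega <= (\prod_(i < d.+1) ((const_mx r : E) 0 i - (const_mx (- r) : E) 0 i))%:E)%E.
  apply: ereal_inf_lbound; exists (const_mx (- r)), (const_mx r); split => //.
    by move=> i; rewrite !mxE ge0_cp// /r addr_ge0.
  move=> x /(MP M1) xr i; rewrite !mxE -ler_norml.
  apply: le_trans xr.
  by rewrite [leRHS]mx_normrE; exact: (le_bigmax _ (fun ij : 'I_1 * 'I_d.+1 => `|x ij.1 ij.2|) (0, i)).
apply: (@le_lt_trans _ _ (box_volume Omega)); last exact: le_lt_trans bfin (ltry _).
apply: lime_le.
  by apply: is_cvg_nneseries => n _ _; exact: box_volume_ge0.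
apply: nearW => -[|n]; first by rewrite big_geq// box_volume_ge0.
by rewrite big_nat_recl//= big1 ?adde0// => i _; exact: box_volume0.
Qed.

Lemma compact_support_bounded (K : set E) (psi : E -> R) : compact K ->
  continuous psi -> (forall x, ~ K x -> psi x = 0) -> exists C, forall x, `|psi x| <= C.
Proof.
move=> cK cpsi psi0.
have : compact (psi @` K) by apply: continuous_compact => //; exact: continuous_subspaceT.
move=> /compact_bounded[M [_ MP]]; exists (`|M| + 1) => x.
have [Kx|Kx] := pselect (K x); last by rewrite psi0// normr0 addr_ge0.
by apply: MP; [rewrite (le_lt_trans (ler_norm _))// ltrDl|exists x].
Qed.

Lemma test_function_bounded (U : set E) phi i : test_function U phi ->
  (exists C, forall x, `|phi x| <= C) /\ (exists C, forall x, `|partial i phi x| <= C).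
Proof.
move=> [sphi [K [cK _ phi0]]]; split.
  by apply: (compact_support_bounded cK) => //; exact: (sphi [::]).1.
apply: (compact_support_bounded cK); first exact: (sphi [:: i]).1.
move=> x Kx; have clK : closed K by apply: compact_closed => //; exact: norm_hausdorff.
have : \forall y \near x, phi y = cst 0 y.
  have : open (~` K) by exact: closed_openC.
  rewrite openE => /(_ x Kx); apply: filterS => y Ky.
  exact: phi0.
by move=> /near_eq_derive h; rewrite /partial h ?derive_cst.
Qed.

End bounded_domain.

Section domain_pairing.
Context {R : realType} {d : nat}.
Variable Omega : set 'rV[R]_d.+1.
Hypothesis bO : bounded_set Omega.
Notation E := 'rV[R]_d.+1.
Notation mu := (domain_measure Omega).

Lemma coord_le_norm (x : E) i : `|x 0 i| <= `|x|.
Proof.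
rewrite [leRHS]mx_normrE.
exact: (le_bigmax _ (fun ij : 'I_1 * 'I_d.+1 => `|x ij.1 ij.2|) (0, i)).
Qed.

(** Here p will be the identity or a coordinate. The limit product is measurable as an everywhere
    limit of products set to 0 on N; after that, Cauchy-Schwarz on a space of finite measure bounds
    the difference of the pairings. *)
Lemma L2_pairing_cvg (X : normedModType R) (p : X -> R) (u : nat -> L2 mu X) (l : L2 mu X)
    (f : nat -> caratheodory_type (outer_restr lebesgue_outer Omega) -> X) g
    (phi : nat -> nat) N (w : E -> R) C :
  (forall x, `|p x| <= `|x|) -> (forall x y, p (x - y) = p x - p y) -> p 0 = 0 ->
  (forall n, class_of (u n) (f n)) -> class_of l g -> u n @[n --> \oo] --> l ->
  measurable N -> (forall x, (if x \in N then 0 else f (phi n) x) @[n --> \oo] --> g x) ->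
  (forall x, `|w x| <= C) ->
  (forall n, mu.-integrable setT (EFin \o (fun x => p (f n x) * w x))) ->
  mu.-integrable setT (EFin \o (fun x => p (g x) * w x)) /\
  (\int[mu]_x (p (f n x) * w x))%R @[n --> \oo] --> (\int[mu]_x (p (g x) * w x))%R.
Proof.
move=> p1 pB p0 uf lg ul mN fg wC ifw.
have fmu := domain_measure_fin bO.
have mfw n : measurable_fun setT (fun x => p (f n x) * w x).
  by apply/measurable_EFinP; have /integrableP[] := ifw n.
have cp (y : nat -> X) z : y n @[n --> \oo] --> z -> p (y n) @[n --> \oo] --> p z.
  move=> yz; apply/cvgrPdist_lt => e e0; move/cvgrPdist_lt : yz => /(_ e e0).
  by apply: filterS => n; apply: le_lt_trans; rewrite -pB.
have mgw : measurable_fun setT (fun x => p (g x) * w x).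
  apply: (@measurable_fun_cvg _ _ _ _ (fun n x => if x \in N then 0 else p (f (phi n) x) * w x)).
    move=> n; rewrite (_ : (fun x => _) = (fun x => p (f (phi n) x) * w x) \_ (~` N)).
      apply/(measurable_restrictT _ (measurableC mN)).
      exact: measurable_funS (mfw (phi n)).
    by apply/funext => x; rewrite patchE in_setC; case: ifP.
  move=> x _.
  rewrite (_ : (fun n => _) = (fun n => p (if x \in N then 0 else f (phi n) x) * w x)).
    by apply: cvgM; [apply: cp; exact: fg|exact: cvg_cst].
  by apply/funext => n; case: ifP; rewrite // p0 mul0r.
have [ig _] := L2_pairing_bound fmu (class_of_sq_integrable lg) (fun x => p1 (g x)) wC mgw.
split => //.
have C0 : 0 <= C by apply: le_trans (wC 0).
set m := fine (mu setT).
have m0 : 0 <= m by exact: fine_ge0.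
have bnd n : `|\int[mu]_x (p (g x) * w x) - \int[mu]_x (p (f n x) * w x)|%R <= C * Num.sqrt m * `|l - u n|.
  have cB := class_ofB lg (uf n).
  have mB : measurable_fun setT (fun x => p (g x - f n x) * w x).
    rewrite (_ : (fun x => _) = (fun x => p (g x) * w x - p (f n x) * w x)).
      exact: measurable_funB.
    by apply/funext => x; rewrite pB mulrBl.
  have [_] := L2_pairing_bound fmu (class_of_sq_integrable cB) (fun x => p1 (g x - f n x)) wC mB.
  rewrite -RintegralB//.
  rewrite (_ : (fun x => p (g x) * w x - _) = (fun x => p (g x - f n x) * w x)); last first.
    by apply/funext => x; rewrite pB mulrBl.
  rewrite -/m sqrtrM// mulrA.
  have -> : (\int[mu]_x (`|g x - f n x| ^+ 2))%R = `|l - u n| ^+ 2.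
    by rewrite /Rintegral -(L2_norm_sqr cB).
  by rewrite sqrtr_sqr normr_id.
have bnd0 : C * Num.sqrt m * `|l - u n| @[n --> \oo] --> 0.
  rewrite -[X in _ --> X](mulr0 (C * Num.sqrt m)); apply: cvgM; first exact: cvg_cst.
  exact: (cvg_real_norm u l).1.
apply/cvgrPdist_lt => e e0; move/cvgr0Pnorm_lt : bnd0 => /(_ e e0).
by apply: filterS => n; apply: le_lt_trans; apply: le_trans (ler_norm _); exact: bnd.
Qed.

End domain_pairing.

Section H1_space_complete.
Context {R : realType} {d : nat}.
Variables Omega Gamma0 : set 'rV[R]_d.+1.
Hypothesis bO : bounded_set Omega.
Notation E := 'rV[R]_d.+1.
Notation mu := (domain_measure Omega).
Notation HG := (H1_Gamma0 Omega Gamma0).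

Lemma H1_normE (u : HG) : `|u| = `|val u|.
Proof. by []. Qed.

(** The identity of weak gradients passes to the limit because pairings with bounded functions are
    continuous in L2, and the zero trace does because [trace] is defined by a closure. *)
Lemma seq_complete_H1_Gamma0 : seq_complete (HG : normedModType R).
Proof.
move=> u cu.
have cL2s := @seq_complete_L2 _ _ _ mu _ (@seq_complete_real R).
have cL2v := @seq_complete_L2 _ _ _ mu _ (@seq_complete_rV R d).
have cval : seq_cauchy (fun n => val (u n)).
  by move=> e /cu[N NP]; exists N => m n Nm Nn; rewrite -raddfB; exact: NP.
have c1 := seq_cauchy_fst cval.
have c2 := seq_cauchy_snd cval.
have hu n : H1 (val (u n)) /\ trace (val (u n)) (0 : L2 (surface_measure Gamma0) R^o).
  by have := valP (u n); rewrite inE.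
have /choice[fG fGP] n : exists fG : (E -> R) * (E -> E),
    [/\ class_of (val (u n)).1 fG.1, class_of (val (u n)).2 fG.2 & is_weak_gradient Omega fG.1 fG.2].
  by have [[f [G [uf uG w]]] _] := hu n; exists (f, G).
have uf n := let: And3 h _ _ := fGP n in h.
have uG n := let: And3 _ h _ := fGP n in h.
have fw n := let: And3 _ _ h := fGP n in h.
have [phi [l1 [g1 [N1 [mN1 lg1 ul1 fg1]]]]] := L2_riesz_fischer (@seq_complete_real R) c1 uf.
have [psi [l2 [g2 [N2 [mN2 lg2 ul2 fg2]]]]] := L2_riesz_fischer (@seq_complete_rV R d) c2 uG.
have cvgl := cvg_prod_pair ul1 ul2.
have hl : (l1, l2) \in @H1_Gamma0_pred R d Omega Gamma0.
  rewrite inE; split.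
    exists g1, g2; split => // t i tt.
    have [[Ct tC] [Cp pC]] := test_function_bounded i tt.
    have [||||i1 v1] := L2_pairing_cvg (X := R^o) (p := id) bO _ _ _ uf lg1 ul1 mN1 fg1 pC _ => //.
      by move=> n; have [] := fw n t i tt.
    have [||||i2 v2] := L2_pairing_cvg (X := E) (p := fun x => x 0 i) bO _ _ _ uG lg2 ul2 mN2 fg2 tC _ => //.
    - by move=> x; exact: coord_le_norm.
    - by move=> x y; rewrite !mxE.
    - by rewrite mxE.
    - by move=> n; have [] := fw n t i tt.
    split => //.
    have v1' : (\int[mu]_x ((fG n).1 x * partial i t x))%R @[n --> \oo] -->
        (\int[mu]_x (g1 x * partial i t x))%R by exact: v1.
    have v2' : - (\int[mu]_x ((fG n).2 x 0 i * t x))%R @[n --> \oo] -->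
        - (\int[mu]_x (g2 x 0 i * t x))%R by exact: cvgN v2.
    have E1 : (fun n => (\int[mu]_x ((fG n).1 x * partial i t x))%R) =
        (fun n => - (\int[mu]_x ((fG n).2 x 0 i * t x))%R).
      by apply/funext => n; have [_ _] := fw n t i tt.
    rewrite E1 in v1'; rewrite -(cvg_lim _ v1')// -(cvg_lim _ v2')//.
  pose z : L2 (surface_measure Gamma0) R^o := 0.
  have ct : (val (u n), z) @[n --> \oo] --> ((l1, l2), z).
    exact: (@cvg_prod_pair _ _ _ (fun n => (val (u n), z)) _ _ cvgl (cvg_cst z)).
  have clS := @closed_closure _ (@smooth_traces R d Omega Gamma0).
  have nS : \forall n \near \oo, closure (@smooth_traces R d Omega Gamma0) (val (u n), z).
    by apply: nearW => n; case: (hu n).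
  have h := @closed_cvg _ _ _ _ _ _ clS nS _ ct.
  exact: h.
exists (MkH1_Gamma0 hl); apply/cvg_real_norm.
move/cvg_real_norm : cvgl; apply: cvg_trans; apply: near_eq_cvg.
by apply: nearW => n; rewrite H1_normE raddfB.
Qed.

Lemma seq_complete_phase : seq_complete (phase Omega Gamma0 : normedModType R).
Proof.
have h1 := seq_complete_H1_Gamma0.
have h2 := @seq_complete_L2 _ _ _ mu _ (@seq_complete_real R).
have h3 := @seq_complete_L2 _ _ _ (@unit_measure R) _ h1.
by do !apply: seq_complete_prod.
Qed.

End H1_space_complete.

(** * The energy form *)

Lemma prod_norm_fst (R : realType) (X Y : normedModType R) (z : (X * Y)%type) : `|z.1| <= `|z|.
Proof. by rewrite [leRHS]prod_normE le_max lexx. Qed.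

Lemma prod_norm_snd (R : realType) (X Y : normedModType R) (z : (X * Y)%type) : `|z.2| <= `|z|.
Proof. by rewrite [leRHS]prod_normE le_max lexx orbT. Qed.

Lemma prod_bounded_form (R : realType) (X Y : normedModType R) (b1 : X -> X -> R)
    (b2 : Y -> Y -> R) C1 C2 k l : bounded_form b1 C1 -> bounded_form b2 C2 ->
  0 <= k -> 0 <= l ->
  bounded_form (fun z z' : (X * Y)%type => k * b1 z.1 z'.1 + l * b2 z.2 z'.2) (k * C1 + l * C2).
Proof.
move=> [s1 l1 n1 p1 C10] [s2 l2 n2 p2 C20] k0 l0; split.
- by move=> x y; rewrite s1 s2.
- by move=> a x x' y /=; rewrite l1 l2; ring.
- move=> x y; apply: (le_trans (ler_normD _ _)); rewrite !normrM (ger0_norm k0) (ger0_norm l0).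
  rewrite !mulrDl -!mulrA; apply: lerD; apply: ler_wpM2l => //.
    apply: (le_trans (n1 _ _)); rewrite -mulrA ler_wpM2l//.
    by apply: ler_pM => //; exact: prod_norm_fst.
  apply: (le_trans (n2 _ _)); rewrite -mulrA ler_wpM2l//.
  by apply: ler_pM => //; exact: prod_norm_snd.
- by move=> x; rewrite addr_ge0// mulr_ge0.
- by rewrite addr_ge0// mulr_ge0.
Qed.

(** * Forms integrated with a weight *)

Section L2_form.
Context {disp : measure_display} {T : measurableType disp} {R : realType}.
Variables (mu : {measure set T -> \bar R}) (X : normedModType R).
Variables (b : X -> X -> R) (C : R) (w : T -> R) (K : R).
Hypotheses (hb : bounded_form b C) (mw : measurable_fun setT w) (w0 : forall x, 0 <= w x)
  (wK : {ae mu, forall x, w x <= K}) (K0 : 0 <= K).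

(** One construction for all parts of the energy product: weight 1 yields [L2_prod] and [grad_prod],
    and weight xi e^(cs) over [grad_prod] yields [weighted_prod]. *)
Definition L2_form (u v : L2 mu X) : R := (\int[mu]_x (w x * b (L2repr u x) (L2repr v x)))%R.

Lemma bform_measurable (f g : T -> X) : strongly_measurable setT f -> strongly_measurable setT g ->
  measurable_fun setT (fun x => b (f x) (g x)).
Proof.
move=> mf mg; apply: strongly_measurable_real => //.
apply: (@strongly_measurable_comp _ _ _ ((X * X)%type) R^o setT (fun z => b z.1 z.2) (fun x => (f x, g x))).
  exact: bform_continuous hb.
exact: strongly_measurable_pair.
Qed.

(** A Young inequality with parameter l is integrated and then optimised. The bound on the weight
    holds almost everywhere, to allow the exponential, which is bounded by K on ]0, 1[. *)
Lemma L2_form_integrable (u v : L2 mu X) f g : class_of u f -> class_of v g ->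
  mu.-integrable setT (EFin \o (fun x => w x * b (f x) (g x))) /\
  `|\int[mu]_x (w x * b (f x) (g x))|%R <= K * C * `|u| * `|v|.
Proof.
move=> uf vg; have [bC bl bb b0 C0] := hb.
have [[mf _] [mg _]] := (class_of_sq_integrable uf, class_of_sq_integrable vg).
have mwb : measurable_fun setT (fun x => w x * b (f x) (g x)).
  by apply: measurable_funM => //; exact: bform_measurable.
have mn2 h : strongly_measurable setT h -> measurable_fun setT (fun x : T => `|h x : X| ^+ 2).
  by move=> mh; apply: measurable_funX; exact: strongly_measurable_norm.
pose D := K * C; have D0 : 0 <= D by rewrite mulr_ge0.
have key l : 0 < l -> (\int[mu]_x `|(w x * b (f x) (g x))%:E| <=
    (D / 2 * (l * `|u| ^+ 2 + `|v| ^+ 2 / l))%:E)%E.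
  move=> l0; have l1 : 0 <= l^-1 by rewrite invr_ge0 ltW.
  have D2 : 0 <= D / 2 by rewrite divr_ge0.
  have mA : measurable_fun setT (fun x => l%:E * (`|f x| ^+ 2)%:E)%E.
    by apply/measurable_EFinP; apply: measurable_funM => //; exact: mn2.
  have mB : measurable_fun setT (fun x => (l^-1)%:E * (`|g x| ^+ 2)%:E)%E.
    by apply/measurable_EFinP; apply: measurable_funM => //; exact: mn2.
  apply: (@le_trans _ _ (\int[mu]_x ((D / 2)%:E * (l%:E * (`|f x| ^+ 2)%:E + (l^-1)%:E * (`|g x| ^+ 2)%:E)))%E).
    apply: ae_ge0_le_integral => //.
    - by apply: measurableT_comp => //; exact/measurable_EFinP.
    - move=> x _; rewrite -?EFinM -?EFinD -?EFinM lee_fin mulr_ge0// addr_ge0// mulr_ge0 ?sqr_ge0//.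
      exact: ltW.
    - by apply: measurable_funeM; exact: emeasurable_funD.
    - apply: filterS wK => x wx _.
      rewrite -?EFinM -?EFinD -?EFinM abse_EFin lee_fin normrM (ger0_norm (w0 x)).
      apply: (@le_trans _ _ (K * (C * `|f x| * `|g x|))); first by rewrite ler_pM.
      have -> : K * (C * `|f x| * `|g x|) = D / 2 * (2 * (`|f x| * `|g x|)) by rewrite /D; field.
      rewrite ler_wpM2l// -subr_ge0.
      have -> : l * `|f x| ^+ 2 + l^-1 * `|g x| ^+ 2 - 2 * (`|f x| * `|g x|) =
          l^-1 * (l * `|f x| - `|g x|) ^+ 2.
        by field; rewrite gt_eqF.
      by rewrite mulr_ge0 ?sqr_ge0.
  have nA x : (0 <= l%:E * (`|f x| ^+ 2)%:E)%E by rewrite lee_fin mulr_ge0 ?sqr_ge0 ?ltW.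
  have nB x : (0 <= (l^-1)%:E * (`|g x| ^+ 2)%:E)%E by rewrite lee_fin mulr_ge0 ?sqr_ge0.
  rewrite ge0_integralZl//; last 2 first.
  - exact: emeasurable_funD.
  - by move=> x _; rewrite adde_ge0.
  rewrite ge0_integralD//.
  rewrite ge0_integralZl//; last 2 first.
  - by apply/measurable_EFinP; exact: mn2.
  - by rewrite lee_fin ltW.
  rewrite ge0_integralZl//; last by apply/measurable_EFinP; exact: mn2.
  by rewrite -(L2_norm_sqr uf) -(L2_norm_sqr vg) [_ / l]mulrC; exact: lexx.
have iwb : mu.-integrable setT (EFin \o (fun x => w x * b (f x) (g x))).
  apply/integrableP; split; first exact/measurable_EFinP.
  exact: le_lt_trans (key 1 ltr01) (ltry _).
split => //; apply: (le_trans (le_normr_Rintegral measurableT iwb)).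
set I := (\int[mu]_x _)%R.
have IE : (I%:E = \int[mu]_x `|(w x * b (f x) (g x))%:E|)%E.
  rewrite /I /Rintegral fineK//.
  by rewrite ge0_fin_numE ?integral_ge0//; apply: le_lt_trans (key 1 ltr01) (ltry _).
have {}key l : 0 < l -> 2 * I <= D * (l * `|u| ^+ 2 + `|v| ^+ 2 / l).
  by move=> /key; rewrite -IE lee_fin; move: (l * _ + _ / l) => z; lra.
rewrite -/D -mulrA; have [D1|D1] := ltP 0 D; last first.
  have D00 : D = 0 by apply/eqP; rewrite eq_le D1 D0.
  by have := key 1 ltr01; rewrite D00 !mul0r; lra.
rewrite -ler_pdivrMl//.
have -> : `|u| * `|v| = Num.sqrt (`|u| ^+ 2 * `|v| ^+ 2).
  by rewrite -exprMn sqrtr_sqr ger0_norm// mulr_ge0.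
apply: le_sqrt_of_amgm; rewrite ?sqr_ge0// => l /key h.
by rewrite mulrCA ler_pdivrMl.
Qed.

Lemma L2_formE (u v : L2 mu X) f g : class_of u f -> class_of v g ->
  L2_form u v = (\int[mu]_x (w x * b (f x) (g x)))%R.
Proof.
move=> uf vg; rewrite /L2_form /Rintegral; congr fine.
have [i1 _] := L2_form_integrable (class_of_repr u) (class_of_repr v).
have [i2 _] := L2_form_integrable uf vg.
apply: ae_eq_integral => //; [by have /integrableP[] := i1|by have /integrableP[] := i2|].
apply: filterS2 (class_of_ae (class_of_repr u) uf) (class_of_ae (class_of_repr v) vg) => x fx gx _.
by rewrite fx gx.
Qed.

Lemma L2_form_bounded : bounded_form L2_form (K * C).
Proof.
have [bC bl bb b0 C0] := hb; split.
- by move=> u v; apply: eq_Rintegral => x _; rewrite bC.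
- move=> a u u' v.
  have cu := class_of_repr u; have cu' := class_of_repr u'; have cv := class_of_repr v.
  rewrite (L2_formE (class_of_comb a cu cu') cv).
  have [i1 _] := L2_form_integrable cu cv; have [i2 _] := L2_form_integrable cu' cv.
  have [_ <-] := Rintegral_comb a i1 i2.
  by apply: eq_Rintegral => x _; rewrite -[X in b X _]/(a *: L2repr u x + L2repr u' x) bl; ring.
- move=> u v; have [_] := L2_form_integrable (class_of_repr u) (class_of_repr v).
  exact.
- by move=> u; apply: Rintegral_ge0 => x _; rewrite mulr_ge0.
- by rewrite mulr_ge0.
Qed.

End L2_form.

Section energy_form.
Context {R : realType} {d : nat}.
Variables Omega Gamma0 : set 'rV[R]_d.+1.
Variables c1 c2 d1 d2 tau c : R.
Hypotheses (hc1 : 0 < c1) (hd1 : 0 < d1) (hd2 : d2 != 0) (htau : 0 < tau).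
Notation E := 'rV[R]_d.+1.
Notation mu := (domain_measure Omega).
Notation HG := (H1_Gamma0 Omega Gamma0).

Lemma dotv_bounded_form : bounded_form (fun x y : E => dotv x y) d.+1%:R.
Proof.
split => //.
- by move=> x y; apply: eq_bigr => i _; rewrite mulrC.
- move=> a x x' y; rewrite /dotv mulr_sumr -big_split; apply: eq_bigr => i _ /=.
  by rewrite !mxE mulrDl mulrA.
- move=> x y; apply: (le_trans (ler_norm_sum _ _ _)).
  rewrite -mulrA; apply: (@le_trans _ _ (\sum_(i < d.+1) `|x| * `|y|)).
    by apply: ler_sum => i _; rewrite normrM ler_pM// coord_le_norm.
  by rewrite sumr_const card_ord mulr_natl.
- by move=> x; apply: sumr_ge0 => i _; rewrite -expr2 sqr_ge0.
Qed.

Lemma mul_bounded_form : bounded_form (fun x y : R^o => x * y : R) 1.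
Proof.
split => //.
- by move=> x y; rewrite mulrC.
- by move=> a x x' y; rewrite mulrDl mulrA.
- by move=> x y; rewrite mul1r normrM.
- by move=> x; rewrite -expr2 sqr_ge0.
Qed.

Lemma L2_prod_bounded_form : bounded_form (@L2_prod R d Omega) 1.
Proof.
have := @L2_form_bounded _ _ _ mu _ _ _ (cst 1) 1 mul_bounded_form.
rewrite mulr1; have -> : L2_form (fun x y : R^o => x * y : R) (cst 1) = @L2_prod R d Omega.
  apply/funext => u; apply/funext => v; apply: eq_Rintegral => x _.
  by rewrite mul1r.
by apply => //; exact: aeW.
Qed.

Lemma grad_prod_bounded_form : bounded_form (@grad_prod R d Omega Gamma0) d.+1%:R.
Proof.
have := @L2_form_bounded _ _ _ mu _ _ _ (cst 1) 1 dotv_bounded_form.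
move=> /(_ (measurable_cst _) (fun=> ler01) (aeW _ (fun=> lexx 1)) ler01).
set B := L2_form _ _; rewrite mul1r => -[BC Bl Bb B0 C0].
have E (u v : HG) : grad_prod u v = B (val u).2 (val v).2.
  by apply: eq_Rintegral => x _; rewrite mul1r.
have n2 (u : HG) : `|(val u).2| <= `|u|.
  exact: (prod_norm_snd (val u)).
split => //.
- by move=> x y; rewrite !E BC.
- by move=> a x x' y; rewrite !E linearP Bl.
- move=> x y; rewrite E; apply: le_trans (Bb _ _) _.
  rewrite -!mulrA; apply: ler_wpM2l => //; apply: ler_pM => //; exact: n2.
- by move=> x; rewrite E.
Qed.

Lemma weighted_prod_bounded_form : exists C,
  bounded_form (@weighted_prod R d Omega Gamma0 d1 d2 c) C.
Proof.
have xi0 : 0 <= xi d1 d2 by rewrite divr_ge0 ?mulr_ge0// ltW.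
pose K := xi d1 d2 * expR `|c|; have K0 : 0 <= K by rewrite mulr_ge0// expR_ge0.
exists (K * d.+1%:R).
apply: (@L2_form_bounded _ _ _ (@unit_measure R) _ _ _ (fun s => xi d1 d2 * expR (c * s)) K
  grad_prod_bounded_form) => //.
- apply: continuous_measurable_fun => s; apply: cvgM; first exact: cvg_cst.
  apply: (continuous_comp (f := fun s => c * s)); last exact: continuous_expR.
  by apply: cvgM; [exact: cvg_cst|exact: cvg_id].
- by move=> s; rewrite mulr_ge0// expR_ge0.
(* Outside ]0, 1[, a null set for [unit_measure], the weight may exceed K. *)
- exists (~` `]0, 1[%classic); split.
  + by apply: measurableC; exact: measurable_itv.
  + by rewrite -[LHS]/(@lebesgue_measure R (~` `]0, 1[ `&` `]0, 1[)) setICl measure0.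
  + move=> s /= h /=; rewrite in_itv/= => /andP[s0 s1]; apply: h.
    rewrite /K ler_wpM2l// ler_expR (le_trans (ler_norm _))// normrM (gtr0_norm s0).
    by rewrite ler_piMr// ltW.
Qed.

Lemma energy_prod_bounded_form : exists C,
  bounded_form (@energy_prod R d Omega Gamma0 c1 d1 d2 tau c) C.
Proof.
have [C3 w] := weighted_prod_bounded_form.
have e3 : 0 <= tau * d1 by rewrite mulr_ge0// ltW.
have e4 : 0 <= tau * `|d2| by rewrite mulr_ge0// ltW.
have f1 := prod_bounded_form grad_prod_bounded_form L2_prod_bounded_form (ltW hc1) ler01.
have f2 := prod_bounded_form f1 w ler01 e3.
have f3 := prod_bounded_form f2 w ler01 e4.
set C := (X in bounded_form _ X) in f3; exists C.
move: f3; set B := (X in bounded_form X _).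
suff -> : B = @energy_prod R d Omega Gamma0 c1 d1 d2 tau c by [].
apply/funext => -[[[u1 u2] u3] u4]; apply/funext => -[[[v1 v2] v3] v4].
by rewrite /B /energy_prod /= !mul1r.
Qed.

End energy_form.

(** * Weak derivatives on the unit interval *)

Section smooth_functions.
Context {R : realType}.
Implicit Types f g : R -> R.

(** Derivatives are carried as witnesses so that closure under products and composition follows by
    induction on k; [diffn_derivable] returns to the iterated derivatives in
    [unit_test_function]. *)
Fixpoint diffn (k : nat) f : Prop := if k is k'.+1 then
  exists2 f' : R -> R, (forall x : R, is_derive x (1 : R) f (f' x)) & diffn k' f' else True.

Lemma diffnW k f : diffn k.+1 f -> diffn k f.
Proof.
elim: k f => // k IH f [f' df [f'' df' h]].
by exists f' => //; apply: IH; exists f''.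
Qed.

Lemma diffn_comb k a b f g : diffn k f -> diffn k g -> diffn k (fun x => a * f x + b * g x).
Proof.
elim: k f g => // k IH f g [f' df hf] [g' dg hg].
exists (fun x => a * f' x + b * g' x); last exact: IH.
by move=> x; have := is_deriveD (is_deriveZ a (df x)) (is_deriveZ b (dg x)).
Qed.

Lemma diffn_mul k f g : diffn k f -> diffn k g -> diffn k (fun x => f x * g x).
Proof.
elim: k f g => // k IH f g hf hg.
have [f' df hf'] := hf; have [g' dg hg'] := hg.
exists (fun x => 1 * (f x * g' x) + 1 * (g x * f' x)).
  by move=> x; have := is_deriveM (df x) (dg x); rewrite !mul1r.
by apply: diffn_comb; apply: IH => //; exact: diffnW.
Qed.

Lemma diffn_comp k f g : diffn k f -> diffn k g -> diffn k (f \o g).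
Proof.
elim: k f g => // k IH f g [f' df hf] hg; have [g' dg hg'] := hg.
exists (fun x => (f' \o g) x * g' x).
  by move=> x; have := is_derive1_comp (df (g x)) (dg x); rewrite mulrC.
by apply: diffn_mul => //; apply: IH => //; exact: diffnW.
Qed.

Lemma diffn_cst k a : diffn k (fun=> a : R).
Proof.
elim: k a => // k IH a; exists (fun=> 0); last exact: IH.
by move=> x; exact: is_derive_cst.
Qed.

Lemma diffn_affine k a b : diffn k (fun x => a * x + b).
Proof.
case: k => // k; exists (fun=> a); last exact: diffn_cst.
move=> x; have := is_deriveD (is_deriveZ a (is_derive_id x (1 : R))) (is_derive_cst b x (1 : R)).
by rewrite addr0 /GRing.scale /= mulr1.
Qed.

Lemma diffn_derivable f : (forall k, diffn k f) -> forall k s, derivable (derive1n k f) s 1.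
Proof.
suff h k : forall f, diffn k.+1 f -> forall s, derivable (derive1n k f) s 1.
  by move=> hf k; exact: h.
elim: k => [|k IH] {}f [f' df hf] s; first by have [] := df s.
rewrite derive1Sn; apply: IH; have -> // : derive1 f = f'.
by apply/funext => x; rewrite derive1E; have [_ ->] := df x.
Qed.

(** The functions x^-n e^(-1/x), extended by 0: the derivative of each is a combination of two
    others, so smoothness of the family follows by induction. *)
Definition exp_inv n (x : R) : R := if 0 < x then (x^-1) ^+ n * expR (- x^-1) else 0.

(** With y = 1/x, the inequality 1 + z <= e^z at z = y / (n + 1) gives (y / (n + 1))^(n + 1) <= e^y.
    The factor x left over provides flatness at 0. *)
Lemma exp_inv_bound n (x : R) : 0 < x -> exp_inv n x <= n.+1%:R ^+ n.+1 * x.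
Proof.
move=> x0; rewrite /exp_inv x0.
have y0 : 0 < x^-1 by rewrite invr_gt0.
have n0 : n.+1%:R != 0 :> R by rewrite pnatr_eq0.
have h : (x^-1 / n.+1%:R) ^+ n.+1 <= expR (x^-1).
  rewrite -[X in expR X](divfK n0) expRM_natr.
  apply: lerXn2r; rewrite ?nnegrE ?expR_ge0 ?divr_ge0 ?(ltW y0)//.
  by apply: le_trans (expR_ge1Dx _); rewrite lerDr.
rewrite expRN ler_pdivrMr ?expR_gt0//.
rewrite mulrAC -ler_pdivrMr//; apply: le_trans _ (ler_wpM2l _ h); last by rewrite exprn_ge0.
by rewrite -exprMn [_ * (_ / _)]mulrC divfK// exprSr.
Qed.

Lemma is_derive_exp_inv n (x : R) : is_derive x (1 : R) (exp_inv n) (exp_inv n.+2 x - n%:R * exp_inv n.+1 x).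
Proof.
have [x0|x0|x0] := ltgtP x 0.
- rewrite /exp_inv ltNge (ltW x0) /= mulr0 subr0.
  apply: (@near_eq_is_derive _ _ _ (cst 0)).
  near=> y; rewrite /exp_inv ltNge (_ : y <= 0)//.
  by apply/ltW; near: y; exact: lt_nbhsl.
- have xn0 : x != 0 by rewrite gt_eqF.
  have dV : is_derive x 1 (fun y : R => y^-1) (- x ^- 2).
    have := is_deriveV xn0 (is_derive_id x (1 : R)).
    by rewrite /GRing.scale /= mulr1.
  have dN : is_derive x 1 (fun y : R => - y^-1) (- - x ^- 2) by exact: (is_deriveN dV).
  have dE := @is_derive1_comp _ expR (fun y : R => - y^-1) x _ _ (is_derive_expR _) dN.
  have dX := is_deriveX n dV.
  have nE : \near x, (x^-1 ^+ n * expR (- x^-1)) = exp_inv n x.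
    near=> y; rewrite /exp_inv (_ : 0 < y)//.
    by near: y; exact: lt_nbhsr.
  apply: (near_eq_is_derive nE).
  have := is_deriveM dX dE.
  have -> : ((fun y : R => y^-1) ^+ n * (expR \o (fun y : R => - y^-1)))%R =
      (fun y => y^-1 ^+ n * expR (- y^-1)).
    by apply/funext => y; rewrite -[LHS]/(((fun y : R => y^-1) ^+ n) y * expR (- y^-1)) exprfctE.
  rewrite exprfctE /exp_inv x0 /GRing.scale /=; congr is_derive.
  rewrite opprK -exprVn.
  (* The case m = 0 is separate because of the predecessor in the exponent; its coefficient vanishes
     there. *)
  have key (m : nat) (y e : R) : y ^+ m * (e * y ^+ 2) + e * (m%:R * y ^+ m.-1 * - y ^+ 2) =
      y ^+ m.+2 * e - m%:R * (y ^+ m.+1 * e).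
    by case: m => [|m] /=; rewrite !exprS; ring.
  exact: key.
- rewrite x0 /exp_inv ltxx mulr0 subr0.
  have cv : h^-1 *: ((exp_inv n \o shift 0) (h *: 1) - exp_inv n 0) @[h --> 0^'] --> (0 : R).
    apply/cvgrPdist_lt => e e0.
    pose K : R := n.+2%:R ^+ n.+2; have K0 : 0 < K by rewrite exprn_gt0.
    apply/nbhs_ballP; exists (e / K) => /=; first by rewrite divr_gt0.
    move=> h /=; rewrite /ball /= sub0r normrN => hK hn0.
    rewrite sub0r normrN /= addr0 -[h *: 1]/(h * 1) mulr1 {2}/exp_inv ltxx subr0.
    have [h0|h0] := ltP 0 h; last first.
      have -> : exp_inv n h = 0 by rewrite /exp_inv ltNge h0.
      by rewrite scaler0 normr0.
    (* The difference quotient at 0 is again in the family, so [exp_inv_bound] sends it to 0. *)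
    have -> : h^-1 *: exp_inv n h = exp_inv n.+1 h.
      by rewrite /exp_inv h0 /GRing.scale /= exprS mulrA.
    rewrite ger0_norm; last by rewrite /exp_inv h0 mulr_ge0 ?expR_ge0// exprn_ge0// invr_ge0 ltW.
    apply: (le_lt_trans (exp_inv_bound n.+1 h0)).
    by move: hK; rewrite gtr0_norm// ltr_pdivlMr// mulrC.
  apply: DeriveDef; first by apply/cvg_ex; exists 0.
  exact: cvg_lim cv.
Unshelve. all: by end_near. Qed.

Lemma diffn_exp_inv k n : diffn k (exp_inv n).
Proof.
elim: k n => // k IH n; exists (fun x => 1 * exp_inv n.+2 x + (- n%:R) * exp_inv n.+1 x).
  by move=> x; have := is_derive_exp_inv n x; rewrite mul1r mulNr.
exact: diffn_comb.
Qed.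

Let psi := exp_inv 0.

Let psi_ndecr x y : x <= y -> psi x <= psi y.
Proof.
move=> xy; rewrite /psi /exp_inv; case: ifPn => x0; last first.
  by case: ifPn => // _; rewrite expr0 mul1r expR_ge0.
have y0 := lt_le_trans x0 xy; rewrite y0 !expr0 !mul1r ler_expR lerN2.
by rewrite lef_pV2 ?posrE.
Qed.

(** A smooth monotone step that is 0 for x <= 0 and constant for x >= 1. Composition of e^(-1/x)
    with itself replaces the usual quotient, at the price of a height [smooth_step 1] that is
    positive but not 1. *)
Definition smooth_step (x : R) := psi (psi 1 - psi (1 - x)).

Lemma smooth_step_smooth k : diffn k smooth_step.
Proof.
apply: (@diffn_comp k psi (fun x => psi 1 - psi (1 - x))); first exact: diffn_exp_inv.
have h : diffn k (psi \o (fun x => -1 * x + 1)).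
  by apply: diffn_comp; [exact: diffn_exp_inv|exact: diffn_affine].
have := diffn_comb 1 (-1) (diffn_cst k (psi 1)) h.
by congr diffn; apply/funext => x /=; rewrite mul1r !mulN1r [- x + 1]addrC.
Qed.

Lemma smooth_step_ndecr x y : x <= y -> smooth_step x <= smooth_step y.
Proof. by move=> xy; apply: psi_ndecr; rewrite lerD2l lerN2 psi_ndecr// lerD2l lerN2. Qed.

Lemma smooth_step_le0 x : x <= 0 -> smooth_step x = 0.
Proof.
move=> x0; rewrite /smooth_step {1}/psi /exp_inv ifF//; apply/negbTE; rewrite -leNgt subr_le0.
by apply: psi_ndecr; rewrite lerDl oppr_ge0.
Qed.

Lemma smooth_step_ge1 x : 1 <= x -> smooth_step x = smooth_step 1.
Proof.
move=> x1; rewrite /smooth_step.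
have E y : 1 <= y -> psi (1 - y) = 0.
  by move=> y1; rewrite /psi /exp_inv ifF//; apply/negbTE; rewrite -leNgt subr_le0.
by rewrite !E.
Qed.

Lemma smooth_step1_gt0 : 0 < smooth_step 1.
Proof.
have p1 : 0 < psi 1 by rewrite /psi /exp_inv ltr01 expr0 mul1r expR_gt0.
rewrite /smooth_step subrr; have -> : psi 0 = 0 by rewrite /psi /exp_inv ltxx.
by rewrite subr0 {1}/psi /exp_inv p1 expr0 mul1r expR_gt0.
Qed.

End smooth_functions.

Lemma ae_imp {disp : measure_display} {T : measurableType disp} {R : realType}
    (mu : {measure set T -> \bar R}) (P Q : T -> Prop) :
  (forall x, P x -> Q x) -> {ae mu, forall x, P x} -> {ae mu, forall x, Q x}.
Proof. by move=> PQ; apply: filterS. Qed.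

(** * From the unit measure to Lebesgue measure on ]0, 1[ *)

Section restricted_measure.
Context {R : realType}.
Notation leb := (@lebesgue_measure R).
Notation unitm := (@unit_measure R).

Lemma unit_measureE A : A `<=` `]0, 1[ -> unitm A = leb A.
Proof. by move=> A1; rewrite -[LHS]/(leb (A `&` `]0, 1[)) setIidl. Qed.

Lemma ae_unit_measure (P : R -> Prop) :
  {ae unitm, forall x, P x} -> {ae leb, forall x, `]0, 1[%classic x -> P x}.
Proof.
move=> [N [mN N0 NP]]; exists (N `&` `]0, 1[); split.
- by apply: measurableI => //; exact: measurable_itv.
- exact: N0.
- move=> x /= /not_implyP[x01 Px]; split => //; exact: NP.
Qed.

Lemma unit_measure_itv : {ae unitm, forall x, `]0, 1[%classic x}.
Proof.
exists (~` `]0, 1[%classic); split => //.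
- by apply: measurableC; exact: measurable_itv.
- by rewrite -[LHS]/(leb (~` `]0, 1[ `&` `]0, 1[)) setICl measure0.
Qed.

Lemma integral_unit_measure (f : R -> \bar R) :
  measurable_fun (setT : set (measurableTypeR R)) f ->
  (\int[unitm]_x f x = \int[leb]_(x in `]0%R, 1%R[) f x)%E.
Proof.
move=> mf; have mI : measurable (`]0, 1[ : set (measurableTypeR R)) by exact: measurable_itv.
rewrite -(@eq_measure_integral _ (measurableTypeR R) R (`]0, 1[%classic : set (measurableTypeR R)) leb unitm f); last first.
  by move=> A _; exact: unit_measureE.
rewrite [RHS]integral_mkcond; apply: ae_eq_integral => //.
  by apply/(measurable_restrictT f mI); exact: measurable_funS mf.
apply: ae_imp unit_measure_itv => x x01 _.
by rewrite patchE mem_set.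
Qed.

Lemma is_bochner_unit_measure (X : normedModType R) (f : R -> X) I :
  is_bochner unitm setT f I -> is_bochner leb `]0, 1[ f I.
Proof.
move=> bf; have mf := is_bochner_strongly_measurable bf.
move: bf => [s [ss sD sf sfi sI]]; exists s; split => //.
- move=> n x _; apply: le_lt_trans (lebesgue_oo_fin 0 1).
  have mI : measurable (`]0, 1[ : set (measurableTypeR R)) by exact: measurable_itv.
  apply: le_measure; rewrite ?inE//.
  by apply: (measurableI _ _ mI); exact: (ss n).2.
- by move=> t _; exact: sf.
- rewrite (_ : (fun n => _) = (fun n => \int[unitm]_t `|f t - s n t|%:E)%E)//.
  apply/funext => n; rewrite integral_unit_measure//.
  by apply/measurable_EFinP; exact: strongly_measurable_normsub.
- rewrite (_ : (fun n => _) = (fun n => simple_integral unitm setT (s n)))//.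
  apply/funext => n; apply: eq_fsbigr => x _.
  by rewrite -[in RHS]/(fine (leb ((setT `&` s n @^-1` [set x]) `&` `]0, 1[)) *: x) setTI setIC.
Qed.

Lemma cont_C0_ge0 (X : normedModType R) (f : R -> X) : continuous f -> C0_ge0 f.
Proof. exact: continuous_subspaceT. Qed.

(** A difference at 1 would persist on an interval to the left of 1, which has positive measure.
    This identifies the boundary values of two continuous representatives. *)
Lemma continuous_ae_eq1 (X : normedModType R) (f g : R -> X) :
  continuous f -> continuous g -> {ae unitm, forall x, f x = g x} -> f 1 = g 1.
Proof.
move=> cf cg [N [mN N0 NP]]; apply/eqP; rewrite -subr_eq0 -normr_eq0; apply/negPn/negP => fg1.
have cfg : continuous (fun x => f x - g x) by move=> x; apply: cvgB; [exact: cf|exact: cg].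
have fg0 : 0 < `|f 1 - g 1| by rewrite lt0r fg1 normr_ge0.
have /cvgrPdist_lt/(_ _ fg0)/nbhs_ballP[d /= d0 dP] := cfg 1.
pose a := Num.max 0 (1 - d).
have a1 : a < 1 by rewrite gt_max ltr01 ltrBlDr ltrDl.
have a0 : 0 <= a by rewrite le_max lexx.
have sub : (`]a, 1[ : set R) `<=` N.
  move=> x; rewrite /= in_itv/= => /andP[ax x1]; apply: NP => /= E.
  have := dP x; rewrite E subrr subr0 ltxx => h; have : false by apply: h;
    rewrite /ball /= gtr0_norm ?subr_gt0// ltrBlDr -ltrBlDl (le_lt_trans _ ax)// le_max lexx orbT.
  by [].
have : (leb (`]a, 1%R[%classic : set R) <= unitm N)%E.
  rewrite -unit_measureE; last first.
    by move=> x /=; rewrite !in_itv/= => /andP[ax ->]; rewrite (le_lt_trans a0).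
  by apply: le_measure; rewrite ?inE//; exact: measurable_itv.
by rewrite N0 lebesgue_oo ?(ltW a1)// lee_fin subr_le0 leNgt a1.
Qed.

End restricted_measure.

(** * Fundamental theorem of calculus for right derivatives *)

Section fundamental_theorem.
Context {R : realType} (X : normedModType R).
Hypothesis cX : seq_complete X.
Notation leb := (@lebesgue_measure R).

(** W minus the primitive of u has right derivative 0, hence is constant. *)
Lemma is_bochner_right_deriv (W u : R -> X) b : 0 <= b -> C0_ge0 u -> cont_on 0 b W ->
  (forall t, 0 <= t < b -> right_deriv W t (u t)) -> is_bochner leb `]0, b[ u (W b - W 0).
Proof.
move=> b0 cu cW dW; have [J [JP J0 cJ dJ]] := primitive_exists cX cu.
have cw : cont_on 0 b (fun t => 1 *: W t + (-1) *: J t).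
  by apply: cont_on_comb => //; exact: C0_ge0_cont_on.
have dw t : 0 <= t < b -> right_deriv (fun t => 1 *: W t + (-1) *: J t) t 0.
  move=> tb; have -> : 0 = 1 *: u t + (-1) *: u t by rewrite scale1r scaleN1r subrr.
  by apply: (@right_deriv_comb _ _ 1 (-1) W J); [exact: dW|apply: dJ; case/andP: tb].
have := right_deriv0_cst b0 cw dw.
rewrite J0 scaler0 addr0 !scale1r scaleN1r => E.
have <- : J b = W b - W 0 by rewrite -[W 0]E opprB addrC subrK.
exact: JP.
Qed.

End fundamental_theorem.

(** * Approximate identities *)

Section smooth_kernel.
Context {R : realType}.
Notation Phi := (@smooth_step R).
Notation rho := (derive1 Phi).

Lemma is_derive_smooth_step (x : R) : is_derive x (1 : R) Phi (rho x).
Proof.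
have [f' df _] := @smooth_step_smooth R 1; have h := df x.
by rewrite derive1E; have [_ ->] := h.
Qed.

Lemma derive_smooth_step_cont : continuous rho.
Proof.
have [f' df [f'' df' _]] := @smooth_step_smooth R 2.
have -> : rho = f' by apply/funext => x; rewrite derive1E; have [_ ->] := df x.
by move=> x; apply: differentiable_continuous; apply/derivable1_diffP; have [] := df' x.
Qed.

Lemma derive_smooth_step_ge0 x : 0 <= rho x.
Proof.
have := is_derive_right_deriv (is_derive_smooth_step x); rewrite /right_deriv => h.
apply: (cvgr_to_ge h); near=> k.
have k0 : 0 < k by near: k; exact: nbhs_right_gt.
by rewrite /GRing.scale /= mulr_ge0 ?invr_ge0 ?(ltW k0)// subr_ge0 smooth_step_ndecr// lerDl ltW.
Unshelve. all: by end_near. Qed.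

Lemma derive_smooth_step_out x : x < 0 \/ 1 < x -> rho x = 0.
Proof.
move=> hx; rewrite derive1E.
have [c hc] : exists c, \near x, Phi x = cst c x.
  case: hx => hx; [exists 0|exists (Phi 1)]; near=> y.
    by apply: smooth_step_le0; apply/ltW; near: y; exact: lt_nbhsl.
  by apply: smooth_step_ge1; apply/ltW; near: y; exact: lt_nbhsr.
by rewrite (near_eq_derive _ hc) derive_cst.
Unshelve. all: by end_near. Qed.

Variables (e a : R).
Hypotheses (e0 : 0 < e).

(** The step rescaled to rise between a and a + e. Its derivative [kernel] is supported there and
    has mass Phi 1 for every e, so it approximates Phi 1 times the delta at a. *)
Definition kernel_step s : R := Phi (e^-1 * s + - (a / e)).
Definition kernel s : R := e^-1 * rho (e^-1 * s + - (a / e)).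

Let argE s : e^-1 * s + - (a / e) = (s - a) / e.
Proof. by rewrite mulrBl mulrC. Qed.

Lemma diffn_kernel_step k : diffn k kernel_step.
Proof.
apply: (@diffn_comp _ k Phi (fun s => e^-1 * s + - (a / e))); first exact: smooth_step_smooth.
exact: diffn_affine.
Qed.

Lemma is_derive_kernel_step (s : R) : is_derive s (1 : R) kernel_step (kernel s).
Proof.
have d : is_derive s (1 : R) (fun s => e^-1 * s + - (a / e)) e^-1.
  have := is_deriveD (is_deriveZ e^-1 (is_derive_id s (1 : R))) (is_derive_cst (- (a / e)) s (1 : R)).
  by rewrite addr0 /GRing.scale /= mulr1.
have := @is_derive1_comp _ Phi _ s _ _ (is_derive_smooth_step _) d.
by rewrite /kernel [e^-1 * rho _]mulrC.
Qed.

Lemma kernel_cont : continuous kernel.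
Proof.
move=> s; apply: cvgM; first exact: cvg_cst.
apply: (continuous_comp (f := fun s => e^-1 * s + - (a / e))).
  by apply: cvgD; [apply: cvgM; [exact: cvg_cst|exact: cvg_id]|exact: cvg_cst].
exact: derive_smooth_step_cont.
Qed.

Lemma kernel_ge0 s : 0 <= kernel s.
Proof. by rewrite mulr_ge0 ?invr_ge0 ?(ltW e0)// derive_smooth_step_ge0. Qed.

Lemma kernel_out s : s < a \/ a + e < s -> kernel s = 0.
Proof.
move=> hs; rewrite /kernel argE derive_smooth_step_out ?mulr0//.
case: hs => hs; [left|right]; first by rewrite pmulr_llt0 ?invr_gt0// subr_lt0.
by rewrite ltr_pdivlMr// mul1r ltrBrDl.
Qed.

Lemma kernel_step_le s : s <= a -> kernel_step s = 0.
Proof.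
move=> sa; rewrite /kernel_step argE smooth_step_le0//.
by rewrite pmulr_lle0 ?invr_gt0// subr_le0.
Qed.

Lemma kernel_step_ge s : a + e <= s -> kernel_step s = Phi 1.
Proof.
move=> sa; rewrite /kernel_step argE smooth_step_ge1//.
by rewrite ler_pdivlMr// mul1r lerBrDl.
Qed.

Hypotheses (a0 : 0 < a) (ae1 : a + e <= 1).
Notation leb := (@lebesgue_measure R).

Lemma is_bochner_kernel : is_bochner leb `]0, 1[ (kernel : R -> R^o) (Phi 1).
Proof.
have := @is_bochner_right_deriv R R^o (@seq_complete_real R) kernel_step kernel 1 ler01.
rewrite kernel_step_ge// kernel_step_le ?(ltW a0)// subr0; apply.
- exact: (cont_C0_ge0 kernel_cont).
- apply: C0_ge0_cont_on; apply: cont_C0_ge0 => s.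
  apply: differentiable_continuous; apply/derivable1_diffP.
  by have [] := is_derive_kernel_step s.
- by move=> t _; apply: is_derive_right_deriv; exact: is_derive_kernel_step.
Qed.

Variables (X : normedModType R) (H : R -> X) (eta : R).

(** The kernel is nonnegative, has mass Phi 1 and lives on [a, a + e], so the integral is this mass
    times a mean of H near a. *)
Lemma is_bochner_kernel_close I : is_bochner leb `]0, 1[ (fun s => kernel s *: H s) I ->
  0 <= eta -> (forall s, a <= s <= a + e -> `|H s - H a| <= eta) ->
  `|I - Phi 1 *: H a| <= eta * Phi 1.
Proof.
move=> bI eta0 Heta.
have mI : measurable (`]0, 1[ : set (measurableTypeR R)) by exact: measurable_itv.
have fI := lebesgue_oo_fin (0 : R) 1.
have bk := is_bochner_kernel.
have b1 : is_bochner leb `]0, 1[ (fun s => kernel s *: H a) (Phi 1 *: H a).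
  apply: (is_bochner_map mI fI (phi := fun r : R^o => r *: H a) _ _ bk).
    by move=> r x y; rewrite scalerDl scalerA.
  by exists `|H a| => // x; rewrite normrZ mulrC.
have b2 := is_bochner_comb mI fI (-1) b1 bI.
rewrite addrC -scaleN1r -lee_fin.
apply: (le_trans (is_bochner_seminorm mI fI (norm_bounded_seminorm X) b2)).
have [ik kE] := is_bochner_real mI fI bk.
have -> : ((eta * Phi 1)%:E = \int[leb]_(s in `]0%R, 1%R[) (eta%:E * (kernel s)%:E))%E.
  rewrite integralZl// EFinM; congr (_ * _)%E.
  by rewrite -kE /Rintegral fineK//; exact: integrable_fin_num.
apply: ge0_le_integral => //.
- apply/measurable_EFinP; apply: strongly_measurable_seminorm => //; first exact: norm_bounded_seminorm.
  exact: is_bochner_strongly_measurable b2.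
- have /integrableP[mk _] := ik; exact: measurable_funeM.
- move=> s _; rewrite -EFinM lee_fin scaleN1r addrC -scalerBr normrZ ger0_norm ?kernel_ge0//.
  rewrite mulrC; have [sa|sa] := ltP s a; first by rewrite kernel_out ?mulr0//; left.
  have [sae|sae] := ltP (a + e) s; first by rewrite kernel_out ?mulr0//; right.
  by rewrite ler_wpM2r ?kernel_ge0// Heta// sa.
Qed.

End smooth_kernel.

Lemma C0_ge0_scale (R : realType) (X : normedModType R) (a : R -> R) (u : R -> X) :
  continuous a -> C0_ge0 u -> C0_ge0 (fun s => a s *: u s).
Proof.
move=> ca /(@subspace_continuousP R `[0, +oo[%classic X u) cu.
apply/(@subspace_continuousP R `[0, +oo[%classic X (fun s => a s *: u s)) => t t0.
by apply: cvgZ; [apply: cvg_within_filter; exact: ca|exact: cu].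
Qed.

(** * Weak derivatives with continuous representatives *)

Section weak_derivative.
Context {R : realType} (X : normedModType R).
Hypothesis cX : seq_complete X.
Notation leb := (@lebesgue_measure R).
Notation P := (@smooth_step R 1).
Notation psi := (@kernel_step R).
Notation ker := (@kernel R).

(** Both steps have the same height, so their difference vanishes outside [a, b + e]; its derivative
    is an approximate delta at a minus one at b. *)
Let bump e a b (s : R) := 1 * psi e a s + (-1) * psi e b s.

Let bump_test e a b : 0 < e -> 0 < a -> a < b -> b + e < 1 -> unit_test_function (bump e a b).
Proof.
move=> e0 a0 ab be; split.
  by apply: diffn_derivable => k; apply: diffn_comb; exact: diffn_kernel_step.
exists a, (b + e); split => // s; rewrite in_itv/= negb_and -!ltNge => /orP[sa|sb]; rewrite /bump.
  by rewrite !kernel_step_le ?mulr0 ?addr0// ?(ltW (lt_trans sa ab)) ?(ltW sa).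
rewrite !kernel_step_ge ?mul1r ?mulN1r ?subrr ?(ltW sb)//.
by rewrite (le_trans _ (ltW sb))// lerD2r ltW.
Qed.

Let bump_derive e a b (s : R) : is_derive s (1 : R) (bump e a b) (ker e a s - ker e b s).
Proof.
have -> : ker e a s - ker e b s = 1 *: ker e a s + (-1) *: ker e b s.
  by rewrite scale1r scaleN1r.
exact: (is_deriveD (is_deriveZ 1 (is_derive_kernel_step e a s))
                   (is_deriveZ (-1) (is_derive_kernel_step e b s))).
Qed.

(* du Bois-Reymond: testing against phi with phi' an approximate
   delta_a - delta_b shows that f minus a primitive of g is constant. *)
Lemma weak_derivative_right_deriv (v p : L2 unit_measure X) f g : is_weak_derivative v p ->
  class_of v f -> class_of p g -> continuous f -> continuous g ->
  forall t, 0 <= t < 1 -> right_deriv f t (g t).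
Proof.
move=> [f0 [g0 [vf0 pg0 hw]]] vf pg cf cg.
have mI : measurable (`]0, 1[ : set (measurableTypeR R)) by exact: measurable_itv.
have fI := lebesgue_oo_fin (0 : R) 1.
have [J [_ J0 cJ dJ]] := primitive_exists cX (cont_C0_ge0 cg).
pose H s := 1 *: f s + (-1) *: J s.
have cH : C0_ge0 H by apply: C0_ge0_comb => //; exact: cont_C0_ge0.
have bex (u : R -> X) : C0_ge0 u -> exists I, is_bochner leb `]0, 1[ u I.
  by move=> cu; apply: (cont_on_bochner cX ler01); exact: C0_ge0_cont_on.
(* The weak derivative speaks of some representatives f0 and g0; the integrals are the same for the
   continuous ones. *)
have aeE (w : L2 unit_measure X) (h h0 : R -> X) (a : R -> R) I I0 : class_of w h -> class_of w h0 ->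
    is_bochner unit_measure setT (fun s => a s *: h0 s) I0 ->
    is_bochner leb `]0, 1[ (fun s => a s *: h s) I -> I = I0.
  move=> wh wh0 /is_bochner_unit_measure b0 b1.
  apply: (is_bochner_ae_unique mI fI _ b1 b0).
  have := ae_unit_measure (class_of_ae wh wh0).
  by apply: ae_imp => x hx x01; rewrite hx.
have key a b : 0 < a -> a < b -> b < 1 -> H a = H b.
  move=> a0 ab b1; apply/eqP; rewrite -subr_eq0 -normr_le0; apply/ler_addgt0Pr => eta2 eta20.
  pose eta := eta2 / 2; have eta0 : 0 < eta by rewrite divr_gt0.
  have [da da0 daP] := (C0_ge0P _).1 cH a (ltW a0) eta eta0.
  have [db db0 dbP] := (C0_ge0P _).1 cH b (ltW (lt_trans a0 ab)) eta eta0.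
  pose e := Num.min (Num.min da db) (1 - b) / 2.
  have e20 : 0 < Num.min (Num.min da db) (1 - b) by rewrite !lt_min da0 db0 subr_gt0.
  have e0 : 0 < e by rewrite divr_gt0.
  have : e < Num.min (Num.min da db) (1 - b) by rewrite ltr_pdivrMr// ltr_pMr// ltr1n.
  rewrite !lt_min => /andP[/andP[eda edb] eb]; have be : b + e < 1 by rewrite addrC -ltrBrDr.
  have b0 := lt_trans a0 ab.
  have ae : a + e < 1 by rewrite (lt_trans _ be)// ltrD2r.
  have [Ia bIa] := bex _ (C0_ge0_scale (@kernel_cont R e a) cH).
  have [Ib bIb] := bex _ (C0_ge0_scale (@kernel_cont R e b) cH).
  have Ea := is_bochner_kernel_close e0 a0 (ltW ae) bIa (ltW eta0).
  have Eb := is_bochner_kernel_close e0 b0 (ltW be) bIb (ltW eta0).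
  have tb := bump_test e0 a0 ab be.
  have [I] := hw _ tb.
  have -> : derive1 (bump e a b) = (fun s => ker e a s - ker e b s).
    by apply/funext => s; rewrite derive1E; have [_ ->] := bump_derive e a b s.
  move=> bf0 bg0.
  have cdk : continuous (fun s => ker e a s - ker e b s).
    by move=> s; apply: cvgB; exact: kernel_cont.
  have cbump : continuous (bump e a b).
    move=> s; apply: differentiable_continuous; apply/derivable1_diffP.
    by have [] := bump_derive e a b s.
  have [K bK] := bex _ (C0_ge0_scale cdk (cont_C0_ge0 cf)).
  have [L bL] := bex _ (C0_ge0_scale cbump (cont_C0_ge0 cg)).
  have EK := aeE _ _ _ _ _ _ vf vf0 bf0 bK.
  have EL := aeE _ _ _ _ _ _ pg pg0 bg0 bL.
  have cu : C0_ge0 (fun s => 1 *: (bump e a b s *: g s) + 1 *: ((ker e a s - ker e b s) *: J s)).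
    by apply: C0_ge0_comb; apply: C0_ge0_scale => //; exact: cont_C0_ge0.
  (* Integration by parts of the bump against J: their product vanishes at 0 and at 1, so its
     derivative has integral 0. *)
  have bW := @is_bochner_right_deriv R X cX (fun s => bump e a b s *: J s) _ 1 ler01 cu.
  have W01 : bump e a b 1 *: J 1 - bump e a b 0 *: J 0 = 0.
    have -> : bump e a b 1 = 0.
      by rewrite /bump !kernel_step_ge ?(ltW be) ?(ltW ae)// mul1r mulN1r subrr.
    by rewrite J0 scale0r scaler0 subr0.
  rewrite W01 in bW.
  have {}bW := bW (C0_ge0_cont_on (C0_ge0_scale cbump cJ)).
  have {}bW : is_bochner leb `]0, 1[
      (fun s => 1 *: (bump e a b s *: g s) + 1 *: ((ker e a s - ker e b s) *: J s)) 0.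
    apply: bW => t /andP[t0 _]; rewrite !scale1r.
    apply: right_deriv_scale; last exact: dJ.
    by apply: is_derive_right_deriv; exact: bump_derive.
  have bH := is_bochner_comb mI fI (-1) bW (is_bochner_comb mI fI 1 bL bK).
  have bH' := is_bochner_comb mI fI (-1) bIb bIa.
  have EI : -1 *: Ib + Ia = -1 *: 0 + (1 *: L + K).
    apply: (is_bochner_unique mI fI bH'); apply: is_bochner_ext bH => s _.
    by rewrite /H !scale1r !scaleN1r opprD addrACA addNr add0r addrC -scalerBr scalerBl addrC.
  (* The weak derivative makes K and L opposite, which leaves equal averages of H near a and near
     b. *)
  have : Ia = Ib.
    apply/eqP; rewrite -subr_eq0 addrC -scaleN1r EI EK EL scaler0 add0r scale1r subrr//.
  move=> EIab; rewrite EIab in Ea.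
  have P0 := @smooth_step1_gt0 R.
  rewrite add0r -(ler_pM2l P0) -[X in X * _](gtr0_norm P0) -normrZ scalerBr.
  rewrite -(subrKA Ib) (le_trans (ler_normD _ _))// [X in X + _]distrC.
  have -> : P * eta2 = eta * P + eta * P by rewrite /eta; field.
  apply: lerD.
    apply: Ea => s /andP[as_ sae]; apply: ltW; apply: daP; first by rewrite (le_trans (ltW a0)).
    by rewrite ger0_norm ?subr_ge0// (le_lt_trans _ eda)// lerBlDl.
  apply: Eb => s /andP[as_ sae]; apply: ltW; apply: dbP; first by rewrite (le_trans (ltW b0)).
  by rewrite ger0_norm ?subr_ge0// (le_lt_trans _ edb)// lerBlDl.
(* The kernels reach only points of the open interval; continuity of H extends its constancy to
   0. *)
have H0 t : 0 <= t < 1 -> H t = H 0.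
  rewrite le_eqVlt => /andP[/orP[/eqP <-//|t0] t1].
  apply/eqP; rewrite -subr_eq0 -normr_le0; apply/ler_addgt0Pr => eta eta0.
  have [del del0 delP] := (C0_ge0P _).1 cH 0 (lexx _) eta eta0.
  pose s := Num.min del t / 2; have m0 : 0 < Num.min del t by rewrite lt_min del0.
  have s0 : 0 < s by rewrite divr_gt0.
  have : s < Num.min del t by rewrite ltr_pdivrMr// ltr_pMr// ltr1n.
  rewrite lt_min => /andP[sd st]; rewrite add0r -(key s t s0 st t1); apply/ltW/delP; first exact: ltW.
  by rewrite subr0 gtr0_norm.
move=> t t01; have /right_derivP dt := dJ t (proj1 (andP t01)).
apply/right_derivP => e e0; have [del d0 dP] := dt e e0.
exists (Num.min del (1 - t)); first by rewrite lt_min d0 subr_gt0; case/andP: t01.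
move=> h h0; rewrite lt_min => /andP[hd ht].
have fE s : 0 <= s < 1 -> f s = H 0 + J s.
  by move=> s01; rewrite -(H0 s s01) /H scale1r scaleN1r subrK.
case/andP: (t01) => t0 t1; rewrite !fE ?t01//; last first.
  by rewrite addr_ge0 ?(ltW h0)//= addrC -ltrBrDr.
by rewrite opprD addrACA subrr add0r; exact: dP.
Qed.

End weak_derivative.

(** * Chain rule for a weighted form *)

Section form_chain_rule.
Context {R : realType} (X : normedModType R).
Hypothesis cX : seq_complete X.
Variables (b : X -> X -> R) (C : R).
Hypothesis hb : bounded_form b C.
Variables (k c : R).
Hypothesis k0 : 0 <= k.
Notation leb := (@lebesgue_measure R).
Notation um := (@unit_measure R).
Notation w := (fun s : measurableTypeR R => k * expR (c * s)).

Lemma expR_affine_continuous : continuous (w : R -> R).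
Proof.
move=> s; apply: cvgM; first exact: cvg_cst.
apply: (continuous_comp (f := fun s => c * s)); last exact: continuous_expR.
by apply: cvgM; [exact: cvg_cst|exact: cvg_id].
Qed.

Lemma expR_affine_bound : {ae um, forall s, w s <= k * expR `|c|}.
Proof.
apply: ae_imp unit_measure_itv => s; rewrite /= in_itv/= => /andP[s0 s1].
rewrite ler_wpM2l// ler_expR (le_trans (ler_norm _))// normrM (gtr0_norm s0).
by rewrite ler_piMr// ltW.
Qed.

(** The left-hand side is the integral of the derivative of s -> k e^(cs) b (f s, f s), and the
    right-hand side is formed of its boundary values; the factor c comes from the weight. *)
Lemma L2_form_weak_derivative (v p : L2 um X) (f g : R -> X) : is_weak_derivative v p ->
  class_of v f -> class_of p g -> continuous f -> continuous g ->
  2 * L2_form b w p v + c * L2_form b w v v =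
    k * (expR c * b (f 1) (f 1) - b (f 0) (f 0)).
Proof.
move=> vp vf pg cf cg; have [bC bl bb b0 C0] := hb.
have df := weak_derivative_right_deriv cX vp vf pg cf cg.
have mw : measurable_fun setT (w : measurableTypeR R -> R).
  by apply: continuous_measurable_fun; exact: expR_affine_continuous.
have w0 s : 0 <= w s by rewrite mulr_ge0 ?expR_ge0.
have K0 : 0 <= k * expR `|c| by rewrite mulr_ge0 ?expR_ge0.
have hL := L2_form_bounded hb mw w0 expR_affine_bound K0.
have cz := class_of_comb 2 pg (class_of_comb c vf (class_of0 _ _)).
have -> : 2 * L2_form b w p v + c * L2_form b w v v =
    L2_form b w (2 *: p + (c *: v + 0)) v.
  by rewrite addr0 (bformDl hL) !(bformZl hL).
rewrite (L2_formE hb mw w0 expR_affine_bound K0 cz vf).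
have [iu _] := L2_form_integrable hb mw w0 expR_affine_bound K0 cz vf.
pose u s := w s *: (2 * b (g s) (f s) : R^o) + (c * w s) *: (b (f s) (f s) : R^o).
have uE s : w s * b ((2 *: g + (c *: f + 0)) s) (f s) = u s.
  rewrite -[(2 *: g + _) s]/(2 *: g s + (c *: f s + 0)) addr0 (bformDl hb) !(bformZl hb).
  by rewrite /u /GRing.scale/= mulrDr; congr (_ + _); rewrite mulrCA mulrA.
have cb (h : R -> X) : continuous h -> continuous (fun s => b (h s) (f s) : R^o).
  by move=> ch s; exact: (bform_cvg hb _ (ch s) (cf s)).
have cw := expR_affine_continuous.
have cQ : continuous (fun s => w s *: (b (f s) (f s) : R^o)).
  by move=> s; apply: cvgZ; [exact: cw|exact: cb].
have cu : continuous u.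
  move=> s; apply: cvgD; apply: cvgZ.
  - exact: cw.
  - by apply: cvgM; [exact: cvg_cst|exact: cb].
  - by apply: cvgM; [exact: cvg_cst|exact: cw].
  - exact: cb.
have dw t : right_deriv (w : R -> R^o) t (c * w t).
  have := @right_deriv_comb R R^o k 0 _ _ t _ _ (@right_deriv_expR R c t) (@right_deriv_expR R c t).
  rewrite scale0r addr0 -[k *: _]/(k * (c * expR (c * t))) mulrCA.
  by apply: right_deriv_ext => s _; rewrite scale0r addr0.
have := @is_bochner_right_deriv R R^o (@seq_complete_real R) _ _ 1 ler01 (cont_C0_ge0 cu)
  (C0_ge0_cont_on (cont_C0_ge0 cQ)).
have -> : w 1 *: (b (f 1) (f 1) : R^o) - w 0 *: (b (f 0) (f 0) : R^o) =
    k * (expR c * b (f 1) (f 1) - b (f 0) (f 0)).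
  by rewrite mulr1 mulr0 expR0 mulr1 mulrBr mulrA.
move=> hB; have {}hB : is_bochner leb `]0, 1[ u (k * (expR c * b (f 1) (f 1) - b (f 0) (f 0))).
  apply: hB => t t01; apply: right_deriv_scale; first exact: dw.
  exact: right_deriv_form (df t t01).
have mI : measurable (`]0, 1[ : set (measurableTypeR R)) by exact: measurable_itv.
have [_ <-] := is_bochner_real mI (lebesgue_oo_fin 0 1) hB.
rewrite /Rintegral integral_unit_measure; last by have /integrableP[] := iu.
by congr fine; apply: eq_integral => s _; rewrite /= uE.
Qed.

End form_chain_rule.

(** * Dissipativity *)

(* AM-GM with weights d1 / (3 |c2|) and d1 / (3 |d2|) spends two thirds of
   d1 * gw on the cross terms; as xi |d2| = d1 / 3, the boundary term at s = 0
   costs only another sixth. *)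
Lemma dissipation_inequality (R : realType) (c1 c2 d1 d2 tau c ec g11 L22 gw G3 G4 W3 W4 g3 g4 : R) :
  0 < c1 -> c2 != 0 -> 0 < d1 -> d2 != 0 -> 0 < tau ->
  9 * c2 ^+ 2 * `|d2| / d1 ^+ 3 <= ec -> 9 * d2 ^+ 2 / d1 ^+ 2 <= ec ->
  0 <= g11 -> 0 <= L22 -> 0 <= gw -> 0 <= G3 -> 0 <= G4 -> 0 <= W3 -> 0 <= W4 ->
  (forall l, 0 < l -> `|g3| <= l * gw + G3 / (4 * l)) ->
  (forall l, 0 < l -> `|g4| <= l * gw + G4 / (4 * l)) ->
  - (c2 * g3 + d1 * gw + d2 * g4)
    - d1 * ((xi d1 d2 * (ec * G3 - g11) - c * W3) / 2)
    - `|d2| * ((xi d1 d2 * (ec * G4 - gw) - c * W4) / 2)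
  <= (`|c| / (2 * tau) + d1 * xi d1 d2 / (2 * c1)) *
     (c1 * g11 + L22 + tau * d1 * W3 + tau * `|d2| * W4).
Proof.
move=> hc1 hc2 hd1 hd2 ht e1 e2 g110 L220 gw0 G30 G40 W30 W40 h3 h4.
have C0 : 0 < `|c2| by rewrite normr_gt0.
have D0 : 0 < `|d2| by rewrite normr_gt0.
have xi0 : 0 < xi d1 d2 by rewrite divr_gt0// mulr_gt0.
have xiE : xi d1 d2 * `|d2| = d1 / 3 by rewrite /xi; field; rewrite gt_eqF.
rewrite -(real_normK (num_real c2)) in e1; rewrite -(real_normK (num_real d2)) in e2.
have cross3 : - (c2 * g3) <= d1 / 3 * gw + d1 * xi d1 d2 * ec / 2 * G3.
  apply: (le_trans (ler_norm _)); rewrite normrN normrM.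
  apply: (le_trans (ler_wpM2l (ltW C0) (h3 (d1 / (3 * `|c2|)) _))); first by rewrite divr_gt0 ?mulr_gt0.
  (* By [e1] the term in G3 is at most half of d1 xi ec G3 / 2, the boundary term available at s =
     1. *)
  have -> : `|c2| * (d1 / (3 * `|c2|) * gw + G3 / (4 * (d1 / (3 * `|c2|)))) =
      d1 / 3 * gw + d1 * xi d1 d2 / 2 * (9 * `|c2| ^+ 2 * `|d2| / d1 ^+ 3) / 2 * G3.
    by rewrite /xi; field; rewrite !gt_eqF.
  rewrite lerD2l ler_wpM2r//.
  have p : 0 < d1 * xi d1 d2 / 2 by rewrite divr_gt0// mulr_gt0.
  have ec0 : 0 <= ec.
    apply: le_trans e1; apply: divr_ge0; last by rewrite exprn_ge0// ltW.
    by rewrite !mulr_ge0.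
  by move: (ler_wpM2l (ltW p) e1) (mulr_ge0 (ltW p) ec0); lra.
have cross4 : - (d2 * g4) <= d1 / 3 * gw + d1 / 3 * ec / 2 * G4.
  apply: (le_trans (ler_norm _)); rewrite normrN normrM.
  apply: (le_trans (ler_wpM2l (ltW D0) (h4 (d1 / (3 * `|d2|)) _))); first by rewrite divr_gt0 ?mulr_gt0.
  have -> : `|d2| * (d1 / (3 * `|d2|) * gw + G4 / (4 * (d1 / (3 * `|d2|)))) =
      d1 / 3 * gw + d1 / 12 * (9 * `|d2| ^+ 2 / d1 ^+ 2) * G4.
    by field; rewrite !gt_eqF.
  rewrite lerD2l ler_wpM2r//.
  have ec0 : 0 <= ec.
    apply: le_trans e2; apply: divr_ge0; last by rewrite exprn_ge0// ltW.
    by rewrite !mulr_ge0.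
  have p : 0 <= d1 / 12 by rewrite divr_ge0// ltW.
  by move: (ler_wpM2l p e2) (mulr_ge0 p ec0); lra.
have first_term : - (c2 * g3 + d1 * gw + d2 * g4)
    - d1 * ((xi d1 d2 * (ec * G3 - g11) - c * W3) / 2)
    - `|d2| * ((xi d1 d2 * (ec * G4 - gw) - c * W4) / 2)
    = - (c2 * g3) - (d2 * g4) - d1 * gw - d1 * xi d1 d2 * ec / 2 * G3
      - (xi d1 d2 * `|d2|) * ec / 2 * G4 + (xi d1 d2 * `|d2|) / 2 * gw
      + d1 * xi d1 d2 / 2 * g11 + c * (d1 * W3 + `|d2| * W4) / 2 by field.
rewrite first_term xiE.
have cW : c * (d1 * W3 + `|d2| * W4) <= `|c| * (d1 * W3 + `|d2| * W4).
  by rewrite ler_wpM2r ?ler_norm// addr_ge0// mulr_ge0// ltW.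
have -> : (`|c| / (2 * tau) + d1 * xi d1 d2 / (2 * c1)) *
     (c1 * g11 + L22 + tau * d1 * W3 + tau * `|d2| * W4) =
  `|c| * (d1 * W3 + `|d2| * W4) / 2 + d1 * xi d1 d2 / 2 * g11 +
  (`|c| / (2 * tau) * (c1 * g11 + L22) + d1 * xi d1 d2 / (2 * c1) * (L22 + tau * d1 * W3 + tau * `|d2| * W4)).
  by field; rewrite !gt_eqF.
have r1 : 0 <= `|c| / (2 * tau) * (c1 * g11 + L22).
  by rewrite mulr_ge0 ?divr_ge0 ?addr_ge0 ?mulr_ge0// ltW.
have r2 : 0 <= d1 * xi d1 d2 / (2 * c1) * (L22 + tau * d1 * W3 + tau * `|d2| * W4).
  by rewrite mulr_ge0 ?divr_ge0 ?addr_ge0 ?mulr_ge0// ltW.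
have r3 : 0 <= d1 * gw by rewrite mulr_ge0// ltW.
by move: cross3 cross4; lra.
Qed.

Section dissipativity.
Context {R : realType} {d : nat}.
Variables Omega Gamma0 : set 'rV[R]_d.+1.
Variables c1 c2 d1 d2 tau c : R.
Hypotheses (hc1 : 0 < c1) (hd1 : 0 < d1) (hc2 : c2 != 0) (hd2 : d2 != 0) (htau : 0 < tau).
Hypothesis hc : ln (Num.max (9 * c2 ^+ 2 * `|d2| / d1 ^+ 3) (9 * d2 ^+ 2 / d1 ^+ 2)) < c.
Notation HG := (H1_Gamma0 Omega Gamma0).
Notation um := (@unit_measure R).
Notation g := (@grad_prod R d Omega Gamma0).
Notation W := (@weighted_prod R d Omega Gamma0 d1 d2 c).
Hypothesis cHG : seq_complete HG.

(** Since w = - p / tau, the left-hand side is - W (v, p), which the chain rule evaluates. The value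
    y of w at 0 comes with a continuous representative of w, hence of p. *)
Lemma weighted_prod_weak_derivative (v p w : L2 um HG) x0 x1 y :
  is_weak_derivative v p -> w = - tau^-1 *: p ->
  value_at v 0 x0 -> value_at v 1 x1 -> value_at w 0 y ->
  tau * W v w = - ((xi d1 d2 * (expR c * g x1 x1 - g x0 x0) - c * W v v) / 2).
Proof.
move=> vp wE [f [cf vf f0]] [f' [cf' vf' f'1]] [h [ch wh h0]].
have [C hW] := weighted_prod_bounded_form Omega Gamma0 d2 c hd1.
have pE : p = (- tau) *: w + 0.
  by rewrite addr0 wE scalerA mulrNN divff ?scale1r// gt_eqF.
have ph := class_of_comb (- tau) wh (class_of0 um HG).
rewrite -pE in ph.
have xi0 : 0 <= xi d1 d2 by rewrite divr_ge0 ?mulr_ge0// ltW.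
have cg : continuous (- tau *: h + 0).
  by move=> s; apply: cvgD; [apply: cvgZr; exact: ch|exact: cvg_cst].
have := L2_form_weak_derivative cHG (grad_prod_bounded_form Omega Gamma0) c xi0 vp vf ph cf cg.
rewrite -[L2_form _ _ p v]/(W p v) -[L2_form _ _ v v]/(W v v).
(* The values at 0 and at 1 are read on possibly different continuous representatives; these agree
   at 1. *)
rewrite f0 (_ : f 1 = x1); last first.
  by rewrite -f'1; apply: continuous_ae_eq1 => //; exact: class_of_ae vf vf'.
rewrite pE addr0 (bformZl hW); have [-> _ _ _ _] := hW => E.
rewrite -E; move: (W w v) (W v v) => a b; by field.
Qed.

Lemma energy_prod_dissipative V V' V'' : operatorA c1 c2 d1 d2 tau V V' ->
  operatorA c1 c2 d1 d2 tau V' V'' ->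
  @energy_prod R d Omega Gamma0 c1 d1 d2 tau c V V' <=
  (`|c| / (2 * tau) + d1 * xi d1 d2 / (2 * c1)) * energy_prod c1 d1 d2 tau c V V.
Proof.
case: V V' V'' => [[[v1 v2] v3] v4] [[[w1 w2] w3] w4] [[[z1 z2] z3] z4].
move=> [x3 [x4 [p3 [p4 [wv [v30 v31 v40 v41] [_ green] [p3v w3E] [p4v w4E]]]]]].
(* Membership of V' in the domain supplies continuous representatives of w3 and w4. *)
move=> [y3 [y4 [q3 [q4 [_ [w30 _ w40 _] _ _ _]]]]].
have E3 := weighted_prod_weak_derivative p3v w3E v30 v31 w30.
have E4 := weighted_prod_weak_derivative p4v w4E v40 v41 w40.
have hg := grad_prod_bounded_form Omega Gamma0; have [gC _ _ g0 _] := hg.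
have [L2C _ _ L20 _] := L2_prod_bounded_form Omega.
have [C [_ _ _ W0 _]] := weighted_prod_bounded_form Omega Gamma0 d2 c hd1.
have cross x l : 0 < l -> `|g x w1| <= l * g w1 w1 + g x x / (4 * l).
  by rewrite gC; exact: bform_amgm hg _ _ _.
have m1 : 0 < 9 * c2 ^+ 2 * `|d2| / d1 ^+ 3.
  rewrite divr_gt0 ?exprn_gt0// mulr_gt0 ?normr_gt0//; apply: mulr_gt0 => //.
  by rewrite exprn_even_gt0.
have em : Num.max (9 * c2 ^+ 2 * `|d2| / d1 ^+ 3) (9 * d2 ^+ 2 / d1 ^+ 2) < expR c.
  have m0 : 0 < Num.max (9 * c2 ^+ 2 * `|d2| / d1 ^+ 3) (9 * d2 ^+ 2 / d1 ^+ 2) by rewrite lt_max m1.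
  by rewrite -[ltLHS](lnK m0) ltr_expR.
move: em; rewrite gt_max => /andP[/ltW e1 /ltW e2].
have h := dissipation_inequality c hc1 hc2 hd1 hd2 htau e1 e2 (g0 v1) (L20 v2) (g0 w1) (g0 x3) (g0 x4)
  (W0 v3) (W0 v4) (cross x3) (cross x4).
rewrite /energy_prod; apply: le_trans h.
rewrite -[tau * d1 * _]mulrA [tau * _]mulrCA E3 -[tau * `|d2| * _]mulrA [tau * _]mulrCA E4.
(* Green's formula is tested with w1, the copy of v2 in H^1_Gamma0; its term in c1 cancels the first
   summand of the energy product. *)
rewrite (L2C v2 w2) -wv (green w1) !(bformDl hg) !(bformZl hg).
move: (g v1 w1) (g x3 w1) (g w1 w1) (g x4 w1) (g x3 x3) (g v1 v1) (g x4 x4) (W v3 v3) (W v4 v4).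
move=> a1 a2 a3 a4 a5 a6 a7 a8 a9; move: (xi _ _) (expR _) `|d2| => X e D.
rewrite le_eqVlt; apply/orP; left; apply/eqP; ring.
Qed.

End dissipativity.

Theorem theorem2p2 (R : realType) (d : nat)
    (Omega Gamma0 Gamma1 : set 'rV[R]_d.+1) (c1 c2 d1 d2 tau c : R)
    (hOmega : lipschitz_domain Omega)
    (hGamma0 : relatively_open (boundary Omega) Gamma0)
    (hGamma1 : relatively_open (boundary Omega) Gamma1)
    (hcover : boundary Omega = closure Gamma0 `|` closure Gamma1)
    (hdisjoint : closure Gamma0 `&` closure Gamma1 = set0)
    (hnonempty : Gamma0 !=set0)
    (hc1 : 0 < c1) (hd1 : 0 < d1) (hc2 : c2 != 0) (hd2 : d2 != 0)
    (htau : 0 < tau)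
    (hc : ln (Num.max (9 * c2 ^+ 2 * `|d2| / d1 ^+ 3) (9 * d2 ^+ 2 / d1 ^+ 2)) < c)
    (expA : R -> phase Omega Gamma0 -> phase Omega Gamma0)
    (hS : C0_semigroup expA)
    (hgen : generates (@operatorA R d Omega Gamma0 c1 c2 d1 d2 tau) expA) :
  exists M omega : R, [/\ 0 < M, 0 < omega &
    forall (V0 : phase Omega Gamma0) (F : R -> phase Omega Gamma0), L2loc F ->
    exists V : R -> phase Omega Gamma0,
      [/\ mild_solution expA V0 F V,
          forall W, mild_solution expA V0 F W -> forall t, 0 <= t -> W t = V t,
          forall T t, 0 < T -> 0 <= t <= T ->
            energy_norm c1 d1 d2 tau c (V t) <=
              M * expR (omega * T) * energy_norm c1 d1 d2 tau c V0 +
              M * expR (omega * T) *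
                Num.sqrt (\int[lebesgue_measure]_(s in `]0, T[)
                            energy_norm c1 d1 d2 tau c (F s) ^+ 2) &
          op_domain (operatorA c1 c2 d1 d2 tau) V0 ->
          C1_ge0 F \/ C0_ge0_domain (operatorA c1 c2 d1 d2 tau) F ->
          classical_solution (operatorA c1 c2 d1 d2 tau) V0 F V]].
Proof.
have [_ _ _ bO _] := hOmega.
have [C hB] := energy_prod_bounded_form Omega Gamma0 d2 c hc1 hd1 htau.
pose w := `|c| / (2 * tau) + d1 * xi d1 d2 / (2 * c1).
have xi0 : 0 <= xi d1 d2 by rewrite divr_ge0 ?mulr_ge0// ltW.
have w0 : 0 <= w by rewrite addr_ge0// divr_ge0 ?mulr_ge0// ltW.
(* The estimate stays in the energy norm on both sides, so no constant of equivalence enters M. *)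
exists 1, (w + 1); split => //; first by rewrite ltr_wpDl.
move=> V0 F hF.
have Bdiss V V' V'' : @operatorA R d Omega Gamma0 c1 c2 d1 d2 tau V V' ->
    operatorA c1 c2 d1 d2 tau V' V'' ->
    energy_prod c1 d1 d2 tau c V V' <= w * energy_prod c1 d1 d2 tau c V V.
  by apply: energy_prod_dissipative => //; exact: seq_complete_H1_Gamma0.
have [V [Vmild Vuniq Vest Vcl]] := abstract_cauchy_wellposed (seq_complete_phase bO) hS hgen hB Bdiss w0 V0 hF.
by exists V; split => // T t; rewrite !mul1r; exact: Vest.
Qed.
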